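(* Let $M$ be a Hausdorff, connected, smooth, compact $m$-dimensional manifold endowed with a linear connection $\nabla$, and let $p \in M$. Let $\mathrm{Hol}_p(\nabla)$ be the holonomy group of $\nabla$ at $p$, regarded as a subgroup of the group $\mathrm{Gl}(T_pM)$ of all linear automorphisms of the tangent space $T_pM$. If $\mathrm{Hol}_p(\nabla)$ has compact closure in $\mathrm{Gl}(T_pM)$, then $(M,\nabla)$ is geodesically complete.
   Context: A manifold is understood in the usual sense (without boundary). A linear connection $\nabla$ on $M$ is a smooth (affine) connection on the tangent bundle $TM$; it is not assumed to be flat, torsion-free, or compatible with any metric. For a piecewise smooth curve $\alpha:[a,b]\to M$, $\tau_\alpha: T_{\alpha(a)}M\to T_{\alpha(b)}M$ denotes the $\nabla$-parallel transport along $\alpha$. The holonomy group at $p$ is $\mathrm{Hol}_p(\nabla)=\{\tau_\alpha : \alpha \text{ a piecewise smooth loop in } M \text{ based at } p\}\subset \mathrm{Gl}(T_pM)$ (all loops, not only null-homotopic ones). $\mathrm{Gl}(T_pM)$ carries its usual Lie group topology. A geodesic is a smooth curve $\gamma$ with $\nabla_{\gamma'}\gamma'=0$, and $(M,\nabla)$ is geodesically complete if every maximal (inextensible) geodesic of $\nabla$ is defined on all of $\mathbb{R}$. *)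

(* Defs.v *)
From HB Require Import structures.
From mathcomp Require Import all_boot all_order all_algebra.
From mathcomp Require Import all_classical all_reals all_analysis.
Import Order.TTheory GRing.Theory Num.Theory.
Import numFieldNormedType.Exports.

Set Implicit Arguments.
Unset Strict Implicit.
Unset Printing Implicit Defensive.

Local Open Scope classical_set_scope.
Local Open Scope ring_scope.

Section Smooth.
Variables (R : realType) (V W : normedModType R).

Fixpoint Ck (k : nat) (U : set V) (f : V -> W) : Prop :=
  match k with
  | 0%N => forall x, U x -> {for x, continuous f}
  | k'.+1 => (forall x, U x -> differentiable f x) /\
             (forall v, Ck k' U ('D_v f))
  end.

(* Meant for open [U]: [f] is a total function whose values off [U] are
   irrelevant. *)
Definition smooth_on (U : set V) (f : V -> W) : Prop := forall k, Ck k U f.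

End Smooth.

Fact diff_comp_near (R : realType) (U V W : normedModType R)
    (f : U -> V) (g : V -> W) (h : U -> W) (x w : U) :
  differentiable f x -> differentiable g (f x) -> differentiable h x ->
  (\forall y \near x, h y = g (f y)) ->
  'd h x w = 'd g (f x) ('d f x w).
Proof.
move=> df dg dh hE.
rewrite -[RHS]/(('d g (f x) \o 'd f x) w) -diff_comp//.
rewrite -!deriveE//; last exact: differentiable_comp.
exact: near_eq_derive.
Qed.

Section Charts.
Variables (R : realType) (m : nat) (M : topologicalType).

(* A homeomorphism [cmap] from the open set [cdom] onto an open subset of R^m,
   with inverse [cinv]; both are total functions, with irrelevant values off
   their domains. *)
Record chart := Chart {
  cdom : set M;
  cmap : M -> 'rV[R]_m;
  cinv : 'rV[R]_m -> M;
  cdom_open : open cdom;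
  cimg_open : open (cmap @` cdom);
  cmapK : forall x, cdom x -> cinv (cmap x) = x;
  cmap_continuous : {within cdom, continuous cmap};
  cinv_continuous : {within cmap @` cdom, continuous cinv}
}.

Definition cimg (c : chart) : set 'rV[R]_m := cmap c @` cdom c.

Definition transition (c c' : chart) : 'rV[R]_m -> 'rV[R]_m :=
  cmap c' \o cinv c.

Record smooth_atlas := SmoothAtlas {
  chart_index : Type;
  chart_of :> chart_index -> chart;
  chart_at : M -> chart_index;
  chart_atP : forall p, cdom (chart_of (chart_at p)) p;
  transition_smooth : forall i j,
    smooth_on (cmap (chart_of i) @` (cdom (chart_of i) `&` cdom (chart_of j)))
              (transition (chart_of i) (chart_of j))
}.

End Charts.

Section TangentSpace.
Variables (R : realType) (m : nat) (M : topologicalType).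
Variable A : smooth_atlas R m M.

(* A tangent vector at [p] is the family of its coordinate vectors in all the
   charts around [p], related by the differentials of the changes of charts;
   the entries at the other charts are set to 0. *)
Definition is_tangent (p : M) : {pred chart_index A -> 'rV[R]_m} := fun v =>
  `[< (forall i j, cdom (A i) p -> cdom (A j) p ->
         v j = 'd (transition (A i) (A j)) (cmap (A i) p) (v i)) /\
      (forall i, ~ cdom (A i) p -> v i = 0) >].

Fact is_tangent_submod_closed p : submod_closed (is_tangent p).
Proof.
split=> [|a u v /asboolP[u1 u2] /asboolP[v1 v2]].
  by apply/asboolP; split=> // i j _ _; rewrite linear0.
apply/asboolP; split=> [i j pi pj|i pi].
  rewrite -[LHS]/(a *: u j + v j) -[X in _ = _ X]/(a *: u i + v i) linearP.
  by rewrite -u1// -v1.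
by rewrite -[LHS]/(a *: u i + v i) u2// v2// scaler0 addr0.
Qed.

HB.instance Definition _ p :=
  GRing.isSubmodClosed.Build R (chart_index A -> 'rV[R]_m) (is_tangent p)
    (is_tangent_submod_closed p).

Record tangent (p : M) := Tangent {
  tcoord : chart_index A -> 'rV[R]_m;
  tcoordP : tcoord \in is_tangent p
}.

HB.instance Definition _ p := [isSub for @tcoord p].
HB.instance Definition _ p := [Choice of tangent p by <:].
HB.instance Definition _ p := [SubChoice_isSubLmodule of tangent p by <:].

Fact transition_diff p i j k :
  cdom (A i) p -> cdom (A j) p -> cdom (A k) p -> forall w,
  'd (transition (A i) (A k)) (cmap (A i) p) w =
  'd (transition (A j) (A k)) (cmap (A j) p)
     ('d (transition (A i) (A j)) (cmap (A i) p) w).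
Proof.
have dT : forall i j, cdom (A i) p -> cdom (A j) p ->
    differentiable (transition (A i) (A j)) (cmap (A i) p).
  move=> i' j' pi pj; have [+ _] := transition_smooth i' j' 1.
  by apply; exists p.
move=> pi pj pk w; set x := cmap (A i) p.
have fx : transition (A i) (A j) x = cmap (A j) p.
  by rewrite /transition/= cmapK.
rewrite -[in RHS]fx; apply: diff_comp_near; rewrite ?fx; try exact: dT.
have xi : cimg (A i) x by exists p.
have cx : {for x, continuous (cinv (A i))}.
  have := @cinv_continuous _ _ _ (A i).
  rewrite continuous_open_subspace; last exact: cimg_open.
  by apply; rewrite inE.
have : \forall y \near x, cdom (A j) (cinv (A i) y).
  apply: cx; apply: open_nbhs_nbhs; split; first exact: cdom_open.
  by rewrite /x cmapK.
by apply: filterS => y yj; rewrite /transition/= cmapK.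
Qed.

Definition smooth_fun (f : M -> R) : Prop :=
  forall i, smooth_on (cimg (A i)) (f \o cinv (A i) : 'rV[R]_m -> R^o).

Record vector_field := VectorField {
  vf_fun :> forall p, tangent p;
  vf_smooth : forall i,
    smooth_on (cimg (A i)) (fun x => tcoord (vf_fun (cinv (A i) x)) i)
}.

Definition dirderiv (p : M) (v : tangent p) (f : M -> R) : R :=
  let c := chart_at A p in
  'd (f \o cinv (A c) : 'rV[R]_m -> R^o) (cmap (A c) p) (tcoord v c).

Definition smooth_curve (U : set R) (gamma : R -> M) : Prop :=
  (forall t, U t -> {for t, continuous gamma}) /\
  (forall i, smooth_on (U `&` gamma @^-1` cdom (A i))
                       (cmap (A i) \o gamma : R^o -> 'rV[R]_m)).

Definition velocity (gamma : R -> M) (t : R) : chart_index A -> 'rV[R]_m :=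
  fun i =>
  if `[< cdom (A i) (gamma t) >] then derive1 (cmap (A i) \o gamma) t else 0.

End TangentSpace.

Section Connection.
Variables (R : realType) (m : nat) (M : topologicalType).
Variable A : smooth_atlas R m M.

(* The axioms speak of sums and multiples of vector fields pointwise. *)
Record connection := Connection {
  nabla :> vector_field A -> vector_field A -> vector_field A;
  nablaDl : forall X X1 X2 Y : vector_field A,
    (forall p, X p = X1 p + X2 p) ->
    forall p : M, nabla X Y p = nabla X1 Y p + nabla X2 Y p;
  nablaZl : forall (f : M -> R) (X X1 Y : vector_field A), smooth_fun A f ->
    (forall p, X p = f p *: X1 p) ->
    forall p : M, nabla X Y p = f p *: nabla X1 Y p;
  nablaDr : forall X Y Y1 Y2 : vector_field A,
    (forall p, Y p = Y1 p + Y2 p) ->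
    forall p : M, nabla X Y p = nabla X Y1 p + nabla X Y2 p;
  nabla_Leibniz : forall (f : M -> R) (X Y Y1 : vector_field A),
    smooth_fun A f -> (forall p, Y p = f p *: Y1 p) ->
    forall p : M, nabla X Y p = dirderiv (X p) f *: Y1 p + f p *: nabla X Y1 p
}.

Variable D : connection.

(* [w] is the covariant derivative at [t] of the field [V] along [gamma].  The
   operator D/dt is determined by additivity, the Leibniz rule and
   D(E o gamma)/dt = nabla_X E for global fields E and X with
   X (gamma t) = gamma' t; hence it is computed by writing
   V = \sum_j a_j (E_j o gamma) near [t]. *)
Definition is_covD (gamma : R -> M) (V : forall t, tangent A (gamma t))
    (t : R) (w : tangent A (gamma t)) : Prop :=
  exists (n : nat) (a : 'I_n -> R -> R^o) (E : 'I_n -> vector_field A)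
         (X : vector_field A),
    [/\ forall j, derivable (a j : R^o -> R^o) t 1,
        \forall s \near t, V s = \sum_j a j s *: E j (gamma s),
        tcoord (X (gamma t)) = velocity gamma t &
        w = \sum_j (derive1 (a j) t *: E j (gamma t) +
                    a j t *: D X (E j) (gamma t))].

Definition parallel_on (U : set R) (gamma : R -> M)
    (V : forall t, tangent A (gamma t)) : Prop :=
  forall t, U t -> is_covD V (0 : tangent A (gamma t)).

(* A smooth curve on a compact interval is one that extends smoothly to a
   neighbourhood of it. *)
Definition smooth_piece (alpha : R -> M) (c d : R) : Prop :=
  exists (U : set R) (beta : R -> M),
    [/\ open U, `[c, d] `<=` U, smooth_curve A U beta &
        {in `[c, d], beta =1 alpha}].

Definition parallel_piece (alpha : R -> M)
    (V : forall t, tangent A (alpha t)) (c d : R) : Prop :=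
  exists (U : set R) (beta : R -> M) (W : forall t, tangent A (beta t)),
    [/\ open U, `[c, d] `<=` U, smooth_curve A U beta, parallel_on U W &
        {in `[c, d], forall t,
           beta t = alpha t /\ tcoord (W t) = tcoord (V t)}].

Definition subdivision (a b : R) (n : nat) (s : nat -> R) : Prop :=
  [/\ s 0%N = a, s n = b & forall k, (k < n)%N -> s k < s k.+1].

Definition piecewise_smooth (alpha : R -> M) (a b : R) : Prop :=
  exists n s, subdivision a b n s /\
    forall k, (k < n)%N -> smooth_piece alpha (s k) (s k.+1).

Definition parallel_along (alpha : R -> M) (a b : R)
    (V : forall t, tangent A (alpha t)) : Prop :=
  exists n s, subdivision a b n s /\
    forall k, (k < n)%N -> parallel_piece V (s k) (s k.+1).

(* [tau] is the parallel transport from [p = alpha a] to [q = alpha b]; vectors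
   at propositionally equal points are compared through their coordinates. *)
Definition is_parallel_transport (alpha : R -> M) (a b : R) (p q : M)
    (tau : tangent A p -> tangent A q) : Prop :=
  [/\ alpha a = p, alpha b = q &
      forall v, exists V : forall t, tangent A (alpha t),
        [/\ parallel_along a b V,
            tcoord (V a) = tcoord v & tcoord (V b) = tcoord (tau v)]].

End Connection.

Section GeneralLinear.
Variables (R : realType) (m : nat) (M : topologicalType).
Variables (A : smooth_atlas R m M) (p : M).

Record GL := MkGL {
  GL_fun :> tangent A p -> tangent A p;
  GL_linear : linear GL_fun;
  GL_bij : bijective GL_fun
}.

Let c := chart_at A p.

Definition frame_coord (k : 'I_m) : chart_index A -> 'rV[R]_m := fun j =>
  if `[< cdom (A j) p >]
  then 'd (transition (A c) (A j)) (cmap (A c) p) (delta_mx 0 k) else 0.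

Fact frame_subproof k : frame_coord k \in is_tangent p.
Proof.
apply/asboolP; split=> [i j pi pj|i pi]; last by rewrite /frame_coord asboolF.
rewrite /frame_coord !asboolT//; apply: transition_diff => //.
exact: chart_atP.
Qed.

(* The coordinate vector field d/dx_k of the chart [chart_at A p], at [p]. *)
Definition frame (k : 'I_m) : tangent A p := Tangent (frame_subproof k).

(* Row convention: row [k] holds the coordinates of [g (frame k)]. *)
Definition GL_mx (g : GL) : 'M[R]_m :=
  \matrix_(k, l) tcoord (g (frame k)) c 0 l.

HB.instance Definition _ := gen_eqMixin GL.
HB.instance Definition _ := gen_choiceMixin GL.
(* GL (T_p M) with the topology it has as a subset of the m x m matrices. *)
HB.instance Definition _ := Topological.copy GL (initial_topology GL_mx).

End GeneralLinear.

Section Statement.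
Variables (R : realType) (m : nat) (M : topologicalType).
Variables (A : smooth_atlas R m M) (D : connection A).

Definition holonomy (p : M) : set (GL A p) :=
  [set g : GL A p | exists (alpha : R -> M) (a b : R),
     [/\ a < b, piecewise_smooth A alpha a b &
         is_parallel_transport D alpha a b g]].

Definition open_interval (J : set R) : Prop :=
  [/\ open J, is_interval J & J !=set0].

Definition geodesic (J : set R) (gamma : R -> M) : Prop :=
  [/\ open_interval J, smooth_curve A J gamma &
      exists V : forall t, tangent A (gamma t),
        (forall t, J t -> tcoord (V t) = velocity gamma t) /\
        parallel_on D J V].

Definition maximal_geodesic (J : set R) (gamma : R -> M) : Prop :=
  geodesic J gamma /\
  forall (J' : set R) (gamma' : R -> M),
    geodesic J' gamma' -> J `<=` J' -> (forall t, J t -> gamma' t = gamma t) ->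
    J' = J.

Definition geodesically_complete : Prop :=
  forall (J : set R) (gamma : R -> M), maximal_geodesic J gamma -> J = setT.

End Statement.

Arguments holonomy {R m M A} D p.
Arguments is_covD {R m M A} D {gamma} V {t} w.
Arguments GL_mx {R m M A p} g.

(* Main.v *)
(** Let gamma be a maximal geodesic whose domain J has a finite end b.  By
    compactness of M, gamma(t) accumulates at some point q as t tends to b.  The
    velocity is parallel along gamma, so for gamma(t) near q it is obtained from
    one fixed vector at p by an element of the holonomy group at p (go from p to
    gamma(t0), along gamma to gamma(t), radially to q, and back to p) followed by
    maps that are bounded independently of t.  As the holonomy group is relatively
    compact, the velocity is bounded by some C in the chart at q whenever gamma(t)
    is near q.  Geodesics that start near q with velocity at most C live for a
    uniform time e, and the one that starts with the data of gamma at a time t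
    with |t - b| < e extends gamma beyond b.

    The connection is an operator on global vector fields; bump functions show
    that it is local and given by Christoffel symbols near each point.  Parallel
    fields and geodesics are then solutions of ordinary differential equations,
    obtained by Picard iteration. *)

Require Import Defs.
From HB Require Import structures.
From mathcomp Require Import all_boot all_order all_algebra.
From mathcomp Require Import all_classical all_reals all_analysis.
From mathcomp Require Import ring lra.
Import Order.TTheory GRing.Theory Num.Theory.
Import numFieldNormedType.Exports.

Set Implicit Arguments.
Unset Strict Implicit.
Unset Printing Implicit Defensive.

Local Open Scope classical_set_scope.
Local Open Scope ring_scope.

(** * Calculus of C^k maps *)

(** The point q is only a cluster point of gamma, so every constant has to be fixed before the time
    t at which gamma is near q. This is why the return from gamma(t) to q is radial: on a short
    segment in a chart the Christoffel term is small and transport at most doubles coordinates,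
    whatever the end point. The stretch along gamma, over whose length nothing is known, is absorbed
    into the holonomy element. The uniform lifetime e rests on the quadratic homogeneity of the
    geodesic equation, which reduces velocities of size C to velocities near zero.

    A second obstacle is formal. A holonomy element needs one curve that serves all vectors, and
    fields along it take values in types that depend on the curve. Transports are therefore handled
    as linear maps composed of elementary pieces, each carried together with its inverse, and only
    the final loop is realized by a glued curve. Vectors at points that are merely provably equal
    are compared through their coordinates. *)

Section CkBasics.
Variables (R : realType) (V W : normedModType R).
Implicit Types (U N : set V) (f g : V -> W).

Lemma near_eq_differentiable f g x :
  (\forall y \near x, f y = g y) -> differentiable f x -> differentiable g x.
Proof.
move=> fg df; have /diff_locallyP[dc E] := df.
have gE : g \o shift x = cst (g x) + 'd f x +o_ 0 id.
  apply/eqaddoP => _/posnumP[e].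
  have /eqaddoP /(_ e%:num) /(_ [gt0 of e%:num]) := E.
  have : \forall y \near 0, f (y + x) = g (y + x).
    by have := fg; rewrite (near_shift 0) /= subr0.
  apply: filterS2 => y.
  rewrite -![(_ - _) y]/(_ y - _ y) -![(_ + _) y]/(_ y + _ y) /cst /= => ->.
  by rewrite (nbhs_singleton fg).
by apply/diff_locallyP; rewrite (diff_unique dc gE).
Qed.

(** Derivatives at a point of the open set [N] see only the values on [N], so the representative may
    vary with the point. Extensions by zero and glued curves are proved smooth in this way. *)
Lemma Ck_local k U f :
  (forall x, U x -> exists N g, [/\ open N, N x, Ck k N g &
     forall y, N y -> f y = g y]) -> Ck k U f.
Proof.
have nE N g x : forall f, open N -> N x -> (forall y, N y -> f y = g y) ->
    \forall y \near x, g y = f y.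
  move=> h oN Nx fg; apply: filterS (open_nbhs_nbhs (conj oN Nx)) => y /fg.
  by move=> ->.
elim: k f => [|k IH] f H.
  move=> x /H[N [g [oN Nx gc fg]]] /=.
  rewrite /prop_for /continuous_at (fg x Nx).
  exact: cvg_trans (near_eq_cvg (nE _ _ _ _ oN Nx fg)) (gc x Nx).
split=> [x /H[N [g [oN Nx [gd _] fg]]]|v].
  exact: near_eq_differentiable (nE _ _ _ _ oN Nx fg) (gd x Nx).
apply: IH => x /H[N [g [oN Nx [_ gd] fg]]].
exists N, ('D_v g); split=> //; first exact: gd.
move=> y Ny.
by apply/esym; apply: near_eq_derive; exact: nE oN Ny fg.
Qed.

Lemma Ck_eq k U f g : open U -> (forall x, U x -> f x = g x) ->
  Ck k U g -> Ck k U f.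
Proof. by move=> oU fg gk; apply: Ck_local => x Ux; exists U, g; split. Qed.

Lemma Ck_sub k U N f : N `<=` U -> Ck k U f -> Ck k N f.
Proof.
move=> NU; elim: k f => [|k IH] f; first by move=> fc x /NU/fc.
by move=> [fd fD]; split=> [x /NU/fd//|v]; exact: IH (fD v).
Qed.

Lemma Ck_pred k U f : Ck k.+1 U f -> Ck k U f.
Proof.
elim: k f => [|k IH] f [fd fD].
  by move=> x /fd; exact: differentiable_continuous.
by split=> // v; exact: IH (fD v).
Qed.

Lemma Ck_continuous k U f x : Ck k U f -> U x -> {for x, continuous f}.
Proof. by elim: k => [|k IH]; [exact|move=> /Ck_pred]. Qed.

Lemma Ck_cst k U (a : W) : Ck k U (cst a).
Proof.
elim: k a => [|k IH] a; first by move=> x _; exact: cst_continuous.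
split=> [x _|v]; first exact: differentiable_cst.
by rewrite (_ : 'D_v _ = cst 0) //; apply/funext => x; rewrite derive_cst.
Qed.

Lemma Ck_linear k U (f : {linear V -> W}) : continuous f -> Ck k U f.
Proof.
move=> fc; case: k => [|k]; first by move=> x _; exact: fc.
split=> [x _|v]; first exact: linear_differentiable.
rewrite (_ : 'D_v _ = cst (f v)); first exact: Ck_cst.
by apply/funext => x; rewrite deriveE ?diff_lin//; exact: linear_differentiable.
Qed.

Lemma CkD k U f g : open U -> Ck k U f -> Ck k U g ->
  Ck k U (fun x => f x + g x).
Proof.
move=> oU; elim: k f g => [|k IH] f g.
  by move=> fc gc x Ux; apply: continuousD; [exact: fc|exact: gc].
move=> [fd fD] [gd gD]; split=> [x Ux|v].
  by apply: differentiableD; [exact: fd|exact: gd].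
apply: Ck_eq (IH _ _ (fD v) (gD v)) => // x Ux.
by apply: deriveD; apply: diff_derivable; [exact: fd|exact: gd].
Qed.

Lemma Ck_sum k U n (f : 'I_n -> V -> W) : open U ->
  (forall i, Ck k U (f i)) -> Ck k U (fun x => \sum_(i < n) f i x).
Proof.
move=> oU H; elim: n f H => [|n IH] f H.
  apply: (@Ck_eq _ _ _ (cst 0)) => //; last exact: Ck_cst.
  by move=> x _; rewrite big_ord0.
apply: (@Ck_eq _ _ _ (fun x => \sum_(i < n) f (widen_ord (leqnSn n) i) x
  + f ord_max x)) => //.
  by move=> x _; rewrite big_ord_recr.
by apply: CkD => //; apply: IH.
Qed.

End CkBasics.

Section CkScale.
Variables (R : realType) (W : normedModType R).

(** A named copy of scaling, to carry the bilinear structure from which the product rule is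
    obtained. *)
Definition scale_op (a : R) (w : W) := a *: w.

Fact scale_bilinear : bilinear_for
    (GRing.Scale.Law.clone _ _ *:%R _) (GRing.Scale.Law.clone _ _ *:%R _)
    scale_op.
Proof.
split=> [u'|u] a x y; rewrite /scale_op /=; first by rewrite scalerDl scalerA.
by rewrite scalerDr !scalerA mulrC.
Qed.
HB.instance Definition _ := bilinear_isBilinear.Build R R W W _ _
  scale_op scale_bilinear.

Variable V : normedModType R.
Implicit Types (f : V -> R) (g : V -> W).

Lemma differentiable_scale f g x : differentiable f x -> differentiable g x ->
  differentiable (fun x => f x *: g x) x /\
  forall v, 'D_v (fun x => f x *: g x) x = f x *: 'D_v g x + 'D_v f x *: g x.
Proof.
move=> df dg.
have -> : (fun x => f x *: g x) =
    (fun p : R * W => p.1 *: p.2) \o (fun y => (f y, g y)) by [].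
have sc : continuous (fun p : R * W => p.1 *: p.2).
  exact: scale_continuous.
have d1 := differentiable_pair df dg.
have d2 : differentiable (fun p : R * W => p.1 *: p.2) (f x, g x).
  exact: (@differentiable_bilin _ _ _ _ scale_op).
have d3 : differentiable
    ((fun p : R * W => p.1 *: p.2) \o (fun y => (f y, g y))) x.
  exact: differentiable_comp.
split=> // v; rewrite !deriveE// diff_comp// /=.
rewrite (@diff_bilin _ _ _ _ scale_op)//=.
by rewrite diff_pair.
Qed.

Lemma CkZ k (U : set V) f g : open U -> Ck k U (f : V -> R^o) -> Ck k U g ->
  Ck k U (fun x => f x *: g x).
Proof.
move=> oU; elim: k f g => [|k IH] f g.
  by move=> fc gc x Ux; apply: continuousZ; [exact: fc|exact: gc].
move=> fC gC; have [fd fD] := fC; have [gd gD] := gC; split=> [x Ux|v].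
  by have [] := differentiable_scale (fd x Ux) (gd x Ux).
apply: (@Ck_eq _ _ _ _ _ _ (fun x => f x *: 'D_v g x + 'D_v f x *: g x)) => //.
  by move=> x Ux; have [_ ->] := differentiable_scale (fd x Ux) (gd x Ux).
by apply: CkD => //; apply: IH; [exact: Ck_pred fC|exact: gD|exact: fD|exact: Ck_pred gC].
Qed.

End CkScale.

Section FinBasis.
Variables (R : realType) (E : normedModType R).

(* Both [R^o] and ['rV_n] serve as sources of the outer map in a composition. *)
Definition fin_basis := exists (n : nat) (e : 'I_n -> E)
  (l : 'I_n -> {linear E -> R}),
  (forall i, continuous (l i)) /\ forall w, w = \sum_(i < n) l i w *: e i.

End FinBasis.

Lemma fin_basis_regular (R : realType) : fin_basis R^o.
Proof.
exists 1%N, (fun=> 1), (fun=> idfun); split=> [i x|w]; first exact: cvg_id.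
by rewrite big_ord1 /= -[RHS]/(w * 1) mulr1.
Qed.

Section Coordinates.
Variables (R : realType) (m n : nat).

Definition mxcoord (i : 'I_m) (j : 'I_n) (A : 'M[R]_(m, n)) : R := A i j.

Fact mxcoord_is_linear i j : linear (mxcoord i j).
Proof. by move=> a A B; rewrite /mxcoord !mxE. Qed.

HB.instance Definition _ i j := GRing.isLinear.Build R 'M[R]_(m, n) R _
  (mxcoord i j) (mxcoord_is_linear i j).

Lemma mxcoord_continuous i j : continuous (mxcoord i j).
Proof. exact: coord_continuous. Qed.

End Coordinates.

Lemma fin_basis_rV (R : realType) n : fin_basis 'rV[R]_n.
Proof.
exists n, (fun j => delta_mx 0 j), (fun j => mxcoord 0 j).
split=> [i|w]; first exact: mxcoord_continuous.
exact: row_sum_delta.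
Qed.

Lemma Ck_comp_linear (R : realType) (V E W : normedModType R) k
    (U : set V) (f : V -> E) (l : {linear E -> W}) :
  open U -> continuous l -> Ck k U f -> Ck k U (l \o f).
Proof.
move=> oU lc; elim: k f => [|k IH] f.
  by move=> fc x Ux; apply: continuous_comp; [exact: fc|exact: lc].
move=> [fd fD]; have ld y : differentiable l y by exact: linear_differentiable.
split=> [x Ux|v]; first by apply: differentiable_comp; [exact: fd|exact: ld].
apply: Ck_eq (IH _ (fD v)) => // x Ux.
rewrite deriveE; last by apply: differentiable_comp; [exact: fd|exact: ld].
by rewrite diff_comp//= ?diff_lin// ?deriveE//; exact: fd.
Qed.

Section CkComp.
Variables (R : realType) (V E W : normedModType R).

Lemma derive_comp (f : V -> E) (g : E -> W) x v :
  differentiable f x -> differentiable g (f x) ->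
  'D_v (g \o f) x = 'd g (f x) ('D_v f x).
Proof.
move=> fd gd; rewrite deriveE; last exact: differentiable_comp.
by rewrite diff_comp// deriveE.
Qed.

(** [Ck] differentiates in fixed directions, whereas the chain rule differentiates [g] in the moving
    direction ['D_v f x]. Expanding this direction in a finite basis of [E] leaves a sum of products
    to which the induction hypothesis applies. *)
Lemma Ck_comp k (U : set V) (O : set E) (f : V -> E) (g : E -> W) :
  fin_basis E -> open U -> Ck k U f -> Ck k O g ->
  (forall x, U x -> O (f x)) -> Ck k U (g \o f).
Proof.
move=> [n [e [l [lc le]]]] oU + + UO; elim: k f g UO => [|k IH] f g UO.
  by move=> fc gc x Ux; apply: continuous_comp; [exact: fc|exact/gc/UO].
move=> fC gC; have [fd fD] := fC; have [gd gD] := gC; split=> [x Ux|v].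
  by apply: (@differentiable_comp _ _ _ _ f g); [exact: fd|exact: gd (UO _ Ux)].
apply: (@Ck_eq _ _ _ _ _ _
    (fun x => \sum_(i < n) l i ('D_v f x) *: ('D_(e i) g \o f) x)) => //.
  move=> x Ux; rewrite derive_comp; [|exact: fd|exact: gd (UO _ Ux)].
  rewrite [in LHS](le ('D_v f x)) linear_sum; apply: eq_bigr => i _.
  by rewrite linearZ /=; congr (_ *: _); rewrite deriveE//; exact: gd (UO _ Ux).
apply: Ck_sum => // i; apply: CkZ => //.
  exact: (@Ck_comp_linear _ _ _ _ k U ('D_v f) (l i) oU (lc i) (fD v)).
by apply: IH => //; [exact: Ck_pred fC|exact: gD].
Qed.

End CkComp.

Section CkMatrix.
Variables (R : realType) (V : normedModType R) (m n : nat).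

Lemma Ck_coord k (U : set V) (f : V -> 'M[R]_(m, n)) i j :
  open U -> Ck k U f -> Ck k U (fun x => f x i j : R^o).
Proof.
move=> oU fC; apply: (@Ck_comp_linear _ _ _ _ k U f (mxcoord i j)) => //.
exact: mxcoord_continuous.
Qed.

End CkMatrix.

Section CkScalar.
Variables (R : realType) (V : normedModType R) (U : set V).
Hypothesis oU : open U.
Implicit Types f g : V -> R^o.

Lemma CkM k f g : Ck k U f -> Ck k U g -> Ck k U (fun x => f x * g x : R^o).
Proof. exact: CkZ. Qed.

Lemma CkN (W : normedModType R) k (h : V -> W) : Ck k U h ->
  Ck k U (fun x => - h x).
Proof.
move=> hC; apply: (@Ck_eq _ _ _ _ _ _ (fun x => (-1 : R) *: h x)) => //.
  by move=> x _; rewrite scaleN1r.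
by apply: CkZ => //; exact: Ck_cst.
Qed.

Lemma CkV k f : (forall x, U x -> f x != 0) -> Ck k U f ->
  Ck k U (fun x => (f x)^-1 : R^o).
Proof.
move=> f0; elim: k f f0 => [|k IH] f f0.
  by move=> fc x Ux; apply: continuousV; [exact: f0|exact: fc].
move=> fC; have [fd fD] := fC; split=> [x Ux|v].
  by apply: differentiableV; [exact: fd|exact: f0].
apply: (@Ck_eq _ _ _ _ _ _ (fun x => - (((f x)^-1 * (f x)^-1) * 'D_v f x))) => //.
  move=> x Ux; rewrite deriveV; [|exact: f0|exact/diff_derivable/fd].
  by rewrite -[LHS]/(_ * _) mulNr -exprVn expr2.
apply: CkN; apply: CkM; last exact: fD.
by apply: CkM; apply: IH (Ck_pred fC).
Qed.

End CkScalar.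

Lemma Ck_id (R : realType) (V : normedModType R) k (U : set V) :
  Ck k U (fun x : V => x).
Proof. by apply: (@Ck_linear _ _ _ k U idfun) => x; exact: cvg_id. Qed.

(** * Bump functions *)

Section Bump.
Variable R : realType.
Implicit Types (P : {poly R}) (x y t : R).

(* A family of flat functions closed under differentiation:
   (P(1/x) e^(-1/x))' = Q(1/x) e^(-1/x) with Q = X^2 (P - P'). *)
Definition expinv P x : R^o := if 0 < x then P.[x^-1] * expR (- x^-1) else 0.

(** Raising 1 + x <= e^x at x = y / (n + 1) to the power n + 1 bounds [expR y] below by a multiple
    of y^(n+1), while [P] grows at most like y^n. The remaining factor 1 / y gives the linear bound
    on [expinv] at 0. *)
Lemma poly_expRN_le P : exists2 K, 0 <= K &
  forall y, 1 <= y -> `|P.[y] * expR (- y)| <= K / y.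
Proof.
set n := size P; pose C := \sum_(i < n) `|P`_i|.
have C0 : 0 <= C by apply: sumr_ge0.
exists (C * n.+1%:R ^+ n.+1); first by rewrite mulr_ge0// exprn_ge0.
move=> y y1; have y0 : 0 < y by exact: lt_le_trans y1.
have Py : `|P.[y]| <= C * y ^+ n.
  rewrite horner_coef (le_trans (ler_norm_sum _ _ _))// mulr_suml.
  rewrite ler_sum// => i _.
  rewrite normrM ler_wpM2l// ger0_norm ?exprn_ge0 ?(ltW y0)//.
  by rewrite ler_weXn2l// ltnW.
have ey : (y / n.+1%:R) ^+ n.+1 <= expR y.
  have -> : expR y = expR (y / n.+1%:R) ^+ n.+1.
    by rewrite -expRM_natl mulrC divfK// pnatr_eq0.
  rewrite lerXn2r ?nnegrE ?expR_ge0 ?divr_ge0 ?ltW//.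
  by apply: le_lt_trans (expR_gt1Dx _); rewrite ?lerDr ?mulf_neq0 ?gt_eqF// invr_gt0.
rewrite expRN normrM (ger0_norm (_ : 0 <= (expR y)^-1)) ?invr_ge0 ?expR_ge0//.
apply: le_trans (_ : C * y ^+ n * ((y / n.+1%:R) ^+ n.+1)^-1 <= _).
  apply: ler_pM => //.
  by rewrite lef_pV2 ?posrE ?expR_gt0// exprn_gt0// divr_gt0.
rewrite expr_div_n invf_div -!mulrA ler_wpM2l//.
rewrite mulrCA ler_wpM2l ?exprn_ge0//.
by rewrite exprSr invfM mulrA mulfV ?mul1r// expf_neq0 ?gt_eqF.
Qed.

Lemma expinv_le P : exists2 K, 0 <= K &
  forall x, `|x| <= 1 -> `|expinv P x| <= K * `|x|.
Proof.
have [K K0 H] := poly_expRN_le P; exists K => // x x1; rewrite /expinv.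
case: ifPn => [x0|_]; last by rewrite normr0 mulr_ge0.
rewrite (gtr0_norm x0) in x1 *.
by have := H x^-1; rewrite invrK; apply; rewrite invf_ge1.
Qed.

Lemma expinv_cvg0 P : expinv P x @[x --> 0^'] --> 0.
Proof.
have [K K0 H] := expinv_le P; apply/cvgrPdist_le => /= e e0.
near=> x; rewrite sub0r normrN.
have x1 : `|x| <= 1 by near: x; apply: dnbhs0_le.
rewrite (le_trans (H _ x1))//.
have xe : `|x| <= e / (K + 1).
  by near: x; apply: dnbhs0_le; rewrite divr_gt0// ltr_wpDl.
rewrite (le_trans (ler_wpM2l K0 xe))// mulrA ler_pdivrMr ?ltr_wpDl//.
by rewrite mulrDr mulr1 mulrC lerDl ltW.
Unshelve. all: by end_near. Qed.

Lemma expinv0 P : expinv P 0 = 0. Proof. by rewrite /expinv ltxx. Qed.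

Lemma is_derive_expinv P x :
  is_derive (x : R^o) 1 (expinv P) (expinv ('X ^+ 2 * (P - P^`())) x).
Proof.
have [x0|x0|->] := ltgtP x 0.
- have -> : expinv ('X ^+ 2 * (P - P^`())) x = 0.
    by rewrite /expinv ltNge (ltW x0).
  apply: near_eq_is_derive (_ : is_derive (x : R^o) 1 (cst 0) _).
  near=> y; rewrite /expinv ltNge.
  have -> // : y <= 0 by apply/ltW; near: y; exact: lt_nbhsl.
- rewrite {2}/expinv x0.
  pose f : R^o -> R^o := (fun x => P.[x^-1] * expR (- x^-1)).
  apply: near_eq_is_derive (_ : is_derive (x : R^o) 1 f _).
    by near=> y; rewrite /expinv ifT//; near: y; exact: lt_nbhsr.
  have xn0 : x != 0 by rewrite gt_eqF.
  have d1 : is_derive (x : R^o) (1 : R^o) (fun x => x^-1 : R^o) (- x ^- 2).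
    apply: DeriveDef; first exact: derivableV.
    by rewrite deriveV ?derive_id//= /GRing.scale /= mulr1.
  have d2 : is_derive x 1 ((horner P) \o (fun x => x^-1))
      ((P^`()).[x^-1] * - x ^- 2).
    exact: is_derive1_comp.
  have d4 : is_derive (x : R^o) (1 : R^o) (fun x => - x^-1 : R^o) (x ^- 2).
    by apply: is_derive_eq; rewrite opprK.
  have d3 : is_derive x 1 (expR \o (fun x => - x^-1))
     (expR (- x^-1) * (x ^- 2)).
    exact: is_derive1_comp.
  apply: (@is_derive_eq _ _ _ _ _ _ _ _ (is_deriveM d2 d3)).
  rewrite !hornerE /= /GRing.scale /= -exprVn. ring.
- rewrite expinv0.
  (* At 0 the difference quotient is itself a member of the family, for the polynomial ['X * P], and
     so tends to 0. *)
  have H : h^-1 *: ((expinv P \o shift 0) (h *: (1 : R^o)) - expinv P 0)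
      @[h --> 0^'] --> (0 : R^o).
    apply: cvg_trans (expinv_cvg0 ('X * P)); apply: near_eq_cvg.
    near=> h; rewrite expinv0 subr0 /= addr0 [h%:A]mulr1 /expinv.
    case: ifP => _; last by rewrite scaler0.
    by rewrite hornerM hornerX -mulrA.
  by apply: DeriveDef; [apply/cvg_ex; exists 0|exact: cvg_lim H].
Unshelve. all: by end_near. Qed.

Lemma derive_regular (W : normedModType R) (f : R^o -> W) x v :
  differentiable f x -> 'D_v f x = v *: 'D_1 f x.
Proof.
by move=> fd; rewrite !deriveE// -[in LHS](mulr1 v) -[v * 1]/(v *: (1 : R^o)) linearZ.
Qed.

Lemma smooth_expinv P : smooth_on setT (expinv P : R^o -> R^o).
Proof.
move=> k; elim: k P => [|k IH] P.
  move=> x _; apply: differentiable_continuous; apply/derivable1_diffP.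
  by have [] := is_derive_expinv P x.
have d x : differentiable (expinv P : R^o -> R^o) x.
  by apply/derivable1_diffP; have [] := is_derive_expinv P x.
split=> [x _|v]; first exact: d.
apply: (@Ck_eq _ _ _ _ _ _ (fun x => v *: expinv ('X ^+ 2 * (P - P^`())) x)).
- exact: openT.
- move=> x _; rewrite derive_regular//; congr (_ *: _).
  by have [_ ->] := is_derive_expinv P x.
- by apply: CkZ (IH _); [exact: openT|exact: Ck_cst].
Qed.

Lemma expinv1_gt0 x : 0 < x -> 0 < expinv 1 x.
Proof. by move=> x0; rewrite /expinv x0 hornerC mul1r expR_gt0. Qed.

Lemma expinv1_ge0 x : 0 <= expinv 1 x.
Proof.
rewrite /expinv; case: ifP => // _.
by rewrite hornerC mul1r expR_ge0.
Qed.

(** The two summands of the denominator are positive for t^2 < 4 and for t^2 > 1 respectively, so it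
    never vanishes. *)
Definition plateau t : R^o :=
  expinv 1 (4 - t ^+ 2) / (expinv 1 (4 - t ^+ 2) + expinv 1 (t ^+ 2 - 1)).

Lemma plateau1 t : `|t| <= 1 -> plateau t = 1.
Proof.
move=> t1; have t2 : t ^+ 2 <= 1.
  by rewrite -real_normK ?num_real// expr_le1.
rewrite /plateau {3}/expinv ltNge subr_le0 t2 /= addr0 divff//.
by rewrite gt_eqF// expinv1_gt0//; lra.
Qed.

Lemma plateau0 t : 2 <= `|t| -> plateau t = 0.
Proof.
move=> t1; have t2 : 4 <= t ^+ 2.
  have : (2 : R) ^+ 2 <= `|t| ^+ 2 by rewrite lerXn2r// nnegrE.
  by rewrite real_normK ?num_real//; lra.
by rewrite /plateau {1}/expinv ltNge subr_le0 t2 /= mul0r.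
Qed.

Lemma smooth_plateau : smooth_on setT (plateau : R^o -> R^o).
Proof.
move=> k; have oT : open [set: R^o] by exact: openT.
have sq : Ck k setT (fun t : R^o => t ^+ 2 : R^o).
  by apply: CkM => //; exact: Ck_id.
have c1 : Ck k setT (fun t : R^o => expinv 1 (4 - t ^+ 2) : R^o).
  apply: (@Ck_comp _ _ _ _ k setT setT (fun t : R^o => 4 - t ^+ 2 : R^o)
    (expinv 1 : R^o -> R^o)) => //.
  - exact: fin_basis_regular.
  - by apply: CkD => //; [exact: Ck_cst|exact: CkN].
  - exact: smooth_expinv.
have c2 : Ck k setT (fun t : R^o => expinv 1 (t ^+ 2 - 1) : R^o).
  apply: (@Ck_comp _ _ _ _ k setT setT (fun t : R^o => t ^+ 2 - 1 : R^o)
    (expinv 1 : R^o -> R^o)) => //.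
  - exact: fin_basis_regular.
  - by apply: CkD => //; exact: Ck_cst.
  - exact: smooth_expinv.
apply: CkM => //; apply: CkV => //; last exact: CkD.
move=> t _; rewrite gt_eqF//.
have [t2|t2] := ltP 1 (t ^+ 2).
  by apply: ltr_wpDl; rewrite ?expinv1_ge0// expinv1_gt0// subr_gt0.
by apply: ltr_pwDl; rewrite ?expinv1_ge0// expinv1_gt0//; lra.
Qed.

End Bump.

Section MaxNorm.
Variables (R : realType) (n : nat).
Implicit Types x y : 'rV[R]_n.

Lemma rV_coord_le x j : `|x 0 j| <= `|x|.
Proof.
by rewrite [leRHS]/Num.norm/= mx_normrE; exact: (le_bigmax _ _ (0, j)).
Qed.

Lemma rV_norm_le x (r : R) : 0 <= r -> (forall j, `|x 0 j| <= r) -> `|x| <= r.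
Proof.
move=> r0 H; rewrite [leLHS]/Num.norm/= mx_normrE.
by apply: bigmax_le => // -[i j] _; rewrite ord1.
Qed.

(** A product over coordinates rather than a function of the norm: the max norm is not smooth, but
    its balls are products of intervals. *)
Definition bump_at x (r : R) y : R^o := \prod_(j < n) plateau ((y 0 j - x 0 j) / r).

Lemma bump_at1 x r y : 0 < r -> `|y - x| <= r -> bump_at x r y = 1.
Proof.
move=> r0 xy; rewrite /bump_at big1// => j _; rewrite plateau1//.
rewrite normrM (gtr0_norm (_ : 0 < r^-1)) ?invr_gt0// ler_pdivrMr// mul1r.
by apply: le_trans xy; have := rV_coord_le (y - x) j; rewrite !mxE.
Qed.

Lemma bump_at0 x r y : 0 < r -> 2 * r <= `|y - x| -> bump_at x r y = 0.
Proof.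
move=> r0 xy; have [j H] : exists j, 2 * r <= `|(y - x) 0 j|.
  apply: contrapT => /forallNP H.
  have : `|y - x| < 2 * r.
    rewrite [ltLHS]/Num.norm/= mx_normrE bigmax_lt//=; first by rewrite mulr_gt0.
    by move=> [i j] _; rewrite ord1 ltNge; apply/negP/H.
  by rewrite ltNge xy.
rewrite /bump_at (bigD1 j)//= plateau0 ?mul0r//.
rewrite normrM (gtr0_norm (_ : 0 < r^-1)) ?invr_gt0// ler_pdivlMr//.
by rewrite !mxE in H.
Qed.

Lemma Ck_prod (V : normedModType R) k (U : set V) N (f : 'I_N -> V -> R^o) :
  open U -> (forall i, Ck k U (f i)) -> Ck k U (fun z => \prod_(i < N) f i z : R^o).
Proof.
move=> oU; elim: N f => [|N IH] f H.
  apply: (@Ck_eq _ _ R^o _ _ _ (cst (1 : R))) => //; last exact: Ck_cst.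
  by move=> z _; rewrite big_ord0.
apply: (@Ck_eq _ _ _ _ _ _ (fun z => (\prod_(i < N) f (widen_ord (leqnSn N) i) z)
  * f ord_max z)) => //.
  by move=> z _; rewrite big_ord_recr.
by apply: CkM => //; apply: IH.
Qed.

Lemma smooth_bump_at x r : smooth_on setT (bump_at x r).
Proof.
move=> k; apply: Ck_prod => [|j]; first exact: openT.
have oT : open [set: 'rV[R]_n] by exact: openT.
apply: (@Ck_comp _ _ _ _ k setT setT (fun y => (y 0 j - x 0 j) / r : R^o)
   (@plateau R : R^o -> R^o)) => //; [exact: fin_basis_regular| |exact: smooth_plateau].
apply: CkM => //; last exact: Ck_cst.
apply: CkD => //; last exact: Ck_cst.
by apply: Ck_coord => //; exact: Ck_id.
Qed.

End MaxNorm.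

(** * Ordinary differential equations *)

Lemma open_norm_lt (R : realType) (V : normedModType R) (x : V) (r : R) :
  open [set y | `|y - x| < r].
Proof.
have := @ball_open R V x r; congr open; apply/seteqP.
by split=> y; rewrite -ball_normE /= distrC.
Qed.

Lemma near_norm_lt (R : realType) (V : normedModType R) (x y : V) (r : R) :
  `|y - x| < r -> \forall z \near y, `|z - x| < r.
Proof. by move=> yx; exact: open_nbhs_nbhs (conj (open_norm_lt x r) yx). Qed.

Lemma is_interval_norm_lt (R : realType) (c e : R) :
  is_interval [set t : R | `|t - c| < e].
Proof.
move=> u v /=; rewrite !ltr_distl => /andP[a _] /andP[_ b] z /andP[uz zv].
by rewrite ltr_distl (lt_le_trans a uz) (le_lt_trans zv b).
Qed.

Section MeanValue.
Variable R : realType.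

Lemma derivable_coord (V : normedModType R) n (f : V -> 'rV[R]_n) x v j :
  derivable f x v -> is_derive x v (fun y => f y 0 j : R^o) (('D_v f x) 0 j).
Proof.
move=> fd; apply: DeriveDef; first exact: (derivable_mxP f x v).1 fd 0 j.
by rewrite derive_mx// mxE.
Qed.

Lemma is_derive_coord (V : normedModType R) n (f : V -> 'rV[R]_n) x v (df : 'rV[R]_n) :
  (forall j, is_derive x v (fun y => f y 0 j : R^o) (df 0 j)) ->
  is_derive x v f df.
Proof.
move=> H; have fd : derivable f x v.
  by apply/derivable_mxP => i j; rewrite ord1; have [] := H j.
apply: DeriveDef => //; apply/rowP => j; rewrite derive_mx// mxE.
by have [_ ->] := H j.
Qed.

(** For the max norm the scalar mean value theorem can be applied to each coordinate without loss in
    the constant. *)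
Lemma mean_value_le n (f : R -> 'rV[R]_n) (I : set R) (K : R) : is_interval I ->
  (forall t, I t -> derivable (f : R^o -> _) t 1 /\ `|'D_1 f t| <= K) ->
  forall s t, I s -> I t -> `|f s - f t| <= K * `|s - t|.
Proof.
move=> iI H.
suff W s t : s <= t -> I s -> I t -> `|f t - f s| <= K * (t - s).
  move=> s t Is It; have [st|/ltW ts] := leP s t.
    by rewrite distrC (distrC s) (ger0_norm (_ : 0 <= t - s)) ?subr_ge0// W.
  by rewrite (ger0_norm (_ : 0 <= s - t)) ?subr_ge0// W.
move=> st Is It.
have Ic c : s <= c <= t -> I c by exact: iI.
have K0 : 0 <= K by have [_] := H _ Is; exact: le_trans.
apply: rV_norm_le => [|j]; first by rewrite mulr_ge0// subr_ge0.
pose g : R -> R := fun y => f y 0 j; pose dg : R -> R := fun y => ('D_1 f y) 0 j.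
rewrite !mxE -/(g t) -/(g s).
have d (c : R) : c \in `[s, t] -> is_derive c 1 g (dg c).
  by rewrite in_itv/= => /Ic /H[fd _]; exact: derivable_coord.
have d' (c : R) : c \in `]s, t[ -> is_derive c 1 g (dg c).
  by move=> /subset_itv_oo_cc; exact: d.
have gc : {within `[s, t], continuous g}.
  by apply: derivable_within_continuous => c /d [].
have [c cst ->] := MVT_segment st d' gc.
rewrite normrM (ger0_norm (_ : 0 <= t - s)) ?subr_ge0//.
apply: ler_wpM2r; rewrite ?subr_ge0// (le_trans (rV_coord_le _ _))//.
by move: cst; rewrite in_itv/= => /Ic /H[].
Qed.

Lemma derivable_continuous (W : normedModType R) (f : R -> W) t :
  derivable (f : R^o -> W) t 1 -> {for t, continuous f}.
Proof. by move=> /derivable1_diffP; exact: differentiable_continuous. Qed.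

(* Gives uniqueness for linear equations, invertibility of their solution
   operators, and a bound on these, all at once. *)
Lemma linear_growth_le n (v : R -> 'rV[R]_n) (I : set R) (C : R) : is_interval I ->
  (forall t, I t -> derivable (v : R^o -> _) t 1 /\ `|'D_1 v t| <= C * `|v t|) ->
  0 <= C -> (forall s t, I s -> I t -> C * `|s - t| <= 2^-1) ->
  forall s t, I s -> I t -> `|v s| <= 2 * `|v t|.
Proof.
move=> iI H C0 CI s t Is It.
pose a := Num.min s t; pose b := Num.max s t.
have ab : a <= b by rewrite /a /b; rewrite ge_min !le_max !lexx.
have Ic c : a <= c <= b -> I c.
  by rewrite /a /b minEle maxEle; case: ifP => _ cab;
    [exact: (iI _ _ Is It c cab)|exact: (iI _ _ It Is c cab)].
(* At a maximum [u] of the norm between [s] and [t], the mean value inequality gives |v u - v t| <=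
   |v u| / 2, hence |v u| <= 2 |v t|. *)
have [|u] := @EVT_max _ (fun c => `|v c|) _ _ ab.
  apply: continuous_in_subspaceT => c; rewrite inE/= in_itv/= => /Ic Icc.
  apply: (@continuous_comp _ _ _ v (@Num.norm _ _)); last exact: norm_continuous.
  by apply: derivable_continuous; have [] := H _ Icc.
rewrite in_itv/= => uab vu; have Iu := Ic _ uab.
have vM c : a <= c <= b -> `|v c| <= `|v u| by move=> ?; apply: vu; rewrite in_itv.
have sab : a <= s <= b by rewrite ge_min le_max !lexx.
pose J := [set c | a <= c <= b].
have iJ : is_interval J.
  move=> x y /andP[ax _] /andP[_ yb] z /andP[xz zy].
  by rewrite /J/= (le_trans ax xz) (le_trans zy yb).
have tab : a <= t <= b by rewrite ge_min le_max !lexx !orbT.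
have H' c : J c -> derivable (v : R^o -> _) c 1 /\ `|'D_1 v c| <= C * `|v u|.
  move=> Jc; have [vd vc] := H _ (Ic _ Jc); split=> //.
  by rewrite (le_trans vc)// ler_wpM2l// vM.
have vut := mean_value_le iJ H' uab tab.
have : `|v u - v t| <= 2^-1 * `|v u|.
  by rewrite (le_trans vut)// mulrAC ler_wpM2r// CI.
have := ler_normB (v u - v t) (- v t); rewrite opprK subrK normrN.
have := vM _ sab; lra.
Qed.


Lemma primitive1 (f : R -> R) (a b : R) : continuous f ->
  exists F : R -> R, forall t : R, a < t < b -> is_derive t 1 F (f t).
Proof.
move=> fc; exists (fun x => \int[lebesgue_measure]_(t in `[a, x]) f t)%R.
move=> t /andP[at_ tb].
have [] := @continuous_FTC1_closed R f a t b tb _ at_ (fc t).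
  apply: continuous_compact_integrable; first exact: segment_compact.
  exact: continuous_subspaceT.
by move=> Fd FE; apply: DeriveDef; [exact: Fd|rewrite -derive1E FE].
Qed.

Lemma primitive n (f : R -> 'rV[R]_n) (a b : R) : continuous f ->
  exists F : R -> 'rV[R]_n,
    forall t : R, a < t < b -> is_derive (t : R^o) 1 F (f t).
Proof.
move=> fc.
have /boolp.choice[F H] : forall j, exists F : R -> R,
    forall t : R, a < t < b -> is_derive t 1 F (f t 0 j).
  move=> j; apply: primitive1 => t.
  by apply: (@continuous_comp _ _ _ f (mxcoord 0 j));
    [exact: fc|exact: mxcoord_continuous].
exists (fun t => \row_j F j t) => t /H Ht; apply: is_derive_coord => j.
by under eq_fun do rewrite mxE; exact: Ht.
Qed.

End MeanValue.

Section GeometricLimit.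
Variable R : realType.

Lemma geometric_small (K e : R) : 0 < e -> exists k, K / 2 ^+ k <= e.
Proof.
move=> e0; have [K0|K0] := leP K 0.
  by exists 0%N; rewrite expr0 divr1 (le_trans K0)// ltW.
have := @cvg_geometric _ K (2^-1 : R) _; rewrite ger0_norm ?invr_ge0//.
have h1 : (2^-1 : R) < 1 by lra.
move=> /(_ h1) /cvgr0_norm_le /(_ _ e0)[k _ /(_ k (leqnn k))/=].
rewrite ger0_norm; first by exists k; rewrite -exprVn.
by rewrite mulr_ge0 ?exprn_ge0 ?invr_ge0 // ltW.
Qed.

Lemma geometric_dist (V : normedModType R) (u : nat -> V) (K : R) :
  (forall k, `|u k.+1 - u k| <= K / 2 ^+ k) ->
  forall k j, `|u (k + j)%N - u k| <= 2 * K / 2 ^+ k.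
Proof.
move=> H k j; have K0 : 0 <= K.
  by have := H 0%N; rewrite expr0 divr1; exact: le_trans.
(* The subtracted tail makes the bound telescope, so that the induction on [j] closes. *)
suff : `|u (k + j)%N - u k| <= 2 * K / 2 ^+ k - 2 * K / 2 ^+ (k + j).
  move=> /le_trans; apply; rewrite gerBl.
  by rewrite !mulr_ge0// invr_ge0 exprn_ge0.
elim: j => [|j IH]; first by rewrite addn0 !subrr normr0.
rewrite addnS -(subrKA (u (k + j)%N)) (le_trans (ler_normD _ _))//.
rewrite (le_trans (lerD (H _) IH))// exprS invfM.
set x := (2 ^+ (k + j))^-1; lra.
Qed.

Lemma geometric_limit (u : nat -> R) (K : R) :
  (forall k, `|u k.+1 - u k| <= K / 2 ^+ k) ->
  exists l, forall k, `|l - u k| <= 2 * K / 2 ^+ k.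
Proof.
move=> H; have uc : cvgn u.
  apply/cauchy_cvgP/cauchy_exP => e e0.
  have [k ke] := geometric_small (2 * K) (divr_gt0 e0 (ltr0n _ 2)).
  exists (u k); exists k => // j /= kj.
  rewrite -ball_normE /= -[j](subnKC kj) distrC.
  rewrite (le_lt_trans (geometric_dist H _ _))// (le_lt_trans ke)//.
  by rewrite ltr_pdivrMr// ltr_pMr// ltr1n.
exists (lim (u @ \oo)) => k; apply/ler_addgt0Pr => e e0.
have /cvgrPdist_le /(_ e e0)[N _ HN] := uc.
have := HN _ (leq_addl k N); rewrite /= => H1.
rewrite -(subrKA (u (k + N)%N)) (le_trans (ler_normD _ _))// addrC lerD//.
exact: geometric_dist.
Qed.

Lemma geometric_limit_rV n (u : nat -> 'rV[R]_n) (K : R) :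
  (forall k, `|u k.+1 - u k| <= K / 2 ^+ k) ->
  exists l, forall k, `|l - u k| <= 2 * K / 2 ^+ k.
Proof.
move=> H; have K0 : 0 <= K.
  by have := H 0%N; rewrite expr0 divr1; exact: le_trans.
have /boolp.choice[l Hl] : forall j, exists l, forall k,
    `|l - u k 0 j| <= 2 * K / 2 ^+ k.
  move=> j; apply: geometric_limit => k; apply: le_trans (H k).
  by have := rV_coord_le (u k.+1 - u k) j; rewrite !mxE.
exists (\row_j l j) => k; apply: rV_norm_le => [|j]; last by rewrite !mxE.
by rewrite mulr_ge0 ?mulr_ge0// invr_ge0 exprn_ge0.
Qed.

End GeometricLimit.

(** * Picard iteration *)

Section Picard.
Variables (R : realType) (n : nat) (F : R -> 'rV[R]_n -> 'rV[R]_n).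
Variables (t0 d L : R) (x0 : 'rV[R]_n).
Hypotheses (d0 : 0 < d) (L0 : 0 <= L) (dL : d * L <= 2^-1).
Hypothesis F_lipschitz : forall t x y, `|t - t0| <= d ->
  `|F t x - F t y| <= L * `|x - y|.
Hypothesis F_continuous : forall t x, `|t - t0| <= d ->
  {for t, continuous (F ^~ x)}.

(** Retracting time onto the interval where [F] is controlled lets all iterates be continuous
    functions on the whole line, with a global sup norm. *)
Let clamp (t : R) := Num.max (t0 - d) (Num.min (t0 + d) t).

Let clamp_cont : continuous clamp.
Proof.
move=> t; apply: (@continuous_max _ _ (cst (t0 - d)) (fun t => Num.min (t0 + d) t)).
  exact: cst_continuous.
apply: (@continuous_min _ _ (cst (t0 + d)) id); first exact: cst_continuous.
exact: cvg_id.
Qed.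

Let clampE t : `|t - t0| <= d -> clamp t = t.
Proof.
rewrite ler_distl => /andP[a b]; rewrite /clamp min_r; last by lra.
by rewrite max_r.
Qed.

Let clamp_dist t : `|clamp t - t0| <= d.
Proof.
rewrite /clamp ler_distl le_max lexx /= ge_max ge_min lexx /= andbT; have := d0; lra.
Qed.

Let rhs_continuous (x : R -> 'rV[R]_n) : continuous x ->
  continuous (fun s => F (clamp s) (x s)).
Proof.
move=> xc s; apply/cvgrPdist_le => e e0; near=> r.
rewrite -(subrKA (F (clamp r) (x s))) (splitr e) (le_trans (ler_normD _ _))//.
apply: lerD.
  near: r; have : {for s, continuous (fun r => F (clamp r) (x s))}.
    apply: (@continuous_comp _ _ _ clamp (F ^~ (x s))); first exact: clamp_cont.
    exact/F_continuous.
  by move=> /cvgrPdist_le /(_ _ (divr_gt0 e0 (ltr0n _ 2))).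
apply: le_trans (F_lipschitz _ _ (clamp_dist _)) _.
have : `|x s - x r| <= e / 2 / (L + 1).
  near: r; have /cvgrPdist_le := xc s; apply.
  by rewrite !divr_gt0// ltr_wpDl.
rewrite ler_pdivlMr ?ltr_wpDl// mulrDr mulr1 mulrC; apply: le_trans.
by rewrite lerDl.
Unshelve. all: by end_near. Qed.

(** [y] is a Picard iterate of [x]. It is a relation because primitives come from an existence
    statement. The primitive is taken on radius [2 * d] so as to be differentiable at the ends t0 -
    d and t0 + d as well. *)
Let step (x y : R -> 'rV[R]_n) := exists2 G : R -> 'rV[R]_n,
  (forall t : R, t0 - 2 * d < t < t0 + 2 * d ->
    is_derive (t : R^o) 1 G (F (clamp t) (x t))) &
  y = fun t => x0 + (G (clamp t) - G t0).

Let inI (t : R) : `|t - t0| <= d -> t0 - 2 * d < t < t0 + 2 * d.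
Proof. rewrite ler_distl; have := d0; move=> ? /andP[? ?]; apply/andP; lra. Qed.

Let step_ex x : continuous x -> exists y, step x y.
Proof.
move=> /rhs_continuous /(primitive (t0 - 2 * d) (t0 + 2 * d))[G HG].
by exists (fun t => x0 + (G (clamp t) - G t0)); exists G.
Qed.

Let step_continuous x y : step x y -> continuous y.
Proof.
move=> [G HG ->] t; apply: (cvgD (cvg_cst _)); apply: cvgB; last exact: cvg_cst.
apply: (@continuous_comp _ _ _ clamp G); first exact: clamp_cont.
by apply: derivable_continuous; have [] := HG _ (inI (clamp_dist t)).
Qed.

(** The difference of the primitives has derivative at most [L * K] over a time at most [d], and
    [d * L <= 2^-1]. *)
Let step_contract x x' y y' K : step x y -> step x' y' ->
  (forall t, `|x t - x' t| <= K) -> forall t, `|y t - y' t| <= K / 2.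
Proof.
move=> [G HG ->] [G' HG' ->] xK t.
have K0 : 0 <= K by exact: le_trans (xK t).
have -> : x0 + (G (clamp t) - G t0) - (x0 + (G' (clamp t) - G' t0)) =
    (G - G') (clamp t) - (G - G') t0.
  rewrite -[(G - G') (clamp t)]/(G (clamp t) - G' (clamp t)).
  rewrite -[(G - G') t0]/(G t0 - G' t0) opprD addrACA subrr add0r !opprB.
  by rewrite (addrC (G' t0)) addrACA (addrC (- G t0)).
pose I := [set t : R | `|t - t0| <= d].
have iI : is_interval I.
  move=> u v; rewrite /I/= !ler_distl => /andP[a b] /andP[a' b'] z /andP[uz zv].
  by rewrite ler_distl (le_trans a uz) (le_trans zv b').
have It0 : I t0 by rewrite /I/= subrr normr0 ltW.
have H u : I u -> derivable (G - G' : R^o -> _) u 1 /\ `|'D_1 (G - G') u| <= L * K.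
  move=> Iu; have [Gd GE] := is_deriveB (HG _ (inI Iu)) (HG' _ (inI Iu)).
  split; first exact: Gd.
  rewrite GE (clampE Iu); apply: le_trans (F_lipschitz _ _ Iu) _.
  exact: ler_wpM2l.
apply: le_trans (mean_value_le iI H (clamp_dist t) It0) _.
apply: le_trans (_ : L * K * d <= _); first by rewrite ler_wpM2l// mulr_ge0.
by rewrite mulrC mulrA mulrC ler_wpM2l.
Qed.

Lemma picard : exists x : R -> 'rV[R]_n, x t0 = x0 /\
  forall t : R, `|t - t0| < d -> is_derive (t : R^o) 1 x (F t (x t)).
Proof.
have /boolp.choice[T HT] : forall x, exists y, continuous x -> step x y.
  move=> x; have [xc|xc] := pselect (continuous x); last by exists x.
  by have [y xy] := step_ex xc; exists y.
pose u k := iter k T (cst x0).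
have uc k : continuous (u k).
  elim: k => [|k IH]; first exact: cst_continuous.
  exact: step_continuous (HT _ IH).
have us k : step (u k) (u k.+1) by exact: HT.
(* The first increment is continuous and factors through [clamp], so its maximum over the compact
   interval bounds it everywhere. *)
have [K HK] : exists K, forall t, `|u 1%N t - u 0%N t| <= K.
  have ab : t0 - d <= t0 + d by have := d0; lra.
  have [|c _ cM] := @EVT_max _ (fun t => `|u 1%N t - u 0%N t|) _ _ ab.
    apply: continuous_subspaceT => t.
    apply: (@continuous_comp _ _ _ (u 1%N - u 0%N) (@Num.norm _ _)).
      by apply: continuousB; exact: uc.
    exact: norm_continuous.
  exists `|u 1%N c - u 0%N c| => t.
  have -> : u 1%N t - u 0%N t = u 1%N (clamp t) - u 0%N (clamp t).
    by have [G _ ->] := us 0%N; rewrite (clampE (clamp_dist t)).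
  by apply: cM; rewrite in_itv/= -ler_distl.
have uK k : forall t, `|u k.+1 t - u k t| <= K / 2 ^+ k.
  elim: k => [|k IH] t; first by rewrite expr0 divr1.
  by rewrite exprSr invfM mulrA; exact: step_contract (us k.+1) (us k) IH t.
have /boolp.choice[x Hx] : forall t, exists l, forall k,
    `|l - u k t| <= 2 * K / 2 ^+ k.
  by move=> t; apply: (@geometric_limit_rV _ _ (u^~ t)) => k; exact: uK.
have xc : continuous x.
  move=> t; apply/cvgrPdist_le => e e0.
  have [k ke] := geometric_small (2 * K) (divr_gt0 e0 (ltr0n _ 3)).
  near=> s; rewrite -(subrKA (u k t)) -(subrKA (u k s) (u k t)).
  have -> : e = e / 3 + (e / 3 + e / 3) by lra.
  rewrite (le_trans (ler_normD _ _))// lerD//; first exact: le_trans (Hx t k) ke.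
  rewrite (le_trans (ler_normD _ _))// lerD//.
    near: s; have /cvgrPdist_le := uc k t; apply; exact: divr_gt0.
  by rewrite distrC; exact: le_trans (Hx s k) ke.
have sx := HT _ xc.
(* By contraction [T x] is as close to [u k.+1] as [x] is, for every [k]. *)
have xE : T x = x.
  apply/funext => t; apply/eqP; rewrite -subr_eq0 -normr_le0.
  apply/ler_addgt0Pr => e e0; rewrite add0r.
  have [k ke] := geometric_small (2 * K) e0.
  rewrite -(subrKA (u k.+1 t)) (le_trans (ler_normD _ _))//.
  have h1 := step_contract sx (us k) (Hx^~ k) t.
  have h2 := Hx t k.+1; rewrite distrC exprSr invfM mulrA in h2.
  by apply: le_trans (lerD h1 h2) _; lra.
case: sx => G HG; rewrite xE => xG; exists x; split.
  by rewrite xG clampE ?subrr ?addr0// normr0 ltW.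
move=> t td; have td' := ltW td; have := HG t (inI td'); rewrite clampE// => Gd.
have : is_derive (t : R^o) 1 (fun t => x0 + (G t - G t0)) (F t (x t)).
  have := is_deriveD (is_derive_cst x0 (t : R^o) 1)
    (is_deriveB Gd (is_derive_cst (G t0) (t : R^o) 1)).
  by rewrite subr0 add0r; exact.
apply: near_eq_is_derive.
by apply: filterS (near_norm_lt td) => s sd; rewrite xG clampE// ltW.
Unshelve. all: by end_near. Qed.

End Picard.

Section CkRow.
Variables (R : realType) (V : normedModType R).

Lemma Ck_row n k (U : set V) (f : V -> 'rV[R]_n) : open U ->
  (forall j, Ck k U (fun x => f x 0 j : R^o)) -> Ck k U f.
Proof.
move=> oU H.
apply: (@Ck_eq _ _ _ _ _ _ (fun x => \sum_(j < n) f x 0 j *: delta_mx 0 j)) => //.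
  by move=> x _; exact: row_sum_delta.
by apply: Ck_sum => // j; apply: CkZ => //; exact: Ck_cst.
Qed.

End CkRow.

Section LocalLipschitz.
Variables (R : realType) (n p : nat).
Implicit Types (c x y z : 'rV[R]_n).

Lemma ball_norm_convex c r x y (t : R) : `|x - c| <= r -> `|y - c| <= r ->
  0 <= t <= 1 -> `|x + t *: (y - x) - c| <= r.
Proof.
move=> xr yr /andP[t0 t1].
have -> : x + t *: (y - x) - c = (1 - t) *: (x - c) + t *: (y - c).
  rewrite scalerBl scale1r -addrA (addrC _ (- c)) addrA -!addrA; congr (_ + (_ + _)).
  by rewrite -scalerN -scalerDr opprB (addrC (c - x)) subrKA.
rewrite (le_trans (ler_normD _ _))// !normrZ ger0_norm ?subr_ge0// ger0_norm//.
have := ler_wpM2l t0 yr.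
have /ler_wpM2l : 0 <= 1 - t by rewrite subr_ge0.
move=> /(_ _ _ xr); lra.
Qed.

Lemma near_closed_ball c (P : set 'rV[R]_n) : (\forall y \near c, P y) ->
  exists2 r : R, 0 < r & forall y, `|y - c| <= r -> P y.
Proof.
move=> /nbhs_normP[r /= r0 H]; exists (r / 2); first exact: divr_gt0.
move=> y yr; apply: H; rewrite /= distrC (le_lt_trans yr)//.
by rewrite ltr_pdivrMr// ltr_pMr// ltr1n.
Qed.

Lemma local_lipschitz (f : 'rV[R]_n -> 'rV[R]_p) (O : set 'rV[R]_n) c :
  open O -> O c -> Ck 1 O f -> exists r L : R,
  [/\ 0 < r, 0 <= L, forall y, `|y - c| <= r -> O y,
     forall y, `|y - c| <= r -> `|f y| <= L &
     forall y z, `|y - c| <= r -> `|z - c| <= r -> `|f y - f z| <= L * `|y - z|].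
Proof.
move=> oO Oc fC; have [fd fD] := fC.
pose M : R := \sum_(j < n) (`|'D_(delta_mx 0 j) f c| + 1).
have M0 : 0 <= M by apply: sumr_ge0 => j _; rewrite addr_ge0.
have : \forall y \near c, (O y /\ `|f y| <= `|f c| + 1) /\
    forall j, `|'D_(delta_mx 0 j) f y| <= `|'D_(delta_mx 0 j) f c| + 1.
  apply: filterI; first apply: filterI.
  - exact: open_nbhs_nbhs.
  - have /cvg_norm/cvgr_le := Ck_continuous fC Oc; apply.
    by rewrite ltrDl.
  - near=> y => j; move: j; near: y; apply: filter_forall => j /=.
    have /cvg_norm/cvgr_le := fD (delta_mx 0 j) c Oc; apply.
    by rewrite ltrDl.
(* A single constant is to bound both [f] and its difference quotients, hence the sum of the two
   bounds. *)
move=> /near_closed_ball[r r0 H]; exists r, (M + (`|f c| + 1)); split=> //.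
- by rewrite !addr_ge0.
- by move=> y /H[[]].
- by move=> y /H[[_ ?] _]; apply: le_trans (_ : `|f c| + 1 <= _); rewrite ?lerDr.
have Dle w y : `|y - c| <= r -> `|'d f y w| <= M * `|w|.
  move=> /H[[Oy _] My]; rewrite [in 'd f y w](row_sum_delta w) linear_sum.
  rewrite (le_trans (ler_norm_sum _ _ _))// mulr_suml ler_sum// => j _.
  rewrite linearZ normrZ mulrC ler_pM ?rV_coord_le//.
  by rewrite -deriveE; [exact: My|exact: fd].
move=> y z yr zr; pose g (t : R) := f (z + t *: (y - z)).
have iI : is_interval [set t : R | 0 <= t <= 1].
  move=> u v /andP[u0 _] /andP[_ v1] w /andP[uw wv].
  by rewrite /= (le_trans u0 uw) (le_trans wv v1).
have gd (t : R) : 0 <= t <= 1 -> derivable (g : R^o -> _) t 1 /\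
    `|'D_1 g t| <= M * `|y - z|.
  move=> t01; have zt := ball_norm_convex zr yr t01; have [[Ot _] _] := H _ zt.
  pose l : R^o -> 'rV[R]_n := fun t : R => z + t *: (y - z).
  have ld : is_diff (t : R^o) l (fun s : R => s *: (y - z)).
    by apply: is_diff_eq; rewrite add0r.
  have ld' := ex_diff (is_diff_def := ld).
  have gdf : differentiable (g : R^o -> _) t.
    by apply: (@differentiable_comp _ _ _ _ l f) => //; exact: fd.
  split; first exact/derivable1_diffP.
  rewrite deriveE// (@diff_comp _ _ _ _ l f)//; last exact: fd.
  by rewrite /= diff_val scale1r; exact: Dle.
have := mean_value_le iI gd (_ : [set t : R | 0 <= t <= 1] 1) (_ : [set t : R | 0 <= t <= 1] 0).
rewrite /g scale1r scale0r addr0 [z + _]addrC subrK subr0 normr1 mulr1 /=.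
rewrite !lexx ler01 => /(_ isT isT) /le_trans; apply.
by rewrite ler_wpM2r// lerDl addr_ge0.
Unshelve. all: by end_near. Qed.

End LocalLipschitz.

Section Clamp.
Variables (R : realType) (n : nat).
Implicit Types (c x y : 'rV[R]_n).

Definition clampr (a b t : R) := Num.max a (Num.min b t).

Lemma clampr_lipschitz a b s t : `|clampr a b s - clampr a b t| <= `|s - t|.
Proof.
rewrite /clampr !maxEle !minEle; do !case: ifP => //; move=> *; rewrite ?subrr ?normr0//;
  rewrite !ler_norml; apply/andP; (case: (lerP 0 (s - t)) => *;
  [rewrite ger0_norm|rewrite ltr0_norm]; lra).
Qed.

(** A 1-Lipschitz retraction onto the closed ball. Composing with it turns a field that is Lipschitz
    on the ball into a globally Lipschitz one, as [picard] requires. *)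
Definition clamp_ball c (r : R) x : 'rV[R]_n :=
  \row_j clampr (c 0 j - r) (c 0 j + r) (x 0 j).

Lemma clamp_ball_lipschitz c r x y :
  `|clamp_ball c r x - clamp_ball c r y| <= `|x - y|.
Proof.
apply: rV_norm_le => // j; rewrite !mxE (le_trans (clampr_lipschitz _ _ _ _))//.
by have := rV_coord_le (x - y) j; rewrite !mxE.
Qed.

Lemma clamp_ball_in c r x : 0 <= r -> `|clamp_ball c r x - c| <= r.
Proof.
move=> r0; apply: rV_norm_le => // j.
by rewrite !mxE ler_distl le_max lexx ge_max ge_min lexx /= andbT; lra.
Qed.

Lemma clamp_ball_id c r x : `|x - c| <= r -> clamp_ball c r x = x.
Proof.
move=> xr; apply/rowP => j; rewrite !mxE /clampr.
have : `|x 0 j - c 0 j| <= r.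
  by apply: le_trans xr; have := rV_coord_le (x - c) j; rewrite !mxE.
by rewrite ler_distl => /andP[? ?]; rewrite min_r// max_r.
Qed.

End Clamp.

Section LocalFlow.
Variables (R : realType) (n : nat) (O : set 'rV[R]_n) (F : 'rV[R]_n -> 'rV[R]_n).
Hypothesis oO : open O.

(** The equation is solved for the field composed with [clamp_ball]. Its speed is at most [L], so a
    solution started in the half ball stays in the ball for a short time, and there the clamping is
    invisible. *)
Lemma local_flow c : O c -> Ck 1 O F -> exists r e L : R,
  [/\ 0 < r, 0 < e, 0 <= L,
    forall y z, `|y - c| <= r -> `|z - c| <= r -> `|F y - F z| <= L * `|y - z| &
    forall z0, `|z0 - c| <= r / 2 -> exists z : R -> 'rV[R]_n, z 0 = z0 /\
      forall t : R, `|t| < e -> [/\ is_derive (t : R^o) 1 z (F (z t)),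
        O (z t) & `|z t - c| < r]].
Proof.
move=> Oc /(local_lipschitz oO Oc)[r [L [r0 L0 rO FL Flip]]].
(* The first term gives [e * L <= 2^-1] for the contraction, the second [L * e < r / 2] for staying
   in the ball; [L + 1] avoids division by zero. *)
pose e := Num.min (2 * (L + 1))^-1 (r / (2 * (L + 1))).
have L1 : 0 < L + 1 by rewrite ltr_wpDl.
have e0 : 0 < e by rewrite lt_min invr_gt0 divr_gt0// !mulr_gt0.
exists r, e, L; split=> // z0 z0r.
have eL : e * L <= 2^-1.
  apply: le_trans (_ : (2 * (L + 1))^-1 * (L + 1) <= _).
    by apply: ler_pM; [exact: ltW|exact: L0|rewrite ge_min lexx|rewrite lerDl].
  by rewrite invfM mulfVK ?gt_eqF.
have [||z [z00 zD]] := @picard R n (fun _ x => F (clamp_ball c r x)) 0 e L z0 e0 L0 eL.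
- move=> _ x y _; apply: le_trans (Flip _ _ _ _) _; try exact/clamp_ball_in/ltW.
  by rewrite ler_wpM2l// clamp_ball_lipschitz.
- by move=> t x _; exact: cst_continuous.
exists z; split=> // t te.
have iI : is_interval [set s : R | `|s| < e].
  by have := @is_interval_norm_lt R 0 e; under eq_set do rewrite subr0.
have H (s : R) : `|s| < e -> derivable (z : R^o -> _) s 1 /\ `|'D_1 z s| <= L.
  have := zD s; rewrite subr0 => /[apply] -[zd ->]; split=> //.
  exact/FL/clamp_ball_in/ltW.
have ztr : `|z t - c| < r.
  rewrite -(subrKA z0) (le_lt_trans (ler_normD _ _))//.
  have := mean_value_le iI H te (_ : `|0 : R| < e); rewrite normr0 => /(_ e0).
  rewrite z00 subr0 => zt.
  suff : `|z t - z0| < r / 2 by lra.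
  apply: le_lt_trans zt _; apply: le_lt_trans (_ : (L * e) < _).
    by rewrite ler_wpM2l// ltW.
  apply: lt_le_trans (_ : (L + 1) * e <= _); first by rewrite ltr_pM2r// ltrDl.
  apply: le_trans (_ : (L + 1) * (r / (2 * (L + 1))) <= _).
    by rewrite (ler_wpM2l (ltW L1))// ge_min lexx orbT.
  by rewrite invfM mulrCA [_ * (_ / _)]mulrCA mulfV ?mulr1// gt_eqF.
split=> //; last exact/rO/ltW.
by have := zD t; rewrite subr0 clamp_ball_id ?ltW//; exact.
Qed.

(** Bootstrapping: the derivative of [z] is [F \o z], which is as regular as [z]. *)
Lemma flow_smooth (I : set R) (z : R -> 'rV[R]_n) : open I -> smooth_on O F ->
  (forall t, I t -> O (z t) /\ is_derive (t : R^o) 1 z (F (z t))) ->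
  smooth_on I (z : R^o -> 'rV[R]_n).
Proof.
move=> oI Fs zD.
have zd t : I t -> differentiable (z : R^o -> _) t.
  by move=> /zD[_ []] /derivable1_diffP.
elim=> [|k IH]; first by move=> t /zd; exact: differentiable_continuous.
split=> [t /zd//|v].
apply: (@Ck_eq _ _ _ _ _ _ (fun t : R^o => v *: (F \o z) t)) => //.
  move=> t It; rewrite (derive_regular _ (zd _ It)); congr (_ *: _).
  by have [_ [_ ->]] := zD _ It.
apply: CkZ => //; first exact: Ck_cst.
apply: (@Ck_comp _ _ _ _ k I O z F) => //; first exact: fin_basis_rV.
by move=> t /zD[].
Qed.

End LocalFlow.

(** * Charts and tangent vectors *)

Section ChartBasics.
Variables (R : realType) (m : nat) (M : topologicalType) (c : chart R m M).

Lemma cmap_in_cimg p : cdom c p -> cimg c (cmap c p).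
Proof. by move=> cp; exists p. Qed.

Lemma cdom_cinv x : cimg c x -> cdom c (cinv c x).
Proof. by move=> [p cp <-]; rewrite cmapK. Qed.

Lemma cinvK x : cimg c x -> cmap c (cinv c x) = x.
Proof. by move=> [p cp <-]; rewrite cmapK. Qed.

Lemma cmap_continuous_at p : cdom c p -> {for p, continuous (cmap c)}.
Proof.
move=> cp; have := @cmap_continuous _ _ _ c.
rewrite continuous_open_subspace; last exact: cdom_open.
by apply; rewrite inE.
Qed.

Lemma cinv_continuous_at x : cimg c x -> {for x, continuous (cinv c)}.
Proof.
move=> cx; have := @cinv_continuous _ _ _ c.
rewrite continuous_open_subspace; last exact: cimg_open.
by apply; rewrite inE.
Qed.

Lemma open_preimage_on (S T : topologicalType) (f : S -> T) (U : set S) (O : set T) :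
  open U -> open O -> (forall x, U x -> {for x, continuous f}) ->
  open (U `&` f @^-1` O).
Proof.
move=> oU oO fc; rewrite openE => x [Ux Ox]; rewrite /interior.
apply: filterI; first exact: open_nbhs_nbhs.
by apply: (fc x Ux); exact: open_nbhs_nbhs.
Qed.

End ChartBasics.

Section AtlasBasics.
Variables (R : realType) (m : nat) (M : topologicalType) (A : smooth_atlas R m M).
Implicit Types (i j k : chart_index A) (p q : M).

Definition tdom i j : set 'rV[R]_m := cimg (A i) `&` cinv (A i) @^-1` cdom (A j).

Lemma tdomE i j : tdom i j = cmap (A i) @` (cdom (A i) `&` cdom (A j)).
Proof.
apply/seteqP; split=> [x [xi xj]|_ [p [pi pj] <-]].
  by exists (cinv (A i) x); [split=> //; exact: cdom_cinv|exact: cinvK].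
by split; [exact: cmap_in_cimg|rewrite /= cmapK].
Qed.

Lemma open_tdom i j : open (tdom i j).
Proof.
apply: open_preimage_on; [exact: cimg_open|exact: cdom_open|].
exact: cinv_continuous_at.
Qed.

Lemma smooth_transition i j : smooth_on (tdom i j) (transition (A i) (A j)).
Proof. by rewrite tdomE; exact: transition_smooth. Qed.

Lemma tdom_cmap i j p : cdom (A i) p -> cdom (A j) p -> tdom i j (cmap (A i) p).
Proof. by move=> pi pj; rewrite tdomE; exists p. Qed.

Lemma transition_cmap i j p : cdom (A i) p ->
  transition (A i) (A j) (cmap (A i) p) = cmap (A j) p.
Proof. by move=> pi; rewrite /transition /= cmapK. Qed.

Lemma transition_tdom i j x : tdom i j x -> tdom j i (transition (A i) (A j) x).
Proof.
rewrite !tdomE => -[p [pi pj] <-]; exists p => //.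
by rewrite transition_cmap.
Qed.

Lemma differentiable_transition i j p : cdom (A i) p -> cdom (A j) p ->
  differentiable (transition (A i) (A j)) (cmap (A i) p).
Proof.
move=> pi pj; have [+ _] := smooth_transition i j 1%N.
by apply; exact: tdom_cmap.
Qed.

Section TangentCoordinates.
Variable p : M.
Implicit Types v w : tangent A p.

Lemma tcoordD v w i : tcoord (v + w) i = tcoord v i + tcoord w i.
Proof. by []. Qed.

Lemma tcoordZ (a : R) v i : tcoord (a *: v) i = a *: tcoord v i.
Proof. by []. Qed.

Lemma tcoord0 i : tcoord (0 : tangent A p) i = 0.
Proof. by []. Qed.

Lemma tcoord_sum n (f : 'I_n -> tangent A p) i :
  tcoord (\sum_k f k) i = \sum_k tcoord (f k) i.
Proof.
elim: n f => [|n IH] f; first by rewrite !big_ord0.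
by rewrite !big_ord_recr -IH.
Qed.

Lemma tcoord_transition v i j : cdom (A i) p -> cdom (A j) p ->
  tcoord v j = 'd (transition (A i) (A j)) (cmap (A i) p) (tcoord v i).
Proof. by have /asboolP[H _] := tcoordP v; exact: H. Qed.

Lemma tcoord_out v i : ~ cdom (A i) p -> tcoord v i = 0.
Proof. by have /asboolP[_ H] := tcoordP v; exact: H. Qed.

Lemma tcoord_inj v w : tcoord v = tcoord w -> v = w.
Proof. exact: (@val_inj _ _ (tangent A p)). Qed.

Lemma tangent_eq v w i : cdom (A i) p -> tcoord v i = tcoord w i -> v = w.
Proof.
move=> pi vw; apply: tcoord_inj; apply/funext => j.
have [pj|pj] := pselect (cdom (A j) p); last by rewrite !tcoord_out.
by rewrite !(@tcoord_transition _ i j)// vw.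
Qed.

End TangentCoordinates.

Lemma transition_id_diff i p u : cdom (A i) p ->
  'd (transition (A i) (A i)) (cmap (A i) p) u = u.
Proof.
move=> pi; rewrite -deriveE; last exact: differentiable_transition.
rewrite -[RHS](derive_id (cmap (A i) p) u); apply: near_eq_derive.
have : \forall x \near cmap (A i) p, cimg (A i) x.
  by apply: open_nbhs_nbhs; split; [exact: cimg_open|exact: cmap_in_cimg].
by apply: filterS => x xi; rewrite /transition /= cinvK.
Qed.

Definition tvec_coord i p (u : 'rV[R]_m) : chart_index A -> 'rV[R]_m := fun j =>
  if `[< cdom (A i) p /\ cdom (A j) p >]
  then 'd (transition (A i) (A j)) (cmap (A i) p) u else 0.

Fact tvec_subproof i p u : tvec_coord i p u \in is_tangent (A := A) p.
Proof.
apply/asboolP; split=> [j k pj pk|j pj]; last first.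
  by rewrite /tvec_coord asboolF// => -[].
have [pi|pi] := pselect (cdom (A i) p); last first.
  by rewrite /tvec_coord !asboolF ?linear0// => -[].
by rewrite /tvec_coord !asboolT//; exact: transition_diff.
Qed.

(* The tangent vector at [p] with coordinates [u] in the chart [i]; it is 0 when
   [p] is not in the domain of [i]. *)
Definition tvec i p u : tangent A p := Tangent (tvec_subproof i p u).

Lemma tcoord_tvec i p u : cdom (A i) p -> tcoord (tvec i p u) i = u.
Proof. by move=> pi; rewrite /= /tvec_coord asboolT// transition_id_diff. Qed.

Lemma tvec_out i p u : ~ cdom (A i) p -> tvec i p u = 0.
Proof.
move=> pi; apply: tcoord_inj; apply/funext => j.
by rewrite tcoord0 /= /tvec_coord asboolF// => -[].
Qed.

Lemma tvec_tcoord i p (v : tangent A p) : cdom (A i) p ->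
  tvec i p (tcoord v i) = v.
Proof. by move=> pi; apply: (tangent_eq pi); rewrite tcoord_tvec. Qed.

Lemma near_cdom i p : cdom (A i) p -> \forall q \near p, cdom (A i) q.
Proof. by move=> pi; apply: open_nbhs_nbhs; split; [exact: cdom_open|]. Qed.

Section Curves.
Variable gamma : R -> M.

Lemma velocityE i t : cdom (A i) (gamma t) ->
  @velocity R m M A gamma t i = 'D_1 (cmap (A i) \o gamma : R^o -> _) t.
Proof. by move=> pi; rewrite /velocity asboolT// derive1E. Qed.

Lemma near_transition i j t : {for t, continuous gamma} ->
  cdom (A i) (gamma t) -> \forall s \near t,
  (transition (A i) (A j) \o (cmap (A i) \o gamma)) s = (cmap (A j) \o gamma) s.
Proof.
move=> gc pi; have : \forall s \near t, cdom (A i) (gamma s).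
  exact: gc (near_cdom pi).
apply: filterS => s ps.
by rewrite /= transition_cmap.
Qed.

Lemma differentiable_chart i j t : {for t, continuous gamma} ->
  cdom (A i) (gamma t) -> cdom (A j) (gamma t) ->
  differentiable (cmap (A i) \o gamma : R^o -> _) t ->
  differentiable (cmap (A j) \o gamma : R^o -> _) t.
Proof.
move=> gc pi pj xd; apply: near_eq_differentiable (near_transition j gc pi) _.
by apply: differentiable_comp => //; exact: differentiable_transition.
Qed.

Lemma velocity_tangent i t : {for t, continuous gamma} ->
  cdom (A i) (gamma t) -> differentiable (cmap (A i) \o gamma : R^o -> _) t ->
  @velocity R m M A gamma t \in is_tangent (A := A) (gamma t).
Proof.
move=> gc pi xd; apply/asboolP; split=> [j k pj pk|j pj]; last first.
  by rewrite /velocity asboolF.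
have xdj := differentiable_chart gc pi pj xd.
rewrite !velocityE//.
rewrite -(derive_comp _ xdj); last exact: differentiable_transition.
apply: near_eq_derive.
by have := near_transition k gc pj; apply: filterS => s ->.
Qed.

Lemma smooth_curve_chart i (U : set R) : open U -> smooth_curve A U gamma ->
  open (U `&` gamma @^-1` cdom (A i)) /\ forall t, U t -> cdom (A i) (gamma t) ->
  differentiable (cmap (A i) \o gamma : R^o -> _) t.
Proof.
move=> oU [gc gs]; split; first by apply: open_preimage_on => //; exact: cdom_open.
by move=> t Ut pi; have [+ _] := gs i 1%N; apply.
Qed.

End Curves.

Lemma smooth_curve_cinv i (I : set R) (x : R -> 'rV[R]_m) : open I ->
  smooth_on I (x : R^o -> _) -> (forall t, I t -> cimg (A i) (x t)) ->
  smooth_curve A I (cinv (A i) \o x).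
Proof.
move=> oI xs xi.
have gc t : I t -> {for t, continuous (cinv (A i) \o x)}.
  move=> It; apply: continuous_comp; last exact/cinv_continuous_at/xi.
  exact: (Ck_continuous (xs 0%N)).
split=> // j k.
apply: (@Ck_comp _ _ _ _ k _ (tdom i j) x (transition (A i) (A j))).
- exact: fin_basis_rV.
- by apply: open_preimage_on => //; exact: cdom_open.
- exact: Ck_sub (@subIsetl _ _ _) (xs k).
- exact: smooth_transition.
- by move=> t [It tj]; split=> //; exact: xi.
Qed.

End AtlasBasics.

(** * Functions and vector fields extended by zero *)

Section FieldOperations.
Variables (R : realType) (m : nat) (M : topologicalType) (A : smooth_atlas R m M).
Implicit Types (i j k : chart_index A) (p q : M) (X Y : vector_field A).

Fact vf_scale_smooth (f : M -> R) X i : smooth_fun A f ->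
  smooth_on (cimg (A i)) (fun x => tcoord (f (cinv (A i) x) *: X (cinv (A i) x)) i).
Proof.
by move=> fs k; apply: CkZ; [exact: cimg_open|exact: fs|exact: vf_smooth].
Qed.

Definition vf_scale f (fs : smooth_fun A f) X : vector_field A :=
  VectorField (vf_fun := fun p => f p *: X p) (fun i => @vf_scale_smooth f X i fs).

Fact vf_sum_smooth n (Z : 'I_n -> vector_field A) i :
  smooth_on (cimg (A i)) (fun x => tcoord (\sum_a Z a (cinv (A i) x)) i).
Proof.
move=> k; have -> : (fun x => tcoord (\sum_a Z a (cinv (A i) x)) i) =
    (fun x => \sum_a tcoord (Z a (cinv (A i) x)) i).
  by apply/funext => x; rewrite tcoord_sum.
by apply: Ck_sum => [|a]; [exact: cimg_open|exact: vf_smooth].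
Qed.

Definition vf_sum n (Z : 'I_n -> vector_field A) : vector_field A :=
  VectorField (vf_fun := fun p => \sum_a Z a p) (vf_sum_smooth Z).

Lemma smooth_cst (a : R) : smooth_fun A (cst a).
Proof. by move=> i k; exact: Ck_cst. Qed.

Lemma dirderivE f p (v : tangent A p) i : smooth_fun A f -> cdom (A i) p ->
  dirderiv v f =
  'd (f \o cinv (A i) : 'rV[R]_m -> R^o) (cmap (A i) p) (tcoord v i).
Proof.
move=> fs pi; rewrite /dirderiv; set c := chart_at A p.
have pc : cdom (A c) p by exact: chart_atP.
have fd j : cdom (A j) p ->
    differentiable (f \o cinv (A j) : 'rV[R]_m -> R^o) (cmap (A j) p).
  by move=> pj; have [+ _] := fs j 1%N; apply; exact: cmap_in_cimg.
rewrite (tcoord_transition v pc pi) -[in 'd _ (cmap (A i) p)](transition_cmap i pc).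
apply: diff_comp_near.
- exact: differentiable_transition.
- by rewrite transition_cmap//; exact: fd.
- exact: fd.
- have := open_nbhs_nbhs (conj (@open_tdom _ _ _ A c i) (tdom_cmap pc pi)).
  by apply: filterS => x [_ /= xi]; rewrite /transition /= cmapK.
Qed.

Section Nabla.
Variable D : connection A.

Lemma nabla_sum X Y n (Z : 'I_n -> vector_field A) :
  (forall p, Y p = \sum_a Z a p) -> forall p, D X Y p = \sum_a D X (Z a) p.
Proof.
elim: n Y Z => [|n IH] Y Z YZ p.
  (* An empty sum is its own double, so additivity forces its derivative to be 0. *)
  have Y0 q : Y q = Y q + Y q by rewrite YZ big_ord0 addr0.
  have /eqP := nablaDr D X Y0 p.
  by rewrite big_ord0 -subr_eq0 opprD addrA subrr sub0r oppr_eq0 => /eqP.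
pose S := vf_sum (fun a => Z (widen_ord (leqnSn n) a)).
rewrite big_ord_recr /= -(IH S)//; apply: nablaDr => q.
by rewrite YZ big_ord_recr.
Qed.

Lemma nabla_suml X Y n (Z : 'I_n -> vector_field A) :
  (forall p, X p = \sum_a Z a p) -> forall p, D X Y p = \sum_a D (Z a) Y p.
Proof.
elim: n X Z => [|n IH] X Z XZ p.
  have X0 q : X q = X q + X q by rewrite XZ big_ord0 addr0.
  have /eqP := nablaDl D Y X0 p.
  by rewrite big_ord0 -subr_eq0 opprD addrA subrr sub0r oppr_eq0 => /eqP.
pose S := vf_sum (fun a => Z (widen_ord (leqnSn n) a)).
rewrite big_ord_recr /= -(IH S)//; apply: nablaDl => q.
by rewrite XZ big_ord_recr.
Qed.

End Nabla.

End FieldOperations.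

Section Extension.
Variables (R : realType) (m : nat) (M : topologicalType) (A : smooth_atlas R m M).
Hypothesis hM : hausdorff_space M.
Variables (i : chart_index A) (c : 'rV[R]_m) (r : R).
Hypothesis ball_in : forall x, `|x - c| <= r -> cimg (A i) x.

Definition vanishes_off (W : nmodType) (u : 'rV[R]_m -> W) :=
  forall x, r < `|x - c| -> u x = 0.

(** A compact subset of a Hausdorff space is closed. This prevents the support from accumulating at
    points outside the chart, where the extension by zero could otherwise jump. *)
Lemma closed_chart_ball : closed (cinv (A i) @` [set x | `|x - c| <= r]).
Proof.
apply: compact_closed => //; apply: continuous_compact.
  apply: continuous_in_subspaceT => x; rewrite inE => /ball_in.
  exact: cinv_continuous_at.
apply: bounded_closed_compact.
  exists (`|c| + r); split; first exact: num_real.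
  move=> K cK x /= xr; rewrite -(subrK c x) (le_trans (ler_normD _ _))//.
  by rewrite (le_trans _ (ltW cK))// addrC lerD2l.
rewrite (_ : [set x | _] = ~` [set x | r < `|x - c|]).
  apply: open_closedC.
  have := @open_comp _ _ (fun x : 'rV[R]_m => `|x - c|) [set y | r < y].
  apply; last exact: open_gt.
  by move=> x _; exact: (cvg_norm (cvgB cvg_id (cvg_cst c))).
by apply/seteqP; split=> x /=; rewrite leNgt => /negP.
Qed.

Lemma off_chart_ball j x : cimg (A j) x -> ~ cdom (A i) (cinv (A j) x) ->
  exists N, [/\ open N, N x & forall y, N y -> cimg (A j) y /\
    forall (W : nmodType) (u : 'rV[R]_m -> W), vanishes_off u ->
    cdom (A i) (cinv (A j) y) -> u (cmap (A i) (cinv (A j) y)) = 0].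
Proof.
move=> xj xi; set K := cinv (A i) @` [set x | `|x - c| <= r].
exists (cimg (A j) `&` cinv (A j) @^-1` (~` K)); split.
- apply: open_preimage_on; [exact: cimg_open| |exact: cinv_continuous_at].
  by rewrite openC; exact: closed_chart_ball.
- by split=> // -[y /ball_in yi yx]; apply: xi; rewrite -yx; exact: cdom_cinv.
- move=> y [yj yK]; split=> // W u u0 yi; apply: u0.
  rewrite ltNge; apply/negP => yr; apply: yK.
  by exists (cmap (A i) (cinv (A j) y)) => //; rewrite cmapK.
Qed.

Definition ext_fun (u : 'rV[R]_m -> R) (p : M) : R :=
  if `[< cdom (A i) p >] then u (cmap (A i) p) else 0.

Lemma ext_funE u p : cdom (A i) p -> ext_fun u p = u (cmap (A i) p).
Proof. by move=> pi; rewrite /ext_fun asboolT. Qed.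

Lemma ext_fun_out u p : ~ cdom (A i) p -> ext_fun u p = 0.
Proof. by move=> pi; rewrite /ext_fun asboolF. Qed.

Lemma smooth_ext_fun (u : 'rV[R]_m -> R^o) : smooth_on (cimg (A i)) u ->
  vanishes_off u -> smooth_fun A (ext_fun u).
Proof.
move=> us u0 j k; apply: Ck_local => x xj.
have [xi|xi] := pselect (cdom (A i) (cinv (A j) x)).
  exists (tdom j i), (u \o transition (A j) (A i)); split=> //.
  - exact: open_tdom.
  - apply: (@Ck_comp _ _ _ _ k _ (cimg (A i))) => //.
    + exact: fin_basis_rV.
    + exact: open_tdom.
    + exact: smooth_transition.
    + by move=> y /transition_tdom[].
  - by move=> y [yj yi]; rewrite /= ext_funE.
have [N [oN Nx HN]] := off_chart_ball xj xi.
exists N, (cst 0); split=> //; first exact: Ck_cst.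
move=> y /HN[yj Hy] /=.
have [yi|yi] := pselect (cdom (A i) (cinv (A j) y)); last exact: ext_fun_out.
by rewrite ext_funE// Hy.
Qed.

Fact ext_vf_smooth (u : 'rV[R]_m -> 'rV[R]_m) : smooth_on (cimg (A i)) u ->
  vanishes_off u -> forall j, smooth_on (cimg (A j))
    (fun x => tcoord (tvec i (cinv (A j) x) (u (cmap (A i) (cinv (A j) x)))) j).
Proof.
move=> us u0 j k; apply: Ck_local => x xj.
have [xi|xi] := pselect (cdom (A i) (cinv (A j) x)).
  (* The differential of the transition applied to [u], written with partial derivatives so that its
     smoothness follows from that of the transition. *)
  pose g (y : 'rV[R]_m) := \sum_(l < m)
    u y 0 l *: 'D_(delta_mx 0 l) (transition (A i) (A j)) y.
  exists (tdom j i), (g \o transition (A j) (A i)); split=> //.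
  - exact: open_tdom.
  - apply: (@Ck_comp _ _ _ _ k _ (tdom i j) (transition (A j) (A i)) g) => //.
    + exact: fin_basis_rV.
    + exact: open_tdom.
    + exact: smooth_transition.
    + apply: Ck_sum => [|l]; first exact: open_tdom.
      apply: CkZ; first exact: open_tdom.
        apply: Ck_coord; first exact: open_tdom.
        by apply: Ck_sub (us k); exact: subIsetl.
      by have [_ ] := smooth_transition i j k.+1; apply.
    + by move=> y /transition_tdom.
  - move=> y [yj yi]; rewrite -/(transition (A j) (A i) y).
    set z := transition (A j) (A i) y.
    have zE : cmap (A i) (cinv (A j) y) = z by [].
    have jy : cdom (A j) (cinv (A j) y) by exact: cdom_cinv.
    rewrite (@tcoord_transition _ _ _ _ _ _ i j)// tcoord_tvec// zE.
    rewrite [in LHS](row_sum_delta (u z)) linear_sum; apply: eq_bigr => l _.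
    rewrite linearZ /= deriveE//; exact: differentiable_transition.
have [N [oN Nx HN]] := off_chart_ball xj xi.
exists N, (cst 0); split=> //; first exact: Ck_cst.
move=> y /HN[yj Hy]; rewrite [RHS]/=.
have [yi|yi] := pselect (cdom (A i) (cinv (A j) y)); last by rewrite tvec_out.
by rewrite Hy// (_ : tvec i _ 0 = 0)//; apply: (tangent_eq yi); rewrite tcoord_tvec.
Qed.

Definition ext_vf u (us : smooth_on (cimg (A i)) u) (u0 : vanishes_off u) :
  vector_field A := 
  VectorField (vf_fun := fun p => tvec i p (u (cmap (A i) p))) (ext_vf_smooth us u0).

Lemma tcoord_ext_vf u (us : smooth_on (cimg (A i)) u) (u0 : vanishes_off u) p :
  cdom (A i) p -> tcoord (ext_vf us u0 p) i = u (cmap (A i) p).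
Proof. by move=> pi; rewrite tcoord_tvec. Qed.

End Extension.

(** * Christoffel symbols *)

Section Christoffel.
Variables (R : realType) (m : nat).

(** The Christoffel term at [x]: [u] is the direction of differentiation, [v] the differentiated
    vector, and [G l k] stands for the coordinate vector of nabla_{d/dx_l} d/dx_k. *)
Definition christoffel_form (G : 'I_m -> 'I_m -> 'rV[R]_m -> 'rV[R]_m)
    (x u v : 'rV[R]_m) : 'rV[R]_m :=
  \sum_k v 0 k *: \sum_l u 0 l *: G l k x.

Variable G : 'I_m -> 'I_m -> 'rV[R]_m -> 'rV[R]_m.

Lemma christoffel_form_linear x u : linear (christoffel_form G x u).
Proof.
move=> a v w; rewrite /christoffel_form scaler_sumr -big_split /=.
by apply: eq_bigr => k _; rewrite !mxE scalerDl scalerA.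
Qed.

Lemma christoffel_form_scalel x (a : R) u v :
  christoffel_form G x (a *: u) v = a *: christoffel_form G x u v.
Proof.
rewrite /christoffel_form scaler_sumr; apply: eq_bigr => k _.
rewrite [RHS]scalerA mulrC -[RHS]scalerA; congr (_ *: _); rewrite scaler_sumr.
by apply: eq_bigr => l _; rewrite !mxE scalerA.
Qed.

Lemma christoffel_form_scaler x (a : R) u v :
  christoffel_form G x u (a *: v) = a *: christoffel_form G x u v.
Proof.
rewrite /christoffel_form scaler_sumr; apply: eq_bigr => k _.
by rewrite !mxE scalerA.
Qed.

Lemma christoffel_form_sumr x u n (v : 'I_n -> 'rV[R]_m) :
  christoffel_form G x u (\sum_a v a) = \sum_a christoffel_form G x u (v a).
Proof.
rewrite /christoffel_form exchange_big /=; apply: eq_bigr => k _.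
by rewrite -scaler_suml summxE.
Qed.

End Christoffel.

Section LocalFrame.
Variables (R : realType) (m : nat) (M : topologicalType) (A : smooth_atlas R m M).
Hypothesis hM : hausdorff_space M.
Variables (D : connection A) (i : chart_index A) (c : 'rV[R]_m) (r : R).
Hypothesis r0 : 0 < r.
Hypothesis ball_in : forall x, `|x - c| <= 2 * r -> cimg (A i) x.

Let b : 'rV[R]_m -> R^o := bump_at c r.

Lemma smooth_bump_on k : Ck k (cimg (A i)) b.
Proof. by apply: Ck_sub (smooth_bump_at c r k). Qed.

Lemma bump_scale_vanishes (W : lmodType R) (u : 'rV[R]_m -> W) :
  vanishes_off c (2 * r) (fun x => b x *: u x).
Proof. by move=> x xr; rewrite /b bump_at0 ?scale0r// ltW. Qed.

Lemma smooth_bump_scale (W : normedModType R) (u : 'rV[R]_m -> W) :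
  smooth_on (cimg (A i)) u -> smooth_on (cimg (A i)) (fun x => b x *: u x).
Proof.
by move=> us k; apply: CkZ; [exact: cimg_open|exact: smooth_bump_on|exact: us].
Qed.

Fact smooth_cst_on (W : normedModType R) (w : W) : smooth_on (cimg (A i)) (cst w).
Proof. by move=> k; exact: Ck_cst. Qed.

Definition frame_field (l : 'I_m) : vector_field A :=
  ext_vf hM ball_in (smooth_bump_scale (smooth_cst_on (delta_mx 0 l)))
    (@bump_scale_vanishes _ _).

Definition cutoff : M -> R := ext_fun i (fun x => b x *: b x).

Lemma smooth_cutoff : smooth_fun A cutoff.
Proof.
apply: (smooth_ext_fun hM ball_in); last exact: bump_scale_vanishes.
by apply: smooth_bump_scale => k; exact: smooth_bump_on.
Qed.

Definition coef (Y : vector_field A) k : M -> R :=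
  ext_fun i (fun x => b x *: tcoord (Y (cinv (A i) x)) i 0 k).

Lemma smooth_coef Y k : smooth_fun A (coef Y k).
Proof.
apply: (smooth_ext_fun hM ball_in); last exact: (@bump_scale_vanishes R^o).
apply: (@smooth_bump_scale R^o) => j.
by apply: Ck_coord; [exact: cimg_open|exact: vf_smooth].
Qed.

Lemma tcoord_frame_field l p : cdom (A i) p ->
  tcoord (frame_field l p) i = b (cmap (A i) p) *: delta_mx 0 l.
Proof. by move=> pi; rewrite tcoord_ext_vf. Qed.

(* The square leaves one bump for the coefficient and one for the field, so that
   both extend to M. *)
Lemma cutoff_decomposition (Y : vector_field A) p :
  cutoff p *: Y p = \sum_k coef Y k p *: frame_field k p.
Proof.
have [pi|pi] := pselect (cdom (A i) p); last first.
  rewrite /cutoff ext_fun_out// scale0r big1// => k _.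
  by rewrite /coef ext_fun_out// scale0r.
apply: (tangent_eq pi); rewrite tcoord_sum tcoordZ.
rewrite [in LHS](row_sum_delta (tcoord (Y p) i)) scaler_sumr.
apply: eq_bigr => k _; rewrite tcoordZ tcoord_frame_field//.
rewrite /cutoff /coef !ext_funE// cmapK// !scalerA; congr (_ *: _).
by rewrite /GRing.scale /= mulrAC.
Qed.

Definition inner : set M :=
  [set p | cdom (A i) p /\ `|cmap (A i) p - c| < r].

Lemma near_bump1 x : `|x - c| < r -> \forall y \near x, b y = 1.
Proof.
by move=> /near_norm_lt; apply: filterS => y yr; rewrite /b bump_at1// ltW.
Qed.

Lemma cutoff_inner p : inner p -> cutoff p = 1.
Proof.
move=> [pi pr]; rewrite /cutoff ext_funE// (nbhs_singleton (near_bump1 pr)).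
exact: mulr1.
Qed.

Lemma coef_inner Y k p : inner p -> coef Y k p = tcoord (Y p) i 0 k.
Proof.
move=> [pi pr]; rewrite /coef ext_funE// (nbhs_singleton (near_bump1 pr)) cmapK//.
exact: mul1r.
Qed.

Lemma inner_frame_field l p : inner p -> tcoord (frame_field l p) i = delta_mx 0 l.
Proof.
move=> [pi pr]; rewrite tcoord_frame_field//.
by rewrite (nbhs_singleton (near_bump1 pr)) scale1r.
Qed.

Lemma near_inner p : inner p -> \forall x \near cmap (A i) p,
  [/\ cimg (A i) x, `|x - c| < r & inner (cinv (A i) x)].
Proof.
move=> [pi pr]; near=> x; have xi : cimg (A i) x.
  near: x; apply: open_nbhs_nbhs; split; [exact: cimg_open|exact: cmap_in_cimg].
have xr : `|x - c| < r by near: x; exact: near_norm_lt pr.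
by split=> //; split; [exact: cdom_cinv|rewrite cinvK].
Unshelve. all: by end_near. Qed.

Lemma differentiable_smooth_fun f p : smooth_fun A f -> cdom (A i) p ->
  differentiable (f \o cinv (A i) : 'rV[R]_m -> R^o) (cmap (A i) p).
Proof. by move=> /(_ i 1%N)[+ _] pi; apply; exact: cmap_in_cimg. Qed.

Lemma dirderiv_cutoff p (v : tangent A p) : inner p -> dirderiv v cutoff = 0.
Proof.
move=> ip; have [pi pr] := ip; have cs := smooth_cutoff.
rewrite (dirderivE _ cs pi) -deriveE; last exact: differentiable_smooth_fun.
rewrite -[RHS](derive_cst (1 : R^o) (cmap (A i) p) (tcoord v i)).
apply: near_eq_derive; apply: filterS (near_inner ip) => x [_ _ xin].
exact: cutoff_inner.
Qed.

Definition vf_coord (Y : vector_field A) x := tcoord (Y (cinv (A i) x)) i.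

Lemma differentiable_vf_coord Y p : cdom (A i) p ->
  differentiable (vf_coord Y) (cmap (A i) p).
Proof. by move=> pi; have [+ _] := vf_smooth Y i 1%N; apply; exact: cmap_in_cimg. Qed.

Lemma dirderiv_coef Y k p (v : tangent A p) : inner p ->
  dirderiv v (coef Y k) = ('d (vf_coord Y) (cmap (A i) p) (tcoord v i)) 0 k.
Proof.
move=> ip; have [pi pr] := ip; have cs := smooth_coef Y k.
rewrite (dirderivE _ cs pi) -deriveE; last exact: differentiable_smooth_fun.
have yd := differentiable_vf_coord Y pi.
rewrite -deriveE//.
have [_ <-] := derivable_coord k (diff_derivable (v := tcoord v i) yd).
apply: near_eq_derive; apply: filterS (near_inner ip) => x [_ _ xin].
exact: coef_inner.
Qed.

(** Computed from the cut-off frame, hence smooth on the whole chart image; it has the meaning of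
    Christoffel symbols only where the bump is 1. *)
Definition gam (l k : 'I_m) (x : 'rV[R]_m) : 'rV[R]_m :=
  vf_coord (D (frame_field l) (frame_field k)) x.

Lemma smooth_gam l k : smooth_on (cimg (A i)) (gam l k).
Proof. exact: vf_smooth. Qed.

(** Multiplying [X] by the cutoff changes nothing at [p], and the product is a combination of global
    fields with global coefficients, to which linearity over functions applies. *)
Lemma nabla_inner_l X Y p : inner p ->
  D X Y p = \sum_l tcoord (X p) i 0 l *: D (frame_field l) Y p.
Proof.
move=> ip; pose Z := vf_scale smooth_cutoff X.
pose F l := vf_scale (smooth_coef X l) (frame_field l).
have -> : D X Y p = D Z Y p.
  by rewrite (nablaZl D Y smooth_cutoff (X := Z) (X1 := X))// cutoff_inner// scale1r.
rewrite (nabla_suml D Y (Z := F)); last exact: cutoff_decomposition.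
apply: eq_bigr => l _.
by rewrite (nablaZl D Y (smooth_coef X l) (X := F l) (X1 := frame_field l))// coef_inner.
Qed.

(** The same decomposition, now in the differentiated field. The Leibniz term of the cutoff vanishes
    because the cutoff is constant near [p]; those of the coefficients assemble into the
    differential of [Y]. *)
Lemma nabla_chart X Y p : inner p -> tcoord (D X Y p) i =
  'd (vf_coord Y) (cmap (A i) p) (tcoord (X p) i) +
  christoffel_form gam (cmap (A i) p) (tcoord (X p) i) (tcoord (Y p) i).
Proof.
move=> ip; have [pi pr] := ip; pose Z := vf_scale smooth_cutoff Y.
pose F l := vf_scale (smooth_coef Y l) (frame_field l).
have -> : D X Y p = D X Z p.
  rewrite (nabla_Leibniz D X smooth_cutoff (Y := Z) (Y1 := Y))//.
  by rewrite dirderiv_cutoff// scale0r add0r cutoff_inner// scale1r.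
rewrite (nabla_sum D X (Z := F)); last exact: cutoff_decomposition.
rewrite tcoord_sum [X in _ = X + _](row_sum_delta) -big_split /=.
apply: eq_bigr => k _.
rewrite (nabla_Leibniz D X (smooth_coef Y k) (Y := F k) (Y1 := frame_field k))//.
rewrite tcoordD !tcoordZ inner_frame_field// dirderiv_coef//; congr (_ + _).
rewrite coef_inner//; congr (_ *: _); rewrite nabla_inner_l// tcoord_sum.
by apply: eq_bigr => l _; rewrite tcoordZ /gam /vf_coord cmapK.
Qed.

End LocalFrame.

(** * Covariant derivative along curves in a chart *)

Section CovariantDerivative.
Variables (R : realType) (m : nat) (M : topologicalType) (A : smooth_atlas R m M).
Variable D : connection A.

(* [G] are Christoffel symbols of [D] in the chart [i], valid on the ball of
   radius [r] around [c]. *)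
Record good_chart (i : chart_index A) (c : 'rV[R]_m) (r : R)
    (G : 'I_m -> 'I_m -> 'rV[R]_m -> 'rV[R]_m) : Prop := GoodChart {
  good_chart_gt0 : 0 < r;
  good_chart_in : forall x, `|x - c| <= r -> cimg (A i) x;
  good_chart_smooth : forall l k, smooth_on (cimg (A i)) (G l k);
  good_chart_covD : forall (gamma : R -> M) (V : forall t, tangent A (gamma t))
      (t : R) (w : tangent A (gamma t)),
    {for t, continuous gamma} -> cdom (A i) (gamma t) ->
    `|cmap (A i) (gamma t) - c| < r ->
    differentiable (cmap (A i) \o gamma : R^o -> _) t ->
    is_covD D V w <->
    is_derive (t : R^o) 1 (fun s => tcoord (V s) i : 'rV[R]_m)
      (tcoord w i - christoffel_form G (cmap (A i) (gamma t))
         ('D_1 (cmap (A i) \o gamma : R^o -> _) t) (tcoord (V t) i))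
}.

Hypothesis hM : hausdorff_space M.

Section InChart.
Variables (i : chart_index A) (c : 'rV[R]_m) (r : R).
Hypothesis r0 : 0 < r.
Hypothesis ball_in : forall x, `|x - c| <= 2 * r -> cimg (A i) x.
Let G := gam hM D r0 ball_in.
Variables (gamma : R -> M) (V : forall t, tangent A (gamma t)) (t : R).
Variable w : tangent A (gamma t).
Hypothesis gc : {for t, continuous gamma}.
Hypothesis gi : inner i c r (gamma t).
Let x : R^o -> 'rV[R]_m := cmap (A i) \o gamma.
Hypothesis xd : differentiable x t.
Let v : R^o -> 'rV[R]_m := fun s => tcoord (V s) i.

Let near_gamma_inner : \forall s \near t, inner i c r (gamma s).
Proof.
have [pi pr] := gi; near=> s; split.
  by near: s; exact: gc (near_cdom pi).
near: s; have xc := differentiable_continuous xd.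
by have := xc _ (near_norm_lt pr).
Unshelve. all: by end_near. Qed.

Let field_along (E : vector_field A) :
  is_derive (t : R^o) 1 (fun s => tcoord (E (gamma s)) i : 'rV[R]_m)
    ('d (vf_coord i E) (x t) ('D_1 x t)).
Proof.
have [pi pr] := gi; have yd := differentiable_vf_coord E pi.
have cd : differentiable (vf_coord i E \o x) t by exact: differentiable_comp.
apply: near_eq_is_derive (_ : is_derive t 1 (vf_coord i E \o x) _).
  apply: filterS near_gamma_inner => s [si _].
  by rewrite /vf_coord /x /= cmapK.
apply: DeriveDef; first exact: diff_derivable.
exact: derive_comp.
Qed.

Lemma covD_chart : is_covD D V w ->
  is_derive (t : R^o) 1 v
    (tcoord w i - christoffel_form G (x t) ('D_1 x t) (v t)).
Proof.
have [pi pr] := gi.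
move=> [n [a [E [X [ad VE Xv wE]]]]].
have vE : \forall s \near t, \sum_j a j s *: tcoord (E j (gamma s)) i = v s.
  by apply: filterS VE => s VsE; rewrite /v VsE tcoord_sum.
have vt : \sum_j a j t *: tcoord (E j (gamma t)) i = v t by exact: nbhs_singleton vE.
apply: near_eq_is_derive vE _.
have XE : tcoord (X (gamma t)) i = 'D_1 x t by rewrite Xv velocityE.
rewrite -vt wE tcoord_sum christoffel_form_sumr -sumrB.
have H j : is_derive (t : R^o) 1
    (fun s : R^o => a j s *: (tcoord (E j (gamma s)) i : 'rV[R]_m))
    (a j t *: 'd (vf_coord i (E j)) (x t) ('D_1 x t) +
     'D_1 (a j) t *: tcoord (E j (gamma t)) i).
  have [Ed EE] := field_along (E j).
  have ajd : differentiable (a j : R^o -> R^o) t by exact/derivable1_diffP.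
  have Ejd := (derivable1_diffP _ _).1 Ed.
  have [sd sE] := differentiable_scale ajd Ejd.
  apply: DeriveDef; first exact: diff_derivable sd.
  by rewrite sE EE.
have := is_derive_sum H.
rewrite (_ : \sum_(j < n) _ = fun s => \sum_j a j s *: tcoord (E j (gamma s)) i);
  last by apply/funext => s; rewrite fct_sumE.
congr (is_derive _ _ _ _); apply: eq_bigr => j _.
rewrite tcoordD !tcoordZ (nabla_chart hM D r0 ball_in)// XE derive1E.
rewrite christoffel_form_scaler scalerDr addrA addrK; exact: addrC.
Qed.

(** The decomposition takes the coordinates of [V] as coefficients of the frame fields. These have
    constant coordinates near the point, so only the Christoffel term of their derivative
    survives. *)
Lemma chart_covD :
  is_derive (t : R^o) 1 v
    (tcoord w i - christoffel_form G (x t) ('D_1 x t) (v t)) -> is_covD D V w.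
Proof.
have [pi pr] := gi; move=> [vd vE].
pose E := frame_field hM r0 ball_in.
pose X := vf_sum (fun l => vf_scale (@smooth_cst _ _ _ A (('D_1 x t) 0 l)) (E l)).
have XE : tcoord (X (gamma t)) i = 'D_1 x t.
  rewrite /X /= tcoord_sum [RHS]row_sum_delta; apply: eq_bigr => l _.
  by rewrite tcoordZ inner_frame_field.
exists m, (fun j s => v s 0 j), E, X; split.
- by move=> j; have [] := derivable_coord j vd.
- apply: filterS near_gamma_inner => s si; have [psi _] := si.
  apply: (tangent_eq psi); rewrite tcoord_sum [LHS]row_sum_delta.
  by apply: eq_bigr => j _; rewrite tcoordZ inner_frame_field.
- have -> : X (gamma t) = Tangent (velocity_tangent gc pi xd).
    by apply: (tangent_eq pi); rewrite XE /= velocityE.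
  by [].
- apply: (tangent_eq pi); rewrite tcoord_sum.
  have -> : tcoord w i = 'D_1 v t + christoffel_form G (x t) ('D_1 x t) (v t).
    by rewrite vE subrK.
  rewrite [X in X + _]row_sum_delta [in christoffel_form _ _ _ (v t)](row_sum_delta (v t)).
  rewrite christoffel_form_sumr -big_split; apply: eq_bigr => j _; rewrite [LHS]/=.
  rewrite tcoordD !tcoordZ (nabla_chart hM D r0 ball_in)// XE derive1E.
  have [_ ->] := derivable_coord j vd.
  rewrite inner_frame_field// christoffel_form_scaler -/G -/(x t).
  rewrite -deriveE; last exact: differentiable_vf_coord.
  rewrite (_ : 'D_('D_1 x t) (vf_coord i (E j)) (x t) = 0) ?add0r//.
  rewrite -[RHS](derive_cst (delta_mx 0 j : 'rV[R]_m) (x t) ('D_1 x t)).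
  apply: near_eq_derive; apply: filterS (near_inner gi) => y [_ _ yi].
  by rewrite /vf_coord inner_frame_field.
Qed.

End InChart.

Lemma good_chart_ex q : exists i r G,
  cdom (A i) q /\ good_chart i (cmap (A i) q) r G.
Proof.
pose i := chart_at A q; have qi : cdom (A i) q by exact: chart_atP.
have : \forall x \near cmap (A i) q, cimg (A i) x.
  by apply: open_nbhs_nbhs; split; [exact: cimg_open|exact: cmap_in_cimg].
move=> /near_closed_ball[r0 r00 Hr].
(* Halved because a bump that is 1 on a ball is supported in the ball of twice the radius. *)
have h0 : 0 < r0 / 2 by exact: divr_gt0.
have ball_in x : `|x - cmap (A i) q| <= 2 * (r0 / 2) -> cimg (A i) x.
  by rewrite mulrC divfK//; exact: Hr.
exists i, (r0 / 2), (gam hM D h0 ball_in); split=> //; split=> //.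
- by move=> x xr; apply: ball_in; apply: le_trans xr _; lra.
- by move=> l k; exact: smooth_gam.
- move=> gamma V t w gc gi gr xd; split; first exact: covD_chart.
  exact: chart_covD.
Qed.

End CovariantDerivative.

(** * Parallel transport *)

HB.instance Definition _ (R : realType) m (G : 'I_m -> 'I_m -> 'rV[R]_m -> 'rV[R]_m) x u :=
  GRing.isLinear.Build R 'rV[R]_m 'rV[R]_m _ (christoffel_form G x u)
    (christoffel_form_linear G x u).

Lemma Ck_christoffel (R : realType) (V : normedModType R) m k (U : set V)
    (O : set 'rV[R]_m) (G : 'I_m -> 'I_m -> 'rV[R]_m -> 'rV[R]_m)
    (x u v : V -> 'rV[R]_m) : open U -> (forall a b, Ck k O (G a b)) ->
  Ck k U x -> (forall t, U t -> O (x t)) -> Ck k U u -> Ck k U v ->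
  Ck k U (fun t => christoffel_form G (x t) (u t) (v t)).
Proof.
move=> oU GC xC xO uC vC.
apply: (@Ck_sum _ _ _ k U m
  (fun b t => v t 0 b *: \sum_a u t 0 a *: G a b (x t)) oU) => b.
apply: (@CkZ _ _ _ k U (fun t => v t 0 b)
  (fun t => \sum_a u t 0 a *: G a b (x t)) oU (Ck_coord 0 b oU vC)).
apply: (@Ck_sum _ _ _ k U m (fun a t => u t 0 a *: G a b (x t)) oU) => a.
apply: (@CkZ _ _ _ k U (fun t => u t 0 a) (G a b \o x) oU (Ck_coord 0 a oU uC)).
exact: Ck_comp (fin_basis_rV _ _) oU xC (GC a b) xO.
Qed.

Section Affine.
Variables (R : realType) (W : normedModType R).

Lemma is_derive_affine (f : R -> W) (s e a u : R) df :
  is_derive (s + e * (u - a) : R^o) 1 f df ->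
  is_derive (u : R^o) 1 (fun u => f (s + e * (u - a))) (e *: df).
Proof.
move=> [fd <-]; pose l : R^o -> R^o := fun u => s + e * (u - a).
have [ld lE] : is_derive (u : R^o) 1 l e.
  have := is_deriveD (is_derive_cst (s : R^o) (u : R^o) 1)
    (is_deriveZ e (is_deriveB (is_derive_id (u : R^o) 1)
      (is_derive_cst (a : R^o) (u : R^o) 1))).
  by rewrite subr0 add0r; congr (is_derive _ _ _ _); exact: mulr1.
have ld' := (derivable1_diffP _ _).1 ld.
have fd' : differentiable (f : R^o -> W) (l u) by exact/derivable1_diffP.
have cd : differentiable (f \o l : R^o -> W) u by exact: differentiable_comp.
apply: DeriveDef; first exact/derivable1_diffP.
rewrite (@derive_comp _ _ _ _ l (f : R^o -> W) _ (1 : R^o) ld' fd') lE.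
rewrite -[in LHS](mulr1 e) -[e * 1]/(e *: (1 : R^o)).
by rewrite linearZ /= deriveE.
Qed.

Lemma smooth_affine (I : set R) (f : R -> W) (s e a : R) : open I ->
  smooth_on I (f : R^o -> W) ->
  let U := (fun u => s + e * (u - a)) @^-1` I in
  open U /\ smooth_on U (fun u : R^o => f (s + e * (u - a))).
Proof.
move=> oI fs; pose l : R^o -> R^o := fun u => s + e * (u - a).
have lC k O : open O -> Ck k O l.
  move=> oO; apply: CkD => //; first exact: Ck_cst.
  apply: CkM => //; first exact: Ck_cst.
  by apply: CkD => //; [exact: Ck_id|exact: Ck_cst].
have oU : open (l @^-1` I).
  have lc x : setT x -> {for x, continuous l} by exact: lC 0%N setT openT x.
  by have := open_preimage_on openT oI lc; rewrite setTI.
split=> // k.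
apply: (@Ck_comp _ _ _ _ k _ I l (f : R^o -> W)) => //.
- exact: fin_basis_regular.
- exact: lC.
Qed.

End Affine.

Section ElementaryTransport.
Variables (R : realType) (m : nat) (M : topologicalType) (A : smooth_atlas R m M).
Variable D : connection A.

(* The parameter interval starts at an arbitrary [a], so that curves can be
   concatenated without reparametrization. *)
Definition elem_transport p q (g : tangent A p -> tangent A q) : Prop :=
  linear g /\ forall a : R, exists (U : set R) (beta : R -> M),
  [/\ open U, `[a, a + 1] `<=` U, smooth_curve A U beta,
      beta a = p /\ beta (a + 1) = q &
      forall v, exists W : forall t, tangent A (beta t),
        [/\ parallel_on D U W, tcoord (W a) = tcoord v &
            tcoord (W (a + 1)) = tcoord (g v)]].

Lemma tcoord_eq i p q (v : tangent A p) (w : tangent A q) : p = q ->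
  cdom (A i) q -> tcoord v i = tcoord w i -> tcoord v = tcoord w.
Proof. by move=> pq; subst q => pi vw; rewrite (tangent_eq pi vw). Qed.

(** Growing the chain at its end matches the gluing of one more curve in [realized_snoc]. *)
Inductive transport p : forall q, (tangent A p -> tangent A q) -> Prop :=
| transport1 q g : elem_transport g -> @transport p q g
| transport_snoc q r g h : @transport p q g ->
    @elem_transport q r h -> @transport p r (h \o g).

Lemma transport_comp p q r g h : @transport p q g -> @transport q r h ->
  transport (h \o g).
Proof.
move=> gT hT; elim: hT => [{}r {}h hE|{}r s {}h k _ IH kE].
  exact: transport_snoc gT hE.
exact: transport_snoc IH kE.
Qed.

Lemma transport_linear p q g : @transport p q g -> linear g.
Proof.
elim=> [{}q {}g []//|{}q r {}g h _ gl [hl _]] a u v.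
by rewrite /= gl hl.
Qed.

(** The inverse is itself required to be a transport, so that paths can be reversed and loops yield
    elements of [GL]. *)
Definition transport_iso p q (g : tangent A p -> tangent A q) g' :=
  [/\ transport g, transport g', cancel g g' & cancel g' g].

Lemma transport_iso_sym p q g g' : @transport_iso p q g g' -> transport_iso g' g.
Proof. by case=> *; split. Qed.

Lemma transport_iso_comp p q r g g' h h' : @transport_iso p q g g' ->
  @transport_iso q r h h' -> transport_iso (h \o g) (g' \o h').
Proof.
move=> [gT gT' gK gK'] [hT hT' hK hK']; split.
- exact: transport_comp gT hT.
- exact: transport_comp hT' gT'.
- exact: can_comp.
- exact: can_comp.
Qed.

Section InChart.
Variables (i : chart_index A) (c : 'rV[R]_m) (r : R).
Variable G : 'I_m -> 'I_m -> 'rV[R]_m -> 'rV[R]_m.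
Hypothesis gG : good_chart D i c r G.
Variables (I : set R) (x : R -> 'rV[R]_m) (t0 d C : R).
Hypothesis oI : open I.
Hypothesis xs : smooth_on I (x : R^o -> 'rV[R]_m).
Hypothesis xin : forall t, I t -> `|x t - c| < r.
Hypothesis Id : forall t, `|t - t0| <= 3 * d -> I t.
Hypothesis d0 : 0 < d.
Hypothesis C0 : 0 <= C.
Hypothesis dC : d * C <= 4^-1.
Hypothesis xC : forall t, `|t - t0| <= 3 * d -> forall v,
  `|christoffel_form G (x t) ('D_1 (x : R^o -> _) t) v| <= C * `|v|.

Let ximg t : I t -> cimg (A i) (x t).
Proof. by move=> /xin/ltW; exact: good_chart_in gG _. Qed.

Definition chart_parallel (y v : R -> 'rV[R]_m) (t : R) :=
  is_derive (t : R^o) 1 v (- christoffel_form G (y t) ('D_1 (y : R^o -> _) t) (v t)).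

Let christoffel_along_continuous t v : I t ->
  {for t, continuous (fun t : R => - christoffel_form G (x t) ('D_1 (x : R^o -> _) t) v)}.
Proof.
move=> It; have oG l k : Ck 0 (cimg (A i)) (G l k) by exact: (good_chart_smooth gG l k 0%N).
have xD : Ck 0 I ('D_1 (x : R^o -> _)) by have [_ ] := xs 1%N; exact.
have vC : Ck 0 I (cst v : R^o -> _) by exact: Ck_cst.
have H := Ck_christoffel oI oG (xs 0%N) ximg xD vC.
have := CkN oI H.
by move=> /(_ t It).
Qed.

(* A solution started at [s] has to reach every [t] with [|t - t0| < d], which is
   at distance at most [2 d] from [s]; this is why data on [3 d] are assumed. *)
Let solution_ex s v0 : `|s - t0| < d -> exists v : R -> 'rV[R]_m,
  v s = v0 /\ forall t, `|t - t0| < d -> chart_parallel x v t.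
Proof.
move=> sd; have near2 (t : R) : `|t - s| <= 2 * d -> `|t - t0| <= 3 * d.
  by move=> ts; have := ler_normD (t - s) (s - t0); rewrite subrKA; lra.
have d20 : 0 < 2 * d by rewrite mulr_gt0.
(* The constant [4^-1] in [dC] is made for this: equations are solved on radius [2 * d]. It serves
   again in [chart_parallel_le], since two times in the interval are at most [2 * d] apart. *)
have d2C : 2 * d * C <= 2^-1 by have := dC; lra.
pose F (t : R) (v : 'rV[R]_m) := - christoffel_form G (x t) ('D_1 (x : R^o -> _) t) v.
have [||v [vs vD]] := @picard R m F s (2 * d) C v0 d20 C0 d2C.
- move=> t y z /near2 td; rewrite /F -opprD normrN -linearB /=.
  exact: xC.
- by move=> t y /near2 td; apply: christoffel_along_continuous; exact: Id.
exists v; split=> // t td; apply: vD.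
by have := ler_normD (t - t0) (t0 - s); rewrite subrKA (distrC t0); lra.
Qed.

Let iI : is_interval [set t : R | `|t - t0| < d] := @is_interval_norm_lt R t0 d.

Lemma chart_parallel_le v : (forall t, `|t - t0| < d -> chart_parallel x v t) ->
  forall s t, `|s - t0| < d -> `|t - t0| < d -> `|v s| <= 2 * `|v t|.
Proof.
move=> vp; apply: (linear_growth_le iI _ C0).
  move=> t td; have [vd ->] := vp _ td; split=> //.
  rewrite normrN; apply: xC; move: td => /= td.
  by have := d0; lra.
move=> s t; rewrite /= => sd td.
have : `|s - t| <= 2 * d.
  by have := ler_normD (s - t0) (t0 - t); rewrite subrKA (distrC t0); lra.
move=> /(ler_wpM2l C0); have := dC; lra.
Qed.

Let chart_parallel_lin (a : R) u v t : chart_parallel x u t ->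
  chart_parallel x v t -> chart_parallel x (fun t => a *: u t + v t) t.
Proof.
move=> up vp; have := is_deriveD (is_deriveZ a up) vp.
by rewrite scalerN -opprD -linearP.
Qed.

Let chart_parallel_uniq u v s : (forall t, `|t - t0| < d -> chart_parallel x u t) ->
  (forall t, `|t - t0| < d -> chart_parallel x v t) -> `|s - t0| < d ->
  u s = v s -> forall t, `|t - t0| < d -> u t = v t.
Proof.
move=> up vp sd usv t td.
have wp (z : R) : `|z - t0| < d -> chart_parallel x (fun t => -1 *: v t + u t) z.
  by move=> zd; apply: chart_parallel_lin; [exact: vp|exact: up].
have := chart_parallel_le wp td sd.
rewrite usv !scaleN1r addNr normr0 mulr0 normr_le0 addrC subr_eq0.
by move=> /eqP.
Qed.

(** [T s t] is the solution operator from time [s] to time [t]. Its linearity and the inverse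
    [T t s] both follow from uniqueness of solutions. *)
Lemma chart_transport : exists T : R -> R -> 'rV[R]_m -> 'rV[R]_m,
  forall s, `|s - t0| < d ->
  [/\ forall u t, `|t - t0| < d -> chart_parallel x (fun t => T s t u) t,
      forall u, T s s u = u,
      forall t, `|t - t0| < d -> linear (T s t) /\ cancel (T s t) (T t s),
      forall t u, `|t - t0| < d -> `|T s t u| <= 2 * `|u| &
      forall v, (forall t, `|t - t0| < d -> chart_parallel x v t) ->
        forall t, `|t - t0| < d -> T s t (v s) = v t].
Proof.
have /boolp.choice[S HS] : forall su : R * 'rV[R]_m, exists v : R -> 'rV[R]_m,
    `|su.1 - t0| < d ->
    v su.1 = su.2 /\ forall t, `|t - t0| < d -> chart_parallel x v t.
  move=> [s u]; have [sd|sd] := pselect (`|s - t0| < d); last by exists (cst 0).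
  by have [v ?] := solution_ex u sd; exists v.
pose T s t u := S (s, u) t.
have Tp s u : `|s - t0| < d -> forall t, `|t - t0| < d ->
    chart_parallel x (fun t => T s t u) t.
  by move=> sd; have [_] := HS (s, u) sd.
have T0 s u : `|s - t0| < d -> T s s u = u.
  by move=> sd; have [] := HS (s, u) sd.
have Tu s v : `|s - t0| < d -> (forall t, `|t - t0| < d -> chart_parallel x v t) ->
    forall t, `|t - t0| < d -> T s t (v s) = v t.
  move=> sd vp t td; apply: (chart_parallel_uniq (Tp s (v s) sd) vp sd _ td).
  exact: T0.
exists T => s sd; split.
- by move=> u t td; exact: Tp.
- by move=> u; exact: T0.
- move=> t td; split.
    move=> a u v.
    have := Tu s (fun t => a *: T s t u + T s t v) sd; rewrite !T0//; apply=> //.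
    by move=> z zd; apply: chart_parallel_lin; exact: Tp.
  by move=> u; rewrite (Tu t (fun z => T s z u))// ?T0//; exact: Tp.
- by move=> t u td; rewrite -[in leRHS](T0 s u sd);
    exact: chart_parallel_le (Tp s u sd) _ _ td sd.
- by move=> v vp t td; exact: Tu.
Qed.

(* The affine change of parameter [u |-> s + (t - s) (u - a)] covers curves run
   forwards, backwards and constant curves alike. *)
Lemma elem_transport_chart (T : R -> 'rV[R]_m -> 'rV[R]_m) s t p q :
  `|s - t0| < d -> `|t - t0| < d ->
  cdom (A i) p -> cdom (A i) q -> cmap (A i) p = x s -> cmap (A i) q = x t ->
  (forall u z, `|z - t0| < d -> chart_parallel x (fun z => T z u) z) ->
  (forall u, T s u = u) -> linear (T t) ->
  elem_transport (fun v : tangent A p => tvec i q (T t (tcoord v i))).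
Proof.
move=> sd td pi qi px qx Tp Ts Tl; split.
  move=> a v w; apply: (tangent_eq qi).
  by rewrite [RHS]tcoordD [in RHS]tcoordZ !tcoord_tvec// -Tl.
move=> a; pose J := [set z : R | `|z - t0| < d].
have oJ : open J by exact: (@open_norm_lt R R^o).
have JI : J `<=` I by move=> z; rewrite /J /= => zd; apply: Id; have := d0; lra.
pose l (u : R) := s + (t - s) * (u - a).
have [oU yS] := smooth_affine s (t - s) a oJ (fun k => Ck_sub JI (xs k)).
set U := (_ @^-1` J) in oU yS.
pose y (u : R) := x (l u); pose beta := cinv (A i) \o y.
have Ui u : U u -> cimg (A i) (y u) by move=> /JI/ximg.
have bs : smooth_curve A U beta by exact: smooth_curve_cinv.
have ba : beta a = p by rewrite /beta /y /l /= subrr mulr0 addr0 -px cmapK.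
have bb : beta (a + 1) = q.
  by rewrite /beta /y /l /= addrAC subrr add0r mulr1 addrC subrK -qx cmapK.
have near_y u : U u -> \forall z \near u, y z = (cmap (A i) \o beta) z.
  move=> Uu; apply: filterS (open_nbhs_nbhs (conj oU Uu)) => z Uz.
  by rewrite /beta /= cinvK//; exact: Ui.
exists U, beta; split=> //.
  move=> u; rewrite /= in_itv /= => /andP[au ua].
  have e0 : 0 <= u - a by rewrite subr_ge0.
  have e1 : u - a <= 1 by lra.
  (* [l u] is a convex combination of [s] and [t]; the case distinction only settles their order. *)
  have [st|ts] := leP s t.
    have st' : 0 <= t - s by rewrite subr_ge0.
    apply: (iI sd td); have := mulr_ge0 st' e0; have := ler_piMr st' e1.
    by move=> *; apply/andP; lra.
  have ts' : 0 <= s - t by rewrite subr_ge0 ltW.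
  apply: (iI td sd); have := mulr_ge0 ts' e0; have := ler_piMr ts' e1.
  by rewrite -(opprB t s) mulNr => *; apply/andP; lra.
move=> v; pose w (u : R) := T (l u) (tcoord v i).
pose W u : tangent A (beta u) := tvec i (beta u) (w u).
have bi u : U u -> cdom (A i) (beta u) by move=> /Ui; exact: cdom_cinv.
have Wi u : U u -> tcoord (W u) i = w u by move=> /bi ?; rewrite tcoord_tvec.
exists W; split.
- move=> u Uu; have yu := nbhs_singleton (near_y u Uu).
  have [bc _] := bs; have [_ bd] := smooth_curve_chart i oU bs.
  apply/(good_chart_covD gG).
  + exact: bc.
  + exact: bi.
  + by rewrite -[cmap _ _]/((cmap (A i) \o beta) u) -yu; apply/xin/JI.
  + by apply: bd => //; exact: bi.
  + rewrite -[cmap _ _]/((cmap (A i) \o beta) u) -yu Wi//.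
    rewrite -(near_eq_derive (1 : R^o) (near_y u Uu)) tcoord0 sub0r.
    apply: near_eq_is_derive (_ : is_derive (u : R^o) 1 w _).
      by apply: filterS (open_nbhs_nbhs (conj oU Uu)) => z /Wi ->.
    (* The derivative of [w] and the velocity of [y] both acquire the factor [t - s], so the
       parallel equation persists, also for [t = s]. *)
    have xd : derivable (x : R^o -> _) (l u) 1.
      by have [+ _] := xs 1%N; move=> /(_ _ (JI _ Uu)) /diff_derivable.
    have [_ ->] := is_derive_affine (derivableP xd).
    have := is_derive_affine (Tp (tcoord v i) _ Uu).
    by rewrite christoffel_form_scalel scalerN.
- apply: (tcoord_eq ba pi); rewrite Wi; first by rewrite /w /l subrr mulr0 addr0 Ts.
  by rewrite /U /= subrr mulr0 addr0.
- apply: (tcoord_eq bb qi); rewrite tcoord_tvec// Wi.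
    by rewrite /w /l addrAC subrr add0r mulr1 addrC subrK.
  by rewrite /U /= addrAC subrr add0r mulr1 addrC subrK.
Qed.

Lemma chart_transport_iso s t p q : `|s - t0| < d -> `|t - t0| < d ->
  cdom (A i) p -> cdom (A i) q -> cmap (A i) p = x s -> cmap (A i) q = x t ->
  exists g g', [/\ @transport_iso p q g g',
    forall u, `|tcoord (g u) i| <= 2 * `|tcoord u i| &
    forall v, (forall z, `|z - t0| < d -> chart_parallel x v z) ->
      forall u, tcoord u i = v s -> tcoord (g u) i = v t].
Proof.
move=> sd td pi qi px qx; have [T HT] := chart_transport.
have [Ts Tss Tst sle Tv] := HT s sd; have [Tt Ttt Tts _ _] := HT t td.
have [Tl TK] := Tst t td; have [Tl' TK'] := Tts s sd.
exists (fun v => tvec i q (T s t (tcoord v i))),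
  (fun v => tvec i p (T t s (tcoord v i))); split; first split.
- apply: transport1.
  exact: (@elem_transport_chart (T s) s t).
- apply: transport1.
  exact: (@elem_transport_chart (T t) t s).
- by move=> v; rewrite tcoord_tvec// TK tvec_tcoord.
- by move=> v; rewrite tcoord_tvec// TK' tvec_tcoord.
- by move=> u; rewrite tcoord_tvec//; exact: sle.
- by move=> v vp u us; rewrite tcoord_tvec// us; exact: Tv.
Qed.

End InChart.

(** * Realization of transports by piecewise smooth curves *)

Section Realization.

Definition glue_curve (a : R) (alpha beta : R -> M) (t : R) :=
  if t <= a then alpha t else beta t.

(** The [return] clause abstracts the test inside the type of the glued curve, so that each branch
    has the type of the field it uses. *)
Definition glue_field (a : R) alpha beta (V : forall t, tangent A (alpha t))
    (W : forall t, tangent A (beta t)) t : tangent A (glue_curve a alpha beta t) :=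
  if t <= a as b return tangent A (if b then alpha t else beta t)
  then V t else W t.

Lemma glue_curve_l a alpha beta t : t <= a -> glue_curve a alpha beta t = alpha t.
Proof. by rewrite /glue_curve => ->. Qed.

Lemma glue_curve_r a alpha beta t : alpha a = beta a -> a <= t ->
  glue_curve a alpha beta t = beta t.
Proof.
move=> ab; rewrite le_eqVlt => /predU1P[<-|at_]; first by rewrite glue_curve_l.
by rewrite /glue_curve leNgt at_.
Qed.

Lemma glue_field_l a alpha beta (V : forall t, tangent A (alpha t))
    (W : forall t, tangent A (beta t)) t : t <= a ->
  tcoord (glue_field a V W t) = tcoord (V t).
Proof. by rewrite /glue_field /glue_curve; case: (t <= a). Qed.

Lemma glue_field_r a alpha beta (V : forall t, tangent A (alpha t))
    (W : forall t, tangent A (beta t)) t : tcoord (V a) = tcoord (W a) ->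
  a <= t -> tcoord (glue_field a V W t) = tcoord (W t).
Proof.
move=> ab; rewrite le_eqVlt => /predU1P[<-|]; first by rewrite glue_field_l.
by rewrite ltNge /glue_field /glue_curve; case: (t <= a).
Qed.

(** Breakpoints are the integers from 0 to [n], so concatenation leaves the earlier subdivision
    unchanged; an elementary transport is appended with [a = n%:R]. *)
Definition realized n p q (g : tangent A p -> tangent A q) := exists alpha : R -> M,
  [/\ alpha 0 = p, alpha n%:R = q,
      forall k, (k < n)%N -> smooth_piece A alpha k%:R k.+1%:R &
      forall v, exists V : forall t, tangent A (alpha t),
        [/\ forall k, (k < n)%N -> parallel_piece D V k%:R k.+1%:R,
            tcoord (V 0) = tcoord v & tcoord (V n%:R) = tcoord (g v)]].

Lemma realized0 p : @realized 0 p p id.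
Proof. by exists (cst p); split=> // v; exists (fun=> v); split. Qed.

Lemma realized_snoc n p q r g h : @realized n p q g -> @elem_transport q r h ->
  realized n.+1 (h \o g).
Proof.
move=> [alpha [a0 an ap aV]] [_ /(_ n%:R)[U [beta [oU Uab bs [ba bb] bW]]]].
have abE : alpha n%:R = beta n%:R by rewrite an.
have n1 : n.+1%:R = n%:R + 1 :> R by rewrite -natr1.
exists (glue_curve n%:R alpha beta); split.
- by rewrite glue_curve_l// ler0n.
- by rewrite glue_curve_r// n1 ?lerDl.
- move=> k; rewrite ltnS leq_eqVlt => /predU1P[->|kn].
    exists U, beta; split=> //; first by rewrite n1.
    by move=> t; rewrite in_itv /= => /andP[nt _]; rewrite glue_curve_r.
  have [U' [b [oU' Uk bs' bE]]] := ap _ kn.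
  exists U', b; split=> // t tk; rewrite bE// glue_curve_l//.
  move: tk; rewrite in_itv /= => /andP[_ /le_trans]; apply.
  by rewrite ler_nat.
- move=> v; have [V [Vp V0 Vn]] := aV v; have [W [Wp Wa Wb]] := bW (g v).
  have VW : tcoord (V n%:R) = tcoord (W n%:R) by rewrite Vn.
  exists (glue_field n%:R V W); split.
  + move=> k; rewrite ltnS leq_eqVlt => /predU1P[->|kn].
      exists U, beta, W; split=> //; first by rewrite n1.
      move=> t; rewrite in_itv /= => /andP[nt _].
      by split; [rewrite glue_curve_r|rewrite glue_field_r].
    have [U' [b [W' [oU' Uk bs' bp bE]]]] := Vp _ kn.
    exists U', b, W'; split=> // t tk; have [e1 e2] := bE t tk.
    have tn : t <= n%:R.
      move: tk; rewrite in_itv /= => /andP[_ /le_trans]; apply.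
      by rewrite ler_nat.
    by split; [rewrite e1 glue_curve_l|rewrite e2 glue_field_l].
  + by rewrite glue_field_l// ler0n.
  + by rewrite glue_field_r ?n1 ?lerDl.
Qed.

(** The successor guarantees the nondegenerate parameter interval that [holonomy] demands. *)
Lemma transport_realized p q g : @transport p q g -> exists n, realized n.+1 g.
Proof.
elim=> [{}q {}g gE|{}q r {}g h _ [n IH] hE].
  by exists 0%N; exact: realized_snoc (realized0 p) gE.
by exists n.+1; exact: realized_snoc IH hE.
Qed.

Lemma transport_iso_holonomy p h h' : @transport_iso p p h h' ->
  exists2 H : GL A p, holonomy D p H & GL_fun H = h.
Proof.
move=> [hT _ hK hK'].
exists (MkGL (transport_linear hT) (Bijective hK hK')) => //.
have [n [alpha [a0 an ap aV]]] := transport_realized hT.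
have sub : subdivision 0 n.+1%:R n.+1 (fun k => k%:R : R).
  by split=> // k _; rewrite ltr_nat.
exists alpha, 0, n.+1%:R; split.
- by rewrite ltr0n.
- by exists n.+1, (fun k => k%:R).
- split=> // v; have [V [Vp V0 Vn]] := aV v.
  by exists V; split=> //; exists n.+1, (fun k => k%:R).
Qed.

End Realization.

End ElementaryTransport.

(** Local constancy makes both [P] and its negation open in [E]. *)
Lemma connected_local_ind (T : topologicalType) (E : set T) (P : T -> Prop) t0 :
  connected E -> open E -> E t0 -> P t0 ->
  (forall t, E t -> \forall s \near t, E s -> (P t <-> P s)) ->
  forall t, E t -> P t.
Proof.
move=> cE oE Et0 Pt0 H t Et; pose B := [set t | E t /\ P t].
have loc s (Q : T -> Prop) : E s -> Q s ->
    (forall u, (P s <-> P u) -> Q u) -> nbhs s [set u | E u /\ Q u].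
  move=> Es Qs HQ; have := open_nbhs_nbhs (conj oE Es).
  by apply: filterS2 (H s Es) => u Hu Eu; split=> //; exact/HQ/Hu.
suff BE : B = E by have := Et; rewrite -{1}BE => -[].
apply: cE; first by exists t0.
- exists B; last by apply/seteqP; split=> s [] // Es [].
  rewrite openE => s [Es Ps]; apply: loc => // u Psu; exact/Psu.
- exists (~` [set s | E s /\ ~ P s]).
    apply: open_closedC; rewrite openE => s [Es nPs].
    by apply: (loc s (fun u => ~ P u)) => // u Psu /Psu.
  apply/seteqP; split=> s [Es]; first by move=> Ps; split=> // -[].
  move=> nPs; split=> //; apply: contrapT => nP; exact: nPs.
Qed.

(** * Transport along radial segments, along curves and between arbitrary points *)

Section TransportConsequences.
Variables (R : realType) (m : nat) (M : topologicalType) (A : smooth_atlas R m M).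
Variable D : connection A.

Lemma near_chart_ball i p c (e : R) : cdom (A i) p -> `|cmap (A i) p - c| < e ->
  \forall q \near p, cdom (A i) q /\ `|cmap (A i) q - c| < e.
Proof.
move=> pi pe; apply: filterI; first exact: near_cdom.
exact: (cmap_continuous_at pi (near_norm_lt pe)).
Qed.

Lemma christoffel_bound i c r G : good_chart D i c r G -> exists e K : R,
  [/\ 0 < e, e <= r, 0 <= K & forall x, `|x - c| <= e -> forall u v,
    `|christoffel_form G x u v| <= K * `|u| * `|v| ].
Proof.
move=> gG; have r0 := good_chart_gt0 gG.
have ci : cimg (A i) c by apply: (good_chart_in gG); rewrite subrr normr0 ltW.
pose K : R := \sum_k \sum_l (`|G l k c| + 1).
have : \forall x \near c, forall k l, `|G l k x| <= `|G l k c| + 1.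
  near=> x => k; move: k; near: x; apply: filter_forall => k.
  near=> x => l; move: l; near: x; apply: filter_forall => l.
  have := Ck_continuous (good_chart_smooth gG l k 0%N) ci.
  by move=> /cvg_norm/cvgr_le; apply; rewrite ltrDl.
move=> /near_closed_ball[e0 e00 H]; exists (Num.min e0 r), K; split.
- by rewrite lt_min e00.
- by rewrite ge_min lexx orbT.
- by apply: sumr_ge0 => k _; apply: sumr_ge0 => l _; rewrite addr_ge0.
move=> x; rewrite le_min => /andP[/H Gx _] u v.
rewrite /christoffel_form (le_trans (ler_norm_sum _ _ _))// !mulr_suml ler_sum// => k _.
rewrite normrZ mulrC ler_pM ?rV_coord_le//.
rewrite (le_trans (ler_norm_sum _ _ _))// mulr_suml ler_sum// => l _.
by rewrite normrZ mulrC ler_pM ?rV_coord_le.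
Unshelve. all: by end_near. Qed.

Lemma radial_transport i q r G : cdom (A i) q ->
  good_chart D i (cmap (A i) q) r G -> exists2 e : R, 0 < e &
  forall p, cdom (A i) p -> `|cmap (A i) p - cmap (A i) q| < e ->
  exists g g', @transport_iso _ _ _ _ D q p g g' /\
    forall u, `|tcoord (g u) i| <= 2 * `|tcoord u i|.
Proof.
set c := cmap (A i) q => qi gG.
have [e [K [e0 er K0 HK]]] := christoffel_bound gG.
(* The segment is run with [t0 = 0] and [d = 2], so that times 0 and 1 are interior. Data are needed
   for |t| <= 3 * d = 6, inside the open interval |t| < 7; the factor 8 yields
   [2 * (K * |w|) <= 4^-1]. *)
pose h := Num.min (e / 7) (8 * (K + 1))^-1.
have K1 : 0 < K + 1 by rewrite ltr_wpDl.
exists h; first by rewrite lt_min divr_gt0// invr_gt0 mulr_gt0.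
move=> p pi; set w := cmap (A i) p - c => wh.
have w7 : 7 * `|w| < e.
  by rewrite mulrC -ltr_pdivlMr// (lt_le_trans wh)// ge_min lexx.
have wK : 8 * (K * `|w|) <= 1.
  have : `|w| <= (8 * (K + 1))^-1.
    by rewrite (le_trans (ltW wh))// ge_min lexx orbT.
  rewrite -[_^-1]mul1r ler_pdivlMr ?mulr_gt0//; have := normr_ge0 w; nra.
pose x (t : R) := c + t *: w; pose I := [set t : R | `|t - 0| < 7].
have xdist (t : R) : `|x t - c| = `|t| * `|w|.
  by rewrite /x addrC addKr normrZ.
have xD t : is_derive (t : R^o) 1 (x : R^o -> _) w.
  have xd : is_diff (t : R^o) (x : R^o -> _) (fun s : R^o => s *: w).
    by apply: is_diff_eq; rewrite add0r.
  have xd' := ex_diff (is_diff_def := xd).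
  apply: DeriveDef; first exact: diff_derivable.
  by rewrite deriveE// diff_val scale1r.
have oI : open I by exact: (@open_norm_lt R R^o).
have xs : smooth_on I (x : R^o -> _).
  move=> k; apply: CkD => //; first exact: Ck_cst.
  by apply: CkZ => //; [exact: Ck_id|exact: Ck_cst].
have xin t : I t -> `|x t - c| < r.
  rewrite /I /= subr0 xdist => t7; apply: lt_le_trans er; apply: le_lt_trans w7.
  by rewrite ler_wpM2r// ltW.
have Id t : `|t - 0| <= 3 * 2 -> I t.
  by rewrite /I /=; move=> t6; apply: le_lt_trans t6 _; lra.
have C0 : 0 <= K * `|w| by rewrite mulr_ge0.
have dC : 2 * (K * `|w|) <= 4^-1 by lra.
have xC t : `|t - 0| <= 3 * 2 -> forall v,
    `|christoffel_form G (x t) ('D_1 (x : R^o -> _) t) v| <= K * `|w| * `|v|.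
  move=> t6 v; have [_ ->] := xD t; apply: HK.
  rewrite subr0 in t6; rewrite xdist; apply: le_trans (ltW w7).
  by rewrite ler_wpM2r// (le_trans t6)//; lra.
have d0 : 0 < 2 :> R by [].
have z0 : `|0 - 0 : R| < 2 by rewrite subrr normr0.
have z1 : `|1 - 0 : R| < 2 by rewrite subr0 normr1 ltr1n.
have x0 : c = x 0 by rewrite /x scale0r addr0.
have x1 : cmap (A i) p = x 1 by rewrite /x scale1r addrC subrK.
have [g [g' [gg gl _]]] :=
  chart_transport_iso gG oI xs xin Id d0 C0 dC xC z0 z1 qi pi x0 x1.
by exists g, g'.
Qed.

(** For a short time [gamma] stays in one good chart with bounded speed. There [V] solves the linear
    equation, and uniqueness identifies it with the transported vector. *)
Lemma along_transport (J : set R) (gamma : R -> M)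
    (V : forall t, tangent A (gamma t)) t0 :
  hausdorff_space M -> open J -> smooth_curve A J gamma -> parallel_on D J V ->
  J t0 -> exists2 d : R, 0 < d & forall t, `|t - t0| < d -> J t /\
  exists g g', @transport_iso _ _ _ _ D (gamma t0) (gamma t) g g' /\
    g (V t0) = V t.
Proof.
move=> hM oJ gs VP Jt0.
have [i [r [G [qi gG]]]] := good_chart_ex D hM (gamma t0).
set c := cmap (A i) (gamma t0) in gG.
have [e [K [e0 er K0 HK]]] := christoffel_bound gG.
pose x := cmap (A i) \o gamma : R^o -> 'rV[R]_m.
pose U := J `&` gamma @^-1` cdom (A i).
have [oU xd] := smooth_curve_chart i oJ gs.
have xs : smooth_on U x by have [_] := gs; exact.
pose I := U `&` x @^-1` [set y | `|y - c| < e].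
have oI : open I.
  by apply: (open_preimage_on oU (open_norm_lt c e)); exact: xs 0%N.
have It0 : I t0 by split; [split|rewrite /= subrr normr0].
pose C := `|'D_1 x t0| + 1.
have C0 : 0 < C by rewrite ltr_wpDl.
have : \forall t \near t0, I t /\ `|'D_1 x t| <= C.
  apply: filterI; first exact: open_nbhs_nbhs.
  have [_ /(_ 1) xD] := xs 1%N.
  by have /cvg_norm/cvgr_le := xD t0 (proj1 It0); apply; rewrite ltrDl.
move=> /nbhs_normP[d1 /= d10 Hd1].
have KC : 0 < 4 * (K * C) + 1 by rewrite ltr_wpDl// !mulr_ge0// ltW.
(* The first term puts the radius [3 * d] inside [d1], the second gives [d * (K * C) <= 4^-1]. *)
pose d := Num.min (d1 / 4) (4 * (K * C) + 1)^-1.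
have d0 : 0 < d by rewrite lt_min divr_gt0// invr_gt0.
have Hd t : `|t - t0| <= 3 * d -> I t /\ `|'D_1 x t| <= C.
  move=> td; apply: Hd1; rewrite /= distrC; apply: le_lt_trans td _.
  have : d <= d1 / 4 by rewrite ge_min lexx.
  by have := d10; lra.
have Id t : `|t - t0| <= 3 * d -> I t by move=> /Hd[].
have KC0 : 0 <= K * C by rewrite mulr_ge0// ltW.
have dC : d * (K * C) <= 4^-1.
  have : d <= (4 * (K * C) + 1)^-1 by rewrite ge_min lexx orbT.
  rewrite -[_^-1]mul1r ler_pdivlMr//; have := d0; nra.
have xC t : `|t - t0| <= 3 * d -> forall v,
    `|christoffel_form G (x t) ('D_1 x t) v| <= K * C * `|v|.
  move=> /Hd[[_ /= xe] xC] v; apply: le_trans (HK _ (ltW xe) _ _) _.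
  by rewrite ler_wpM2r// ler_wpM2l.
have xin t : I t -> `|x t - c| < r by move=> [_ /= xe]; exact: lt_le_trans er.
have xsI : smooth_on I x by move=> k; apply: Ck_sub (xs k); exact: subIsetl.
have close t : `|t - t0| < d -> I t.
  by move=> td; apply: Id; apply: le_trans (ltW td) _; lra.
exists d => // t td; have [[Jt ti] _] := close t td; split=> //.
have t0d : `|t0 - t0| < d by rewrite subrr normr0.
have [g [g' [gg _ gV]]] :=
  chart_transport_iso gG oI xsI xin Id d0 KC0 dC xC t0d td qi ti erefl erefl.
exists g, g'; split=> //; apply: (tangent_eq ti).
apply: (gV (fun s => tcoord (V s) i)) => // z /close Iz; have [[Jz zi] _] := Iz.
have [gc _] := gs.
have := (good_chart_covD gG V 0 (gc z Jz) zi (xin z Iz) (xd z Jz zi)).1 (VP z Jz).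
by rewrite tcoord0 sub0r.
Qed.

Lemma interval_transport (J : set R) (gamma : R -> M)
    (V : forall t, tangent A (gamma t)) t0 :
  hausdorff_space M -> open J -> is_interval J ->
  smooth_curve A J gamma -> parallel_on D J V ->
  J t0 -> forall t, J t ->
  exists g g', @transport_iso _ _ _ _ D (gamma t0) (gamma t) g g' /\
    g (V t0) = V t.
Proof.
move=> hM oJ iJ gs VP Jt0.
have along t : J t -> \forall s \near t, exists g g',
    @transport_iso _ _ _ _ D (gamma t) (gamma s) g g' /\ g (V t) = V s.
  move=> Jt; have [d d0 H] := along_transport hM oJ gs VP Jt.
  by apply/nbhs_normP; exists d => //= s; rewrite /= distrC => /H[].
have cJ : connected J by exact/connected_intervalP.
apply: (connected_local_ind cJ oJ Jt0).
  (* [transport] has no constructor for the identity; going out and back replaces it. *)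
  have [g [g' [[gT gT' gK gK'] gV]]] := nbhs_singleton (along t0 Jt0).
  exists (g' \o g), (g' \o g); split; last by rewrite /= gK.
  have gg : transport_iso D g g' by split.
  exact: transport_iso_comp gg (transport_iso_sym gg).
move=> t Jt; apply: filterS (along t Jt) => s [h [h' [hh hV]]] Js.
split=> -[g [g' [gg gV]]].
  by exists (h \o g), (g' \o h'); split; [exact: transport_iso_comp gg hh|rewrite /= gV].
exists (h' \o g), (g' \o h); split.
  exact: transport_iso_comp gg (transport_iso_sym hh).
by rewrite /= gV -hV; case: hh => _ _ ->.
Qed.

Lemma connected_transport p q : hausdorff_space M -> connected [set: M] ->
  exists g g', @transport_iso _ _ _ _ D p q g g'.
Proof.
move=> hM cM.
have rad t : \forall s \near t, exists g g', @transport_iso _ _ _ _ D t s g g'.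
  have [i [r [G [ti gG]]]] := good_chart_ex D hM t.
  have [e e0 H] := radial_transport ti gG.
  have te : `|cmap (A i) t - cmap (A i) t| < e by rewrite subrr normr0.
  apply: filterS (near_chart_ball ti te) => s [si se].
  by have [g [g' [gg _]]] := H s si se; exists g, g'.
apply: (@connected_local_ind M setT (fun q => exists g g',
  @transport_iso _ _ _ _ D p q g g') p cM openT) => //.
  have [g [g' gg]] := nbhs_singleton (rad p); exists (g' \o g), (g' \o g).
  exact: transport_iso_comp gg (transport_iso_sym gg).
move=> t _; apply: filterS (rad t) => s [h [h' hh]] _.
split=> -[g [g' gg]].
  by exists (h \o g), (g' \o h'); exact: transport_iso_comp gg hh.
by exists (h' \o g), (g' \o h); exact: transport_iso_comp gg (transport_iso_sym hh).
Qed.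

End TransportConsequences.

(** * Bounds from the holonomy group *)

Section HolonomyBound.
Variables (R : realType) (m : nat) (M : topologicalType) (A : smooth_atlas R m M).
Variable D : connection A.

Lemma frame_expansion p (v : tangent A p) :
  v = \sum_k tcoord v (chart_at A p) 0 k *: frame A p k.
Proof.
have pc := chart_atP A p; apply: (tangent_eq pc); rewrite tcoord_sum.
rewrite [LHS]row_sum_delta; apply: eq_bigr => k _; rewrite tcoordZ.
congr (_ *: _); rewrite /= /frame_coord asboolT//.
by rewrite transition_id_diff.
Qed.

Lemma linear_frame_expansion p q (g : tangent A p -> tangent A q) v : linear g ->
  g v = \sum_k tcoord v (chart_at A p) 0 k *: g (frame A p k).
Proof.
move=> gl; pose gM := GRing.isLinear.Build _ _ _ _ _ gl.
pose gL : {linear tangent A p -> tangent A q} := HB.pack g gM.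
rewrite -[g]/(gL : _ -> _) [in LHS](frame_expansion v) linear_sum.
by apply: eq_bigr => k _; rewrite linearZ.
Qed.

Lemma linear_tangent_le p q (g : tangent A p -> tangent A q) i : linear g ->
  exists2 K, 0 <= K & forall v,
  `|tcoord (g v) i| <= K * `|tcoord v (chart_at A p)|.
Proof.
move=> gl; exists (\sum_k `|tcoord (g (frame A p k)) i|); first exact: sumr_ge0.
move=> v; rewrite (linear_frame_expansion v gl) tcoord_sum.
rewrite (le_trans (ler_norm_sum _ _ _))// mulr_suml ler_sum// => k _.
by rewrite tcoordZ normrZ mulrC ler_wpM2l// rV_coord_le.
Qed.

(** The topology of [GL] makes the matrix map continuous, so the matrices of the closure form a
    compact, hence bounded, set. The factor [m] comes from summing over the frame. *)
Lemma holonomy_bound p : compact (closure (holonomy D p)) -> exists2 K : R,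
  0 <= K & forall H, holonomy D p H -> forall v,
  `|tcoord (GL_fun H v) (chart_at A p)| <= K * `|tcoord v (chart_at A p)|.
Proof.
move=> cpt; have gc : continuous (@GL_mx R m M A p) by exact: initial_continuous.
have : compact (@GL_mx R m M A p @` closure (holonomy D p)).
  by apply: continuous_compact => //; exact: continuous_subspaceT.
move=> /compact_bounded/pinfty_ex_gt0[B B0 HB].
exists (m%:R * B); first by rewrite mulr_ge0// ltW.
move=> H hH v; have := HB (GL_mx H) _; rewrite /= => HB'.
have {}HB' : `|GL_mx H| <= B by apply: HB'; exists H => //; exact: subset_closure.
rewrite (linear_frame_expansion v (@GL_linear _ _ _ _ _ H)) tcoord_sum.
rewrite (le_trans (ler_norm_sum _ _ _))//.
apply: le_trans (_ : \sum_(k < m) (B * `|tcoord v (chart_at A p)|) <= _); last first.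
  by rewrite sumr_const card_ord mulr_natl mulrnAl.
apply: ler_sum => k _; rewrite tcoordZ normrZ mulrC.
apply: ler_pM => //; last exact: rV_coord_le.
apply: rV_norm_le => [|l]; first exact: ltW.
have := HB'; rewrite [leLHS]/Num.norm /= mx_normrE.
have := @le_bigmax _ _ _ 0 (fun kl : 'I_m * 'I_m => `|GL_mx H kl.1 kl.2|) (k, l).
by rewrite /= mxE => /le_trans; apply.
Qed.

(* [V t] is the image of a fixed vector at [p] under the holonomy of the loop from
   [p] to [gamma t0], along [gamma] to [gamma t], radially to [q] and back to [p],
   followed by two maps with bounds independent of [t]. *)
Lemma velocity_bound p (J : set R) (gamma : R -> M)
    (V : forall t, tangent A (gamma t)) t0 q i r G :
  hausdorff_space M -> connected [set: M] -> compact (closure (holonomy D p)) ->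
  open J -> is_interval J -> smooth_curve A J gamma -> parallel_on D J V -> J t0 ->
  cdom (A i) q -> good_chart D i (cmap (A i) q) r G ->
  exists e C : R, [/\ 0 < e, 0 <= C & forall t, J t -> cdom (A i) (gamma t) ->
    `|cmap (A i) (gamma t) - cmap (A i) q| < e -> `|tcoord (V t) i| <= C].
Proof.
move=> hM cM cpt oJ iJ gs VP Jt0 qi gG.
have [e e0 He] := radial_transport qi gG.
have [a [a' aa]] := connected_transport D p (gamma t0) hM cM.
have [b [b' bb]] := connected_transport D p q hM cM.
have [K K0 HK] := holonomy_bound cpt.
have [bT _ bK bK'] := bb.
have [K' K'0 HK'] := linear_tangent_le i (transport_linear bT).
pose w0 := a' (V t0); pose C := 2 * (K' * (K * `|tcoord w0 (chart_at A p)|)).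
exists e, C; split=> //; first by rewrite !mulr_ge0.
move=> t Jt ti te.
have [s [s' [ss sV]]] := interval_transport hM oJ iJ gs VP Jt0 Jt.
have [l [l' [ll lle]]] := He _ ti te.
have hh := transport_iso_comp (transport_iso_comp (transport_iso_comp aa ss)
  (transport_iso_sym ll)) (transport_iso_sym bb).
have [H hH HE] := transport_iso_holonomy hh.
have [_ _ _ aK'] := aa; have [_ _ _ lK'] := ll.
(* [b] and [l] undo the last two legs of the loop; [H], [b] and [l] contribute the factors [K], [K']
   and 2 to [C]. *)
have -> : V t = l (b (GL_fun H w0)).
  by rewrite HE /= bK' lK' /w0 aK' sV.
apply: le_trans (lle _) _; rewrite /C ler_wpM2l//.
apply: le_trans (HK' _) _; rewrite ler_wpM2l//.
exact: HK.
Qed.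

End HolonomyBound.

Section RowBlocks.
Variables (R : realType) (m n : nat).

Lemma rV_row_mx_le (u : 'rV[R]_m) (v : 'rV[R]_n) (e : R) : 0 <= e ->
  `|u| <= e -> `|v| <= e -> `|row_mx u v| <= e.
Proof.
move=> e0 ue ve; apply: rV_norm_le => // j; rewrite mxE.
by case: (fintype.split j) => k; [exact: le_trans (rV_coord_le _ _) ue|
  exact: le_trans (rV_coord_le _ _) ve].
Qed.

Lemma is_derive_row_mx (V : normedModType R) (f : V -> 'rV[R]_m)
    (g : V -> 'rV[R]_n) x v df dg : is_derive x v f df -> is_derive x v g dg ->
  is_derive x v (fun y => row_mx (f y) (g y)) (row_mx df dg).
Proof.
move=> [fd <-] [gd <-]; apply: is_derive_coord => j; rewrite mxE.
under eq_fun do rewrite mxE.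
by case: (fintype.split j) => k; exact: derivable_coord.
Qed.

End RowBlocks.

(** * The geodesic equation *)

Section GeodesicEquation.
Variables (R : realType) (m : nat) (O : set 'rV[R]_m).
Variable G : 'I_m -> 'I_m -> 'rV[R]_m -> 'rV[R]_m.
Hypothesis oO : open O.
Hypothesis Gs : forall l k, smooth_on O (G l k).

(** The geodesic spray: the left block of [z] is the position, the right block the velocity. *)
Definition geodesic_rhs (z : 'rV[R]_(m + m)) : 'rV[R]_(m + m) :=
  row_mx (rsubmx z) (- christoffel_form G (lsubmx z) (rsubmx z) (rsubmx z)).

Definition phase_dom : set 'rV[R]_(m + m) := [set z | O (lsubmx z)].

Let lsub_smooth k (U : set 'rV[R]_(m + m)) :
  Ck k U (lsubmx : 'rV[R]_(m + m) -> 'rV[R]_m).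
Proof. by apply: Ck_linear => z; exact: continuous_lsubmx. Qed.

Let rsub_smooth k (U : set 'rV[R]_(m + m)) :
  Ck k U (rsubmx : 'rV[R]_(m + m) -> 'rV[R]_m).
Proof. by apply: Ck_linear => z; exact: continuous_rsubmx. Qed.

Lemma open_phase_dom : open phase_dom.
Proof.
have lc z : setT z -> {for z, continuous (lsubmx : 'rV[R]_(m + m) -> 'rV[R]_m)}.
  by move=> _; exact: continuous_lsubmx.
by have := open_preimage_on openT oO lc; rewrite setTI.
Qed.

Lemma smooth_geodesic_rhs : smooth_on phase_dom geodesic_rhs.
Proof.
move=> k; have oP := open_phase_dom.
have cC : Ck k phase_dom (fun z => - christoffel_form G (lsubmx z) (rsubmx z) (rsubmx z)).
  apply: CkN => //; apply: (@Ck_christoffel _ _ _ k phase_dom O) => //.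
  by move=> l j; exact: Gs.
apply: Ck_row => // j; rewrite /geodesic_rhs.
have -> : (fun z => row_mx (rsubmx z)
    (- christoffel_form G (lsubmx z) (rsubmx z) (rsubmx z)) 0 j : R^o) =
  match fintype.split j with
  | inl a => fun z => rsubmx z 0 a : R^o
  | inr b => fun z => (- christoffel_form G (lsubmx z) (rsubmx z) (rsubmx z)) 0 b : R^o
  end by apply/funext => z; rewrite mxE; case: (fintype.split j).
case: (fintype.split j) => a.
- exact: (@Ck_coord _ _ _ _ k phase_dom rsubmx 0 a oP (rsub_smooth _ _)).
- exact: (Ck_coord 0 a oP cC).
Qed.

Definition geodesic_at (y : R -> 'rV[R]_m) (t : R) :=
  derivable (y : R^o -> _) t 1 /\
  chart_parallel G y ('D_1 (y : R^o -> _)) t.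

Lemma geodesic_phase y t : geodesic_at y t ->
  is_derive (t : R^o) 1 (fun s => row_mx (y s) ('D_1 (y : R^o -> _) s))
    (geodesic_rhs (row_mx (y t) ('D_1 (y : R^o -> _) t))).
Proof.
move=> [yd yp]; rewrite /geodesic_rhs row_mxKl row_mxKr.
exact: is_derive_row_mx (derivableP yd) yp.
Qed.

(** The equation is nonlinear, but by the Lipschitz bound the difference of two phase curves
    satisfies |w'| <= L |w|, which is all that [linear_growth_le] needs. *)
Lemma geodesic_unique (I : set R) y1 y2 t : open I -> I t ->
  (forall s, I s -> [/\ O (y1 s), geodesic_at y1 s & geodesic_at y2 s]) ->
  y1 t = y2 t -> 'D_1 (y1 : R^o -> _) t = 'D_1 (y2 : R^o -> _) t ->
  \forall s \near t, y1 s = y2 s.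
Proof.
move=> oI It H yE dyE.
pose z1 s := row_mx (y1 s) ('D_1 (y1 : R^o -> _) s).
pose z2 s := row_mx (y2 s) ('D_1 (y2 : R^o -> _) s).
have [Oy1 g1 g2] := H t It.
have Oz : phase_dom (z1 t) by rewrite /phase_dom /z1 /= row_mxKl.
have [r [L [r0 L0 _ _ Flip]]] :=
  local_lipschitz open_phase_dom Oz (smooth_geodesic_rhs 1%N).
have zc (z : R -> 'rV[R]_(m + m)) : is_derive (t : R^o) 1 z (geodesic_rhs (z t)) ->
    z t = z1 t ->
    \forall s \near t, `|z s - z1 t| < r.
  move=> [/derivable_continuous zc _] zt.
  have ztr : `|z t - z1 t| < r by rewrite zt subrr normr0.
  exact: (zc _ (near_norm_lt ztr)).
have z21 : z2 t = z1 t by rewrite /z1 /z2 yE dyE.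
have : \forall s \near t, [/\ I s, `|z1 s - z1 t| < r & `|z2 s - z1 t| < r].
  have n1 := zc z1 (geodesic_phase g1) erefl.
  have n2 := zc z2 (geodesic_phase g2) z21.
  have n3 := open_nbhs_nbhs (conj oI It).
  by apply: filterS3 n3 n1 n2 => s a b c; exact: And3 a b c.
move=> /nbhs_normP[d0 /= d00 Hd].
(* Two times in [J] are at most [2 * d] apart, and [2 * d * L <= 2^-1]. *)
pose d := Num.min d0 (4 * (L + 1))^-1.
have L1 : 0 < L + 1 by rewrite ltr_wpDl.
have d_gt0 : 0 < d by rewrite lt_min d00 invr_gt0 mulr_gt0.
pose J := [set s : R | `|s - t| < d].
have JH s : J s -> [/\ I s, `|z1 s - z1 t| < r & `|z2 s - z1 t| < r].
  by move=> /= sd; apply: Hd; rewrite /= distrC (lt_le_trans sd)// ge_min lexx.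
have iJ : is_interval J by exact: is_interval_norm_lt.
have dL : 4 * (L * d) <= 1.
  have : d <= (4 * (L + 1))^-1 by rewrite ge_min lexx orbT.
  rewrite -[_^-1]mul1r ler_pdivlMr ?mulr_gt0//; have := d_gt0; nra.
pose w : R -> 'rV[R]_(m + m) := fun s => z1 s - z2 s.
have grow (s : R) : J s -> derivable (w : R^o -> _) s 1 /\
    `|'D_1 (w : R^o -> _) s| <= L * `|w s|.
  move=> /JH[Is s1 s2]; have [_ h1 h2] := H s Is.
  have [dd ->] := is_deriveB (geodesic_phase h1) (geodesic_phase h2).
  exact: conj dd (Flip _ _ (ltW s1) (ltW s2)).
have small s u : J s -> J u -> L * `|s - u| <= 2^-1.
  rewrite /J /= => sd ud; have : `|s - u| <= 2 * d.
    by have := ler_normD (s - t) (t - u); rewrite subrKA (distrC t); lra.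
  by move=> /(ler_wpM2l L0); lra.
have Jt : J t by rewrite /J /= subrr normr0.
have eqz s : J s -> z1 s = z2 s.
  move=> Js; have := linear_growth_le iJ grow L0 small Js Jt.
  by rewrite /w z21 subrr normr0 mulr0 normr_le0 subr_eq0 => /eqP.
apply: filterS (near_norm_lt (_ : `|t - t| < d)).
  by move=> s /eqz /(congr1 lsubmx); rewrite !row_mxKl.
by rewrite subrr normr0.
Qed.

Lemma geodesic_ex c (C : R) : O c -> 0 <= C -> exists r e : R, [/\ 0 < r, 0 < e &
  forall x1 v1, `|x1 - c| <= r -> `|v1| <= C -> exists y : R -> 'rV[R]_m,
    [/\ y 0 = x1, 'D_1 (y : R^o -> _) 0 = v1,
        smooth_on [set t : R | `|t| < e] (y : R^o -> _) &
        forall t, `|t| < e -> O (y t) /\ geodesic_at y t] ].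
Proof.
move=> Oc C0; pose c0 := row_mx c (0 : 'rV[R]_m).
have Oc0 : phase_dom c0 by rewrite /phase_dom /= row_mxKl.
have [r [e [L [r0 e0 L0 _ flow]]]] :=
  local_flow open_phase_dom Oc0 (smooth_geodesic_rhs 1%N).
(* Time is slowed down by [k] so that the initial velocity falls in the ball of
   radius [r / 2] provided by the flow near the zero velocity. *)
pose k := 2 * (C + 1) / r.
have C1 : 0 < C + 1 by rewrite ltr_wpDl.
have k0 : 0 < k by rewrite divr_gt0// mulr_gt0.
exists (r / 2), (e / k); split; [exact: divr_gt0|exact: divr_gt0|].
move=> x1 v1 x1c v1C.
have [|z [z0 zD]] := flow (row_mx x1 (k^-1 *: v1)).
  rewrite /c0 opp_row_mx add_row_mx subr0; apply: rV_row_mx_le => //.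
    by rewrite ltW// divr_gt0.
  rewrite normrZ gtr0_norm ?invr_gt0// mulrC ler_pdivrMr// /k.
  rewrite (_ : r / 2 * (2 * (C + 1) / r) = C + 1); last by field; rewrite gt_eqF.
  by rewrite (le_trans v1C)// lerDl.
pose I := [set t : R | `|t| < e].
have oI : open I by have := @open_norm_lt R R^o 0 e; under eq_set do rewrite subr0.
have zs : smooth_on I (z : R^o -> _).
  apply: (flow_smooth oI smooth_geodesic_rhs) => t /zD[zd Oz _]; split=> //.
pose y (t : R) := lsubmx (z (k * t)).
have kt (t : R) : `|t| < e / k -> `|k * t| < e.
  by rewrite ltr_pdivlMr// normrM (gtr0_norm k0) mulrC.
have zl (t : R) : k * t = 0 + k * (t - 0) by rewrite add0r subr0.
have zkD (t : R) : `|t| < e / k ->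
    is_derive (t : R^o) 1 (fun t => z (k * t)) (k *: geodesic_rhs (z (k * t))).
  move=> /kt kte; have [zd _ _] := zD _ kte.
  have := @is_derive_affine _ _ z 0 k 0 t (geodesic_rhs (z (k * t))).
  by rewrite -zl; under eq_fun do rewrite -zl; exact.
have yD (t : R) : `|t| < e / k -> is_derive (t : R^o) 1 y (k *: rsubmx (z (k * t))).
  move=> te; have [zd zE] := zkD t te; apply: is_derive_coord => j.
  have [zjd zjE] := derivable_coord (lshift m j) zd.
  rewrite /y; under eq_fun do rewrite mxE.
  apply: DeriveDef => //.
  by rewrite zjE zE [LHS]mxE [RHS]mxE /geodesic_rhs row_mxEl.
have near_e (t : R) : `|t| < e / k -> \forall s \near t, `|s| < e / k.
  by move=> te; have := @near_norm_lt R R^o 0 t (e / k); rewrite subr0 => /(_ te);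
    apply: filterS => s; rewrite subr0.
have y2D (t : R) : `|t| < e / k -> is_derive (t : R^o) 1 ('D_1 (y : R^o -> _))
    (- christoffel_form G (y t) ('D_1 (y : R^o -> _) t) ('D_1 (y : R^o -> _) t)).
  move=> te; have [_ yE] := yD t te.
  apply: near_eq_is_derive (_ : is_derive (t : R^o) 1 (fun s => k *: rsubmx (z (k * s))) _).
    by apply: filterS (near_e t te) => s se; have [_ ->] := yD s se.
  have [zd zE] := zkD t te.
  (* The Christoffel term is quadratic in the velocity; its two factors [k] match those produced by
     differentiating twice in the rescaled time. *)
  rewrite yE christoffel_form_scalel christoffel_form_scaler -scalerN -scalerN.
  apply: is_deriveZ; apply: is_derive_coord => j.
  have [zjd zjE] := derivable_coord (rshift m j) zd.
  under eq_fun do rewrite mxE.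
  apply: DeriveDef => //.
  by rewrite zjE zE [LHS]mxE [RHS]mxE /geodesic_rhs row_mxEr.
exists y; split.
- by rewrite /y mulr0 z0 row_mxKl.
- have [|_ ->] := yD 0; first by rewrite normr0 divr_gt0.
  by rewrite mulr0 z0 row_mxKr scalerA divff ?scale1r// gt_eqF.
- have [oU zas] := smooth_affine 0 k 0 oI zs.
  have -> : y = lsubmx \o (fun u => z (0 + k * (u - 0))).
    by apply/funext => t; rewrite /y /= -zl.
  move=> j; apply: (@Ck_sub _ _ _ _ _ _ _ _ (Ck_comp_linear oU _ (zas j))).
    by move=> t te; rewrite /= -zl; exact: kt.
  exact: continuous_lsubmx.
- move=> t te; have [_ Oz _] := zD _ (kt t te); split=> //; split; last exact: y2D.
  by have [] := yD t te.
Qed.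

End GeodesicEquation.

(** * Locality of the geodesic condition *)

Section GeodesicLocality.
Variables (R : realType) (m : nat) (M : topologicalType) (A : smooth_atlas R m M).
Variable D : connection A.
Implicit Types (gamma beta : R -> M).

(** Even where the curves agree, the two fields have different types; this lemma is the passage
    between them, and it is stated for the derivative 0, which exists in both. *)
Lemma covD_near gamma beta (V : forall t, tangent A (gamma t))
    (W : forall t, tangent A (beta t)) t :
  (\forall s \near t, gamma s = beta s /\ tcoord (V s) = tcoord (W s)) ->
  is_covD D V (0 : tangent A (gamma t)) -> is_covD D W (0 : tangent A (beta t)).
Proof.
move=> near_eq [n [a [E [X [ad VE Xv w0]]]]].
have [gb _] := nbhs_singleton near_eq.
have tE (Y : vector_field A) p q : p = q -> tcoord (Y p) = tcoord (Y q) by move=> ->.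
exists n, a, E, X; split=> //.
- apply: filterS2 near_eq VE => s [gbs VW] VsE; apply: tcoord_inj; rewrite -VW VsE.
  apply/funext => i; rewrite !tcoord_sum; apply: eq_bigr => j _.
  by rewrite !tcoordZ (tE _ _ _ gbs).
- rewrite -(tE _ _ _ gb) Xv; apply/funext => i; rewrite /velocity gb.
  case: asboolP => // ti; rewrite !derive1E; apply: near_eq_derive.
  by apply: filterS near_eq => s [gbs _]; rewrite /= gbs.
- apply: tcoord_inj; apply/funext => i.
  apply: etrans (congr1 (fun v => tcoord v i) w0) _.
  rewrite !tcoord_sum; apply: eq_bigr => j _.
  by rewrite !tcoordD !tcoordZ (tE _ _ _ gb) (tE (D X (E j)) _ _ gb).
Qed.

Lemma velocity_near gamma beta t : (\forall s \near t, gamma s = beta s) ->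
  @velocity R m M A gamma t = velocity beta t.
Proof.
move=> near_eq; have gb := nbhs_singleton near_eq.
apply/funext => i; rewrite /velocity gb; case: asboolP => // ti.
rewrite !derive1E; apply: near_eq_derive.
by apply: filterS near_eq => s gbs; rewrite /= gbs.
Qed.

(** A total field attached to every curve; the default 0 occurs only at times where the velocity is
    not a tangent vector. *)
Definition velocity_field gamma t : tangent A (gamma t) :=
  match pselect (@velocity R m M A gamma t \in is_tangent (A := A) (gamma t)) with
  | left vt => Tangent vt
  | right _ => 0
  end.

Lemma tcoord_velocity_field (U : set R) gamma t : open U -> smooth_curve A U gamma ->
  U t -> tcoord (velocity_field gamma t) = velocity gamma t.
Proof.
move=> oU gs Ut; have [gc _] := gs.
have [_ gd] := smooth_curve_chart (chart_at A (gamma t)) oU gs.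
have ti := chart_atP A (gamma t).
rewrite /velocity_field; case: pselect => // -[].
exact: velocity_tangent (gc t Ut) ti (gd t Ut ti).
Qed.

(** With neither an interval condition nor an existential field, this form can be checked on an open
    cover of [U]. *)
Definition geodesic_on (U : set R) gamma := smooth_curve A U gamma /\
  forall t, U t -> is_covD D (velocity_field gamma) (0 : tangent A (gamma t)).

Lemma geodesic_onP (U : set R) gamma : open_interval U ->
  geodesic D U gamma <-> geodesic_on U gamma.
Proof.
move=> iU; have [oU _ _] := iU; split=> [[_ gs [V [Vv Vp]]]|[gs gp]].
  split=> // t Ut; apply: covD_near (Vp t Ut).
  apply: filterS (open_nbhs_nbhs (conj oU Ut)) => s Us; split=> //.
  by rewrite (tcoord_velocity_field oU gs Us) Vv.
split=> //; exists (velocity_field gamma); split=> // t Ut.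
exact: tcoord_velocity_field oU gs Ut.
Qed.

Lemma geodesic_on_local (U : set R) gamma :
  (forall t, U t -> exists N beta, [/\ open N, N t, geodesic_on N beta &
    forall s, N s -> gamma s = beta s]) -> geodesic_on U gamma.
Proof.
move=> H; split; first split.
- move=> t /H[N [beta [oN Nt [[bc _] _] gb]]].
  rewrite /prop_for /continuous_at (gb t Nt); apply: cvg_trans (bc t Nt).
  apply: near_eq_cvg; apply: filterS (open_nbhs_nbhs (conj oN Nt)) => s Ns.
  by rewrite gb.
- move=> i k; apply: Ck_local => t [Ut ti].
  have [N [beta [oN Nt [bs _] gb]]] := H t Ut.
  have [oNi _] := smooth_curve_chart i oN bs; have [_ bsi] := bs.
  exists (N `&` beta @^-1` cdom (A i)), (cmap (A i) \o beta); split=> //.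
  + by split=> //; rewrite /preimage /= -gb.
  + exact: bsi.
  + by move=> s [Ns _]; rewrite /= gb.
move=> t Ut; have [N [beta [oN Nt [bs bp] gb]]] := H t Ut.
have Nn := open_nbhs_nbhs (conj oN Nt).
apply: covD_near (bp t Nt); apply: filterS Nn => s Ns; split; first by rewrite gb.
rewrite (tcoord_velocity_field oN bs Ns).
have sn : \forall u \near s, beta u = gamma u.
  by apply: filterS (open_nbhs_nbhs (conj oN Ns)) => u Nu; rewrite gb.
rewrite (velocity_near sn) /velocity_field; case: pselect => // -[].
rewrite -(velocity_near sn) gb//.
by rewrite -(tcoord_velocity_field oN bs Ns); exact: tcoordP.
Qed.

Lemma geodesic_on_chart (I : set R) i c r G (y : R -> 'rV[R]_m) :
  open I -> good_chart D i c r G -> smooth_on I (y : R^o -> _) ->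
  (forall t, I t -> `|y t - c| < r /\ geodesic_at G y t) ->
  geodesic_on I (cinv (A i) \o y).
Proof.
move=> oI gG ys yg.
have yi t : I t -> cimg (A i) (y t).
  by move=> /yg[/ltW + _]; exact: good_chart_in gG _.
have sc : smooth_curve A I (cinv (A i) \o y) by exact: smooth_curve_cinv.
split=> // t It; have [yr [yd yp]] := yg t It.
have ci s : I s -> cdom (A i) ((cinv (A i) \o y) s) by move=> /yi; exact: cdom_cinv.
have yE s : I s -> \forall u \near s, y u = (cmap (A i) \o (cinv (A i) \o y)) u.
  move=> Is; apply: filterS (open_nbhs_nbhs (conj oI Is)) => u /yi yu.
  by rewrite /= cinvK.
have [gc _] := sc; have [_ gd] := smooth_curve_chart i oI sc.
have Vi s : I s -> tcoord (velocity_field (cinv (A i) \o y) s) i = 'D_1 (y : R^o -> _) s.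
  move=> Is; rewrite (tcoord_velocity_field oI sc Is) velocityE; last exact: ci.
  by apply/esym; apply: near_eq_derive; exact: yE.
apply/(good_chart_covD gG).
- exact: gc.
- exact: ci.
- by rewrite /= cinvK//; exact: yi.
- by apply: gd => //; exact: ci.
have E1 : cmap (A i) ((cinv (A i) \o y) t) = y t by apply: cinvK; exact: yi.
have E2 := near_eq_derive (1 : R^o) (yE t It).
rewrite tcoord0 sub0r (Vi t It) E1 -E2.
apply: near_eq_is_derive yp.
by apply: filterS (open_nbhs_nbhs (conj oI It)) => s Is; rewrite Vi.
Qed.

Lemma geodesic_on_geodesic_at (J : set R) gamma i c r G t :
  open J -> good_chart D i c r G -> geodesic_on J gamma -> J t ->
  cdom (A i) (gamma t) -> `|cmap (A i) (gamma t) - c| < r ->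
  \forall s \near t, [/\ J s, cdom (A i) (gamma s),
    `|cmap (A i) (gamma s) - c| < r & geodesic_at G (cmap (A i) \o gamma) s].
Proof.
move=> oJ gG [gs gp] Jt ti tr; have [gc _] := gs.
have [oU gd] := smooth_curve_chart i oJ gs.
have near_in s : J s -> cdom (A i) (gamma s) -> `|cmap (A i) (gamma s) - c| < r ->
    \forall u \near s, [/\ J u, cdom (A i) (gamma u) & `|cmap (A i) (gamma u) - c| < r].
  move=> Js si sr; have n1 : \forall u \near s,
      cdom (A i) (gamma u) /\ `|cmap (A i) (gamma u) - c| < r.
    exact: gc s Js _ (near_chart_ball si sr).
  by apply: filterS2 n1 (open_nbhs_nbhs (conj oJ Js)) => u [ui ur] Ju; exact: And3.
apply: filterS (near_in t Jt ti tr) => s [Js si sr]; split=> //.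
have sd := gd s Js si; split; first exact/derivable1_diffP.
have := (good_chart_covD gG (velocity_field gamma) 0 (gc s Js) si sr sd).1 (gp s Js).
have Vi u : J u -> cdom (A i) (gamma u) ->
    tcoord (velocity_field gamma u) i = 'D_1 (cmap (A i) \o gamma : R^o -> _) u.
  by move=> Ju ui; rewrite (tcoord_velocity_field oJ gs Ju) velocityE.
rewrite tcoord0 sub0r Vi//; apply: near_eq_is_derive.
by apply: filterS (near_in s Js si sr) => u [Ju ui _]; rewrite Vi.
Qed.

End GeodesicLocality.

(** * Extension of geodesics *)

Section Extension.
Variables (R : realType) (m : nat) (M : topologicalType) (A : smooth_atlas R m M).
Variable D : connection A.
Hypothesis hM : hausdorff_space M.

(** Connectedness of the overlap, applied to equality of points and velocities. [gamma] may leave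
    the chart, so neither half of the open-and-closed argument takes place in the chart alone. *)
Lemma geodesic_coincide (J I : set R) gamma i c r G (y : R -> 'rV[R]_m) t1 :
  open J -> is_interval J -> open I -> is_interval I -> J t1 -> I t1 ->
  good_chart D i c r G -> geodesic_on D J gamma -> smooth_on I (y : R^o -> _) ->
  (forall t, I t -> `|y t - c| < r /\ geodesic_at G y t) ->
  gamma t1 = cinv (A i) (y t1) ->
  'D_1 (cmap (A i) \o gamma : R^o -> _) t1 = 'D_1 (y : R^o -> _) t1 ->
  forall t, J t -> I t -> gamma t = cinv (A i) (y t).
Proof.
move=> oJ iJ oI iI Jt1 It1 gG gJ ys yg g1 d1 t Jt It.
pose x := cmap (A i) \o gamma : R -> 'rV[R]_m.
have [gs _] := gJ; have [gc gsm] := gs.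
have yi s : I s -> cimg (A i) (y s).
  by move=> /yg[/ltW + _]; exact: good_chart_in gG _.
have [sc _] : smooth_curve A I (cinv (A i) \o y) by exact: smooth_curve_cinv.
pose E := J `&` I; pose P s := gamma s = cinv (A i) (y s) /\
  'D_1 (x : R^o -> _) s = 'D_1 (y : R^o -> _) s.
suff [] : P t by [].
have cE : connected E.
  apply/connected_intervalP => u v [Ju Iu] [Jv Iv] z uzv.
  by split; [exact: iJ uzv|exact: iI uzv].
apply: (@connected_local_ind _ E P t1 cE (openI oJ oI)) => // s [Js Is].
(* Distinct points have disjoint neighbourhoods, so the curves stay apart nearby. *)
have [gys|gys] := pselect (gamma s = cinv (A i) (y s)); last first.
  have := hM; rewrite open_hausdorff => /(_ _ _ (introN eqP gys)).
  move=> [[B C] /= [/set_mem Bg /set_mem Cy] [oB oC /eqP BC]].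
  have nB : \forall u \near s, B (gamma u) by exact: gc s Js _ (open_nbhs_nbhs (conj oB Bg)).
  have nC : \forall u \near s, C (cinv (A i) (y u)).
    exact: sc s Is _ (open_nbhs_nbhs (conj oC Cy)).
  apply: filterS2 nB nC => u Bu Cu _; split=> -[gu _]; first by case: gys.
  have : (B `&` C) (gamma u) by split=> //; rewrite gu.
  by rewrite BC.
have si : cdom (A i) (gamma s) by rewrite gys; exact/cdom_cinv/yi.
have xsE : x s = y s by rewrite /x /= gys cinvK//; exact: yi.
have [ysr _] := yg s Is.
have xsr : `|x s - c| < r by rewrite xsE.
have nx := geodesic_on_geodesic_at oJ gG gJ Js si xsr.
have nI := open_nbhs_nbhs (conj oI Is).
(* Equal data: uniqueness for the equation gives equality nearby. *)
have [dE|dE] := pselect ('D_1 (x : R^o -> _) s = 'D_1 (y : R^o -> _) s).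
  have [e /= e0 He] : \forall u \near s, [/\ I u, J u, cdom (A i) (gamma u),
      `|x u - c| < r & geodesic_at G x u].
    by apply: filterS2 nI nx => u Iu [Ju ui ur gu]; exact: And5 Iu Ju ui ur gu.
  pose I0 := [set u : R | `|u - s| < e].
  have oI0 : open I0 by exact: (@open_norm_lt R R^o).
  have I0s : I0 s by rewrite /I0 /= subrr normr0.
  have H u : I0 u -> [/\ I u, J u, cdom (A i) (gamma u),
      `|x u - c| < r & geodesic_at G x u].
    by move=> us; apply: He; rewrite /ball_ /= distrC.
  have H' u : I0 u -> [/\ cimg (A i) (x u), geodesic_at G x u & geodesic_at G y u].
    move=> /H[Iu _ ui _ gu]; have [_ gyu] := yg u Iu.
    exact: And3 (cmap_in_cimg ui) gu gyu.
  have := geodesic_unique (@cimg_open _ _ _ (A i)) (good_chart_smooth gG) oI0 I0s H' xsE dE.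
  move=> xy; have := nbhs_interior xy.
  have nI0 := open_nbhs_nbhs (conj oI0 I0s).
  apply: filterS2 nI0 => u I0u xyu _; have [_ _ ui _ _] := H u I0u.
  have gyu : gamma u = cinv (A i) (y u).
    by rewrite -(nbhs_singleton xyu) /x /= cmapK.
  have Pu : P u := conj gyu (near_eq_derive (1 : R^o) xyu).
  have Ps : P s := conj gys dE.
  by split=> _; [exact: Pu|exact: Ps].
(* Equal points with different velocities: by continuity the velocities still differ nearby. *)
have [oU xd] := smooth_curve_chart i oJ gs.
have xDc : {for s, continuous ('D_1 (x : R^o -> _))}.
  have [_ /(_ 1) xD] := gsm i 1%N; exact: (xD s (conj Js si)).
have yDc : {for s, continuous ('D_1 (y : R^o -> _))}.
  have [_ /(_ 1) yD] := ys 1%N; exact: (yD s Is).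
have dn0 : 'D_1 (x : R^o -> _) s - 'D_1 (y : R^o -> _) s != 0.
  by rewrite subr_eq0; apply/eqP.
pose w (u : R) := 'D_1 (x : R^o -> _) u - 'D_1 (y : R^o -> _) u.
have wc : {for s, continuous w} by apply: cvgB; [exact: xDc|exact: yDc].
have ws : `|w s - w s| < `|w s| by rewrite subrr normr0 normr_gt0.
have nz : \forall u \near s, `|w u - w s| < `|w s| by exact: wc _ (near_norm_lt ws).
apply: filterS nz => u du _; split=> -[_ e]; first by case: dE.
have wu0 : w u = 0 by apply/eqP; rewrite subr_eq0; apply/eqP; exact: e.
by exfalso; move: du; rewrite wu0 sub0r normrN ltxx.
Qed.

(** A boundary point outside [J] plays the part of a finite end, left and right alike. *)
Lemma boundary_point (J : set R) : open J -> J !=set0 -> J <> setT ->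
  exists2 b, closure J b & ~ J b.
Proof.
move=> oJ J0 JT; apply: contrapT => H; apply: JT.
have cJ : closed J by move=> b cb; apply: contrapT => nb; apply: H; exists b.
have cT : connected [set: R] by apply/connected_intervalP.
by apply: cT => //; exists J => //; rewrite setTI.
Qed.

Lemma boundary_cluster (J : set R) (gamma : R -> M) b : compact [set: M] ->
  closure J b -> exists q : M, forall (N : set M) (e : R), nbhs q N -> 0 < e ->
  exists t, [/\ J t, `|t - b| < e & N (gamma t)].
Proof.
move=> kM cJb; pose F := gamma @ within J (nbhs b).
have FF : ProperFilter F by apply: fmap_proper_filter; exact: within_nbhs_proper.
have [q [_ qF]] := kM F FF filterT.
exists q => N e nN e0.
have FB : F (gamma @` [set t | J t /\ `|t - b| < e]).
  rewrite /F /= /nbhs /= /within /=.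
  have : \forall t \near b, `|t - b| < e.
    by apply: (@near_norm_lt R R^o); rewrite subrr normr0.
  by apply: filterS => t tb Jt; exists t.
have [_ [[t [Jt tb] <-] Nt]] := qF _ _ FB nN.
by exists t.
Qed.

End Extension.

Theorem theorem1p1 (R : realType) (m : nat) (M : topologicalType)
    (A : smooth_atlas R m M) (nabla : connection A) (p : M) :
  hausdorff_space M -> connected [set: M] -> compact [set: M] ->
  compact (closure (holonomy nabla p)) ->
  geodesically_complete nabla.
Proof.
move=> hM cM kM cpt J gamma [gJ maxJ]; apply: contrapT => JT.
have [oiJ gs [V [Vv Vp]]] := gJ; have [oJ iJ J0] := oiJ.
have gon := (geodesic_onP nabla gamma oiJ).1 gJ.
have [b cJb nJb] := boundary_point oJ J0 JT.
have [q qcl] := boundary_cluster gamma kM cJb.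
have [i [r [G [qi gG]]]] := good_chart_ex nabla hM q.
set c := cmap (A i) q in gG.
have [t0 Jt0] := J0.
have [e1 [C [e10 C0 HC]]] := velocity_bound hM cM cpt oJ iJ gs Vp Jt0 qi gG.
(* The ball on which [G] represents the connection; solutions are confined to it rather than to the
   whole chart image. *)
pose O := [set x : 'rV[R]_m | `|x - c| < r].
have oO : open O by exact: open_norm_lt.
have r0 := good_chart_gt0 gG.
have Oc : O c by rewrite /O /= subrr normr0.
have Gs l k : smooth_on O (G l k).
  move=> j; apply: Ck_sub (good_chart_smooth gG l k j) => x /ltW.
  exact: good_chart_in gG _.
have [e2 [e [e20 e0 Hex]]] := geodesic_ex oO Gs Oc C0.
pose e3 := Num.min e1 e2; have e30 : 0 < e3 by rewrite lt_min e10.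
have cc : `|cmap (A i) q - c| < e3 by rewrite subrr normr0.
(* The time [t1] comes last: the lifetime [e] depends on [q] and [C] only, so [t1] can be taken
   within [e] of [b]. *)
have [t1 [Jt1 t1b [t1i t1c]]] := qcl _ _ (near_chart_ball qi cc) e0.
pose x := cmap (A i) \o gamma : R -> 'rV[R]_m.
have x1c : `|x t1 - c| <= e2 by rewrite ltW// (lt_le_trans t1c)// ge_min lexx orbT.
have v1C : `|'D_1 (x : R^o -> _) t1| <= C.
  have <- : tcoord (V t1) i = 'D_1 (x : R^o -> _) t1 by rewrite Vv// velocityE.
  by apply: HC => //; rewrite (lt_le_trans t1c)// ge_min lexx.
have [y0 [y00 dy0 y0s y0g]] := Hex _ _ x1c v1C.
pose I := [set t : R | `|t - t1| < e].
have oI : open I by exact: (@open_norm_lt R R^o).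
have iI : is_interval I by exact: is_interval_norm_lt.
have It1 : I t1 by rewrite /I /= subrr normr0.
(* A translation in time, written in the shape expected by the lemmas on affine
   reparametrization. *)
pose y (t : R) := y0 (0 + 1 * (t - t1)).
have sh (t : R) : 0 + 1 * (t - t1) = t - t1 by rewrite add0r mul1r.
have ys : smooth_on I (y : R^o -> _).
  have oe : open [set t : R | `|t| < e].
    by have := @open_norm_lt R R^o 0 e; under eq_set do rewrite subr0.
  have [_ ysm] := smooth_affine 0 1 t1 oe y0s.
  by move=> k; apply: Ck_sub (ysm k) => t It; rewrite /= sh.
have yD (t : R) : I t -> is_derive (t : R^o) 1 y ('D_1 (y0 : R^o -> _) (t - t1)).
  move=> It; have [_ [yd _]] := y0g _ It.
  have := @is_derive_affine _ _ y0 0 1 t1 t ('D_1 (y0 : R^o -> _) (t - t1)).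
  by rewrite sh scale1r; apply; exact: derivableP.
have yg t : I t -> `|y t - c| < r /\ geodesic_at G y t.
  move=> It; have [yO [yd yp]] := y0g _ It; rewrite -sh in yO.
  split; first exact: yO.
  have [yd' yE] := yD t It; split; first exact: yd'.
  apply: near_eq_is_derive
    (_ : is_derive (t : R^o) 1 (fun t => 'D_1 (y0 : R^o -> _) (0 + 1 * (t - t1))) _).
    by apply: filterS (open_nbhs_nbhs (conj oI It)) => u Iu; have [_ ->] := yD u Iu; rewrite sh.
  rewrite yE /y sh.
  have := @is_derive_affine _ _ ('D_1 (y0 : R^o -> _)) 0 1 t1 t
    (- christoffel_form G (y0 (t - t1)) ('D_1 (y0 : R^o -> _) (t - t1))
       ('D_1 (y0 : R^o -> _) (t - t1))).
  by rewrite sh scale1r; apply.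
have y1 : y t1 = x t1 by rewrite /y sh subrr.
have g1 : gamma t1 = cinv (A i) (y t1) by rewrite y1 /x /= cmapK.
have d1 : 'D_1 (x : R^o -> _) t1 = 'D_1 (y : R^o -> _) t1.
  by have [_ ->] := yD t1 It1; rewrite subrr dy0.
have agree := geodesic_coincide hM oJ iJ oI iI Jt1 It1 gG gon ys yg g1 d1.
(* By [agree] this equals the chart geodesic on all of [I], so it is a geodesic on each of two open
   sets covering its domain. *)
pose gamma' t := if pselect (J t) is left _ then gamma t else cinv (A i) (y t).
have gJ' t : J t -> gamma' t = gamma t by rewrite /gamma'; case: pselect.
have gI' t : I t -> gamma' t = cinv (A i) (y t).
  by rewrite /gamma'; case: pselect => // Jt It; exact: agree.
have oiU : open_interval (J `|` I).
  split; [exact: openU| |by exists t1; left].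
  apply/connected_intervalP; apply: connectedU.
  - by exists t1.
  - exact/connected_intervalP.
  - exact/connected_intervalP.
have gU : geodesic_on nabla (J `|` I) gamma'.
  apply: geodesic_on_local => t [Jt|It].
    by exists J, gamma; split.
  exists I, (cinv (A i) \o y); split=> //.
  exact: geodesic_on_chart oI gG ys yg.
(* Maximality leaves no room for [I], which contains [b] because |t1 - b| < e. *)
have JIE := maxJ _ _ ((geodesic_onP nabla gamma' oiU).2 gU) (@subsetUl _ J I) gJ'.
by apply: nJb; rewrite -JIE; right; rewrite /I /= distrC.
Qed.
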